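(* On the Lie algebras $\mathfrak{n}_{7,3,C}$, $\mathfrak{n}_{7,3,D}$ and $\mathfrak{n}_{7,3,D_1}$ there exist purely coclosed $\mathrm{G}_2$-structures inducing a nilsoliton metric, while the nilsoliton metrics on $\mathfrak{n}_{6,3}\oplus\mathbb{R}$, $\mathfrak{n}_{7,3,A}$, $\mathfrak{n}_{7,3,B}$ and $\mathfrak{n}_{7,3,B_1}$ are not induced by any purely coclosed $\mathrm{G}_2$-structure.
   Context: Real Lie algebras are described by the tuple $(\mathrm{d}f^1,\dots,\mathrm{d}f^7)$ for a basis $\{f^i\}$ of the dual, with $f^{ij}=f^i\wedge f^j$: $\mathfrak{n}_{6,3}\oplus\mathbb{R}=(0,0,0,0,f^{12},f^{13},f^{23})$, $\mathfrak{n}_{7,3,A}=(0,0,0,0,f^{12},f^{23},f^{24})$, $\mathfrak{n}_{7,3,B}=(0,0,0,0,f^{12},f^{23},f^{34})$, $\mathfrak{n}_{7,3,B_1}=(0,0,0,0,f^{12}-f^{34},f^{13}+f^{24},f^{14})$, $\mathfrak{n}_{7,3,C}=(0,0,0,0,f^{12}+f^{34},f^{23},f^{24})$, $\mathfrak{n}_{7,3,D}=(0,0,0,0,f^{12}+f^{34},f^{13},f^{24})$, $\mathfrak{n}_{7,3,D_1}=(0,0,0,0,f^{12}-f^{34},f^{13}+f^{24},f^{14}-f^{23})$. $\mathrm{d}$ is the Chevalley-Eilenberg differential ($\mathrm{d}\alpha(x,y)=-\alpha([x,y])$ for $\alpha\in\mathfrak{n}^*$, extended as a graded derivation of $\Lambda^\bullet\mathfrak{n}^*$).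 A nilsoliton metric on a nilpotent Lie algebra $\mathfrak{n}$ is an inner product $g$ whose Ricci endomorphism (that of the corresponding left-invariant Riemannian metric on the simply connected Lie group with Lie algebra $\mathfrak{n}$) is of the form $\mathrm{Rc}(g)=\lambda\,\mathrm{Id}+D$ for some $\lambda\in\mathbb{R}$ and some derivation $D$ of $\mathfrak{n}$; it is known to be unique up to automorphism and scaling when it exists. A $\mathrm{G}_2$-structure on a $7$-dimensional real vector space $V$ is a $3$-form $\varphi\in\Lambda^3V^*$ such that $(v\lrcorner\varphi)\wedge(v\lrcorner\varphi)\wedge\varphi\neq0$ for all $v\in V\smallsetminus\{0\}$. It determines a unique inner product $g_\varphi$ and orientation, with volume form $\mathrm{vol}_\varphi$, such that $g_\varphi(v,w)\mathrm{vol}_\varphi=\frac16\,(v\lrcorner\varphi)\wedge(w\lrcorner\varphi)\wedge\varphi$; $*_\varphi$ is the corresponding Hodge operator. $\varphi$ induces $g$ if $g_\varphi=g$. A $\mathrm{G}_2$-structure $\varphi$ on $\mathfrak{n}$ is purely coclosed if $\mathrm{d}*_\varphi\varphi=0$ and $\mathrm{d}\varphi\wedge\varphi=0$. *)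

(* Defs.v *)
From HB Require Import structures.
From mathcomp Require Import all_boot all_order all_algebra.
From mathcomp Require Import reals.

Set Implicit Arguments.
Unset Strict Implicit.
Unset Printing Implicit Defensive.

Import Order.TTheory GRing.Theory Num.Theory.
Local Open Scope ring_scope.

(* The Lie algebras live on V = R^7, written 'rV[R]_7, whose standard basis is
   dual to f^1, ..., f^7.  Matrices act on row vectors from the right. *)

(* Elements of the exterior algebra of V^*, by coefficients: the coefficient at
   S = {i1 < ... < ik} is that of f^{i1} /\ ... /\ f^{ik}.
   R^o (rather than R) provides scaling. *)
Notation ext_alg R := {ffun {set 'I_7} -> R^o}.

Definition monomial (R : realType) (S : {set 'I_7}) : ext_alg R :=
  [ffun T => (T == S)%:R].

Definition homog (R : realType) (k : nat) (a : ext_alg R) : Prop :=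
  forall S : {set 'I_7}, a S != 0 -> #|S| = k.

(* f^S /\ f^T = shuffle_sign S T f^(S :|: T) for disjoint S and T *)
Definition shuffle_sign (R : realType) (S T : {set 'I_7}) : R :=
  (-1) ^+ #|[set p in setX S T | (p.2 < p.1)%N]|.

Definition wedge (R : realType) (a b : ext_alg R) : ext_alg R :=
  [ffun U : {set 'I_7} => \sum_(S : {set 'I_7} | S \subset U)
     shuffle_sign R S (U :\: S) * a S * b (U :\: S)].

(* interior product v _| a, where (v _| a)(w, ...) = a(v, w, ...) *)
Definition iprod (R : realType) (v : 'rV[R]_7) (a : ext_alg R) : ext_alg R :=
  [ffun S : {set 'I_7} => \sum_(i | i \notin S)
     shuffle_sign R [set i] S * v 0 i * a (i |: S)].

(* A Lie algebra is given by its structure equations L = (df^1, ..., df^7). *)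
Notation structure_eqs R := (7.-tuple (ext_alg R)).

(* df^k(x, y) = - f^k([x, y]); the coefficient at set0 is the scalar part. *)
Definition bracket (R : realType) (L : structure_eqs R) (x y : 'rV[R]_7) :
    'rV[R]_7 :=
  \row_k - iprod y (iprod x (tnth L k)) set0.

(* Chevalley-Eilenberg differential: the graded derivation with f^k |-> L_k.
   The 2-form df^i is moved to the front of the product. *)
Definition ext_d (R : realType) (L : structure_eqs R) (a : ext_alg R) :
    ext_alg R :=
  \sum_(S : {set 'I_7}) a S *: \sum_(i in S)
    shuffle_sign R [set i] (S :\ i) *: wedge (tnth L i) (monomial R (S :\ i)).

(* Metrics are given by their Gram matrices in the standard basis. *)
Definition metric (R : realType) (G : 'M[R]_7) (v w : 'rV[R]_7) : R :=
  (v *m G *m w^T) 0 0.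

Definition inner_product (R : realType) (G : 'M[R]_7) : Prop :=
  G^T = G /\ forall v : 'rV[R]_7, v != 0 -> 0 < metric G v v.

(* Metric induced on forms: < f^S, f^T > is the determinant of the
   (< f^i, f^j >)_(i in S, j in T), and < f^i, f^j > = (G^-1)_ij.
   Forms of different degrees are orthogonal. *)
Definition gram_minor (R : realType) (G : 'M[R]_7) (S T : {set 'I_7}) : R :=
  \det (\matrix_(i < #|S|, j < #|S|)
    invmx G (nth ord0 (enum S) i) (nth ord0 (enum T) j)).

Definition form_inner (R : realType) (G : 'M[R]_7) (a b : ext_alg R) : R :=
  \sum_(S : {set 'I_7}) \sum_(T : {set 'I_7} | #|T| == #|S|)
    a S * b T * gram_minor G S T.

(* One of the two volume forms of G; the choice is the orientation. *)
Definition volume_form (R : realType) (G : 'M[R]_7) (vol : ext_alg R) : Prop :=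
  homog 7 vol /\ form_inner G vol vol = 1.

(* Hodge operator of (G, vol); see wedge_hodge *)
Definition hodge (R : realType) (G : 'M[R]_7) (vol b : ext_alg R) : ext_alg R :=
  [ffun S : {set 'I_7} => shuffle_sign R (~: S) S *
     form_inner G (monomial R (~: S)) b * vol [set: 'I_7]].

Definition G2_structure (R : realType) (phi : ext_alg R) : Prop :=
  homog 3 phi /\ forall v : 'rV[R]_7, v != 0 ->
    wedge (wedge (iprod v phi) (iprod v phi)) phi != 0.

(* G = g_phi and vol = vol_phi *)
Definition G2_metric_volume (R : realType) (phi : ext_alg R) (G : 'M[R]_7)
    (vol : ext_alg R) : Prop :=
  [/\ inner_product G, volume_form G vol &
      forall v w : 'rV[R]_7, (metric G v w : R) *: vol =
        6%:R^-1 *: wedge (wedge (iprod v phi) (iprod w phi)) phi].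

Definition induces (R : realType) (phi : ext_alg R) (G : 'M[R]_7) : Prop :=
  exists vol : ext_alg R, G2_metric_volume phi G vol.

Definition purely_coclosed (R : realType) (L : structure_eqs R)
    (phi : ext_alg R) : Prop :=
  [/\ G2_structure phi,
      exists (G : 'M[R]_7) (vol : ext_alg R),
        G2_metric_volume phi G vol /\ ext_d L (hodge G vol phi) = 0 &
      wedge (ext_d L phi) phi = 0].

(* Koszul formula for left-invariant fields: 2 g(nabla_x y, z) *)
Definition koszul (R : realType) (L : structure_eqs R) (G : 'M[R]_7)
    (x y z : 'rV[R]_7) : R :=
  metric G (bracket L x y) z - metric G (bracket L y z) x
    + metric G (bracket L z x) y.

Definition levi_civita (R : realType) (L : structure_eqs R) (G : 'M[R]_7)
    (x y : 'rV[R]_7) : 'rV[R]_7 :=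
  (\row_k (2%:R^-1 * koszul L G x y (delta_mx 0 k))) *m invmx G.

Definition curvature (R : realType) (L : structure_eqs R) (G : 'M[R]_7)
    (x y z : 'rV[R]_7) : 'rV[R]_7 :=
  levi_civita L G x (levi_civita L G y z)
    - levi_civita L G y (levi_civita L G x z)
    - levi_civita L G (bracket L x y) z.

(* trace of x |-> curvature x y z *)
Definition ricci (R : realType) (L : structure_eqs R) (G : 'M[R]_7)
    (y z : 'rV[R]_7) : R :=
  \sum_(i < 7) curvature L G (delta_mx 0 i) y z 0 i.

(* metric G (y *m ricci_endo L G) z = ricci L G y z *)
Definition ricci_endo (R : realType) (L : structure_eqs R) (G : 'M[R]_7) :
    'M[R]_7 :=
  (\matrix_(i, j) ricci L G (delta_mx 0 i) (delta_mx 0 j)) *m invmx G.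

Definition derivation (R : realType) (L : structure_eqs R) (D : 'M[R]_7) :
    Prop :=
  forall x y : 'rV[R]_7,
    bracket L x y *m D = bracket L (x *m D) y + bracket L x (y *m D).

Definition nilsoliton (R : realType) (L : structure_eqs R) (G : 'M[R]_7) :
    Prop :=
  inner_product G /\ exists (lambda : R) (D : 'M[R]_7),
    derivation L D /\ ricci_endo L G = lambda%:M + D.

(* ff i j is f^{ij}, with indices numbered from 1 *)
Definition ff (R : realType) (i j : nat) : ext_alg R :=
  wedge (monomial R [set inord i.-1]) (monomial R [set inord j.-1]).
Arguments ff {R}.

Definition n63R (R : realType) : structure_eqs R :=
  [tuple 0; 0; 0; 0; ff 1 2; ff 1 3; ff 2 3].
Definition n73A (R : realType) : structure_eqs R :=
  [tuple 0; 0; 0; 0; ff 1 2; ff 2 3; ff 2 4].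
Definition n73B (R : realType) : structure_eqs R :=
  [tuple 0; 0; 0; 0; ff 1 2; ff 2 3; ff 3 4].
Definition n73B1 (R : realType) : structure_eqs R :=
  [tuple 0; 0; 0; 0; ff 1 2 - ff 3 4; ff 1 3 + ff 2 4; ff 1 4].
Definition n73C (R : realType) : structure_eqs R :=
  [tuple 0; 0; 0; 0; ff 1 2 + ff 3 4; ff 2 3; ff 2 4].
Definition n73D (R : realType) : structure_eqs R :=
  [tuple 0; 0; 0; 0; ff 1 2 + ff 3 4; ff 1 3; ff 2 4].
Definition n73D1 (R : realType) : structure_eqs R :=
  [tuple 0; 0; 0; 0; ff 1 2 - ff 3 4; ff 1 3 + ff 2 4; ff 1 4 - ff 2 3].

Lemma form_inner_sumE (R : realType) (G : 'M[R]_7) (a b : ext_alg R) :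
  form_inner G a b =
    \sum_(S : {set 'I_7}) a S * form_inner G (monomial R S) b.
Proof.
apply: eq_bigr => S _; rewrite [form_inner _ _ _](bigD1 S) //= [X in _ + X]big1.
  rewrite addr0 mulr_sumr; apply: eq_bigr => T _.
  by rewrite ffunE eqxx mul1r mulrA.
move=> T neTS; apply: big1 => U _.
by rewrite ffunE (negPf neTS) !mul0r.
Qed.

(* the defining property of the Hodge operator *)
Lemma wedge_hodge (R : realType) (G : 'M[R]_7) (vol : ext_alg R) (k : nat)
    (a b : ext_alg R) :
  homog 7 vol -> homog k a -> homog k b ->
  wedge a (hodge G vol b) = form_inner G a b *: vol.
Proof.
move=> hvol ha hb; apply/ffunP => U; rewrite !ffunE.
have inner_deg (S : {set 'I_7}) :
    #|S| != k -> form_inner G (monomial R S) b = 0.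
  move=> neSk; apply: big1 => T _; apply: big1 => T' /eqP cT'.
  rewrite ffunE; case: eqP => [eTS|_]; last by rewrite !mul0r.
  case: (eqVneq (b T') 0) => [->|/hb kT']; first by rewrite mulr0 mul0r.
  by rewrite -eTS -cT' kT' eqxx in neSk.
have [->|neUT] := eqVneq U [set: 'I_7]; last first.
  have -> : vol U = 0.
    apply/eqP; apply: contraT => /hvol cU; move: neUT.
    by rewrite eqEcard subsetT cardsT card_ord cU.
  rewrite scaler0 big1 // => S sSU; rewrite ffunE.
  have [->|/ha cS] := eqVneq (a S) 0; first by rewrite mulr0 mul0r.
  rewrite inner_deg ?mulr0 ?mul0r ?mulr0 //; apply: contraNneq neUT => cC.
  have /eqP eC : S == ~: (U :\: S).
    rewrite eqEcard cC cS leqnn andbT setDE setCI setCK.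
    exact: subsetUr.
  rewrite -subTset; apply/subsetP=> i _; case: (boolP (i \in S)).
    exact: (subsetP sSU).
  by rewrite eC inE negbK inE => /andP[].
rewrite form_inner_sumE scaler_suml; apply: eq_big => [S|S _].
  by rewrite subsetT.
rewrite ffunE setTD setCK /GRing.scale /= -[X in _ * X]mulrA mulrACA.
by rewrite -expr2 sqrr_sign mul1r mulrA.
Qed.

(* Main.v *)
(* All seven algebras are two-step: R^7 = r + n' with r = <e_1, ..., e_4>, and the
   df^k, k = 5, 6, 7, are 2-forms on r.  Let w be the 3 x 6 matrix of their
   coefficients, N = w w^T their Gram matrix and Z their wedge pairing.

   In an orthonormal frame, d * phi = 0 says that the 3 x 3 matrix
   M_kl = <df^k, e_l _| phi> is symmetric (and that some other entries vanish),
   and d phi /\ phi is proportional to tr M.  The contraction identity of the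
   G2 cross product gives M^2 = s N + q Z with s > 0, and q^2 = s^2 unless Z = 0.
   The nilsoliton equation is 2 N w - Z w E = mu w, E being the matrix of the
   wedge pairing of 2-forms on r; it implies N Z = mu Z and 2 N^2 - Z^2 = mu N, so
   that the eigenvalues of M^2 are known up to those of Z.  But a symmetric
   traceless 3 x 3 matrix satisfies 2 tr M^4 = (tr M^2)^2, which is impossible
   when Z = 0 or Z has rank two.  This excludes the last four algebras, because
   the rank of Z does not depend on the metric.

   On the other three algebras, a frame in which the nilsoliton equation holds
   and M is symmetric and traceless is written down explicitly. *)
Require Import Defs.
From mathcomp Require Import all_boot all_order all_algebra.
From mathcomp Require Import reals.
From mathcomp Require Import ring lra zify.

Set Implicit Arguments.
Unset Strict Implicit.
Unset Printing Implicit Defensive.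

Import Order.TTheory GRing.Theory Num.Theory.
Local Open Scope ring_scope.

(** * Exterior algebra *)

(** The definition of a G2-structure supplies no adapted basis, so the contraction identity has to
    come from the metric condition itself. Write phi = f ∧ omega + rho with f dual to a unit vector.
    Polynomial identities in the 35 coefficients of phi relate the metric to omega, omega^2, omega ∧
    rho and Hitchin's endomorphism of rho, and force the matrix of omega to have scalar square.
    Orthogonal changes of frame carry this to all unit vectors, and polarisation to all pairs. The
    relation q^2 = s^2 rests on the other vanishing torsion entries: as soon as Z is nonzero they
    force phi to vanish on r. Cross products of vectors of r then lie in the three-dimensional n',
    which leaves only two possible values for q. Orthonormal frames are taken upper triangular, so
    that they respect n' and the equations stay two-step; Z then changes by a congruence and a
    nonzero factor. The eigenvalue argument is carried out without diagonalising, through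
    Cayley-Hamilton and traces. *)

Section ExteriorAlgebra.

Variable R : realType.
Implicit Types (a b c : ext_alg R) (u v w : 'rV[R]_7) (i j k : 'I_7).
Implicit Types (S T U : {set 'I_7}).

Local Notation sg := (shuffle_sign R).

Lemma shuffle_signE S T :
  sg S T = \prod_(i in S) \prod_(j in T) (-1) ^+ (j < i)%N.
Proof.
rewrite /shuffle_sign pair_big /= prodrXr; congr (_ ^+ _).
rewrite -sum1_card [RHS](eq_bigr (fun p : 'I_7 * 'I_7 => if (p.2 < p.1)%N then 1%N else 0%N)).
  by rewrite -big_mkcondr; apply: eq_bigl => p; rewrite !inE.
by move=> p _; case: ltnP.
Qed.

Lemma shuffle_signs0 S : sg S set0 = 1.
Proof. by rewrite shuffle_signE big1 // => i _; rewrite big_set0. Qed.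

Lemma shuffle_signK S T : sg S T * sg S T = 1.
Proof. by rewrite -expr2 sqrr_sign. Qed.

Lemma shuffle_signU1l i S T :
  i \notin S -> sg (i |: S) T = sg [set i] T * sg S T.
Proof. by move=> iS; rewrite !shuffle_signE big_setU1 //= big_set1. Qed.

Lemma shuffle_signUr S T U :
  [disjoint T & U] -> sg S (T :|: U) = sg S T * sg S U.
Proof.
move=> dTU; rewrite !shuffle_signE -big_split; apply: eq_bigr => i _ /=.
by rewrite -bigU //=; apply: eq_bigl => j; rewrite !inE.
Qed.

Lemma shuffle_signU1r j S T :
  j \notin T -> sg S (j |: T) = sg S [set j] * sg S T.
Proof. by move=> jT; rewrite shuffle_signUr // disjoints1. Qed.

Lemma shuffle_sign11 i j : sg [set i] [set j] = (-1) ^+ (j < i)%N.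
Proof. by rewrite shuffle_signE !big_set1. Qed.

Lemma shuffle_sign1C i S :
  i \notin S -> sg [set i] S * sg S [set i] = (-1) ^+ #|S|.
Proof.
move=> iS; rewrite !shuffle_signE big_set1 -big_split /=.
rewrite (eq_bigr (fun=> -1)) ?prodr_const // => j jS.
rewrite big_set1 -signr_addb.
have: i != j by apply: contraNneq iS => ->.
by rewrite neq_ltn; case: ltngtP.
Qed.

Lemma wedgeDl a b c : wedge (a + b) c = wedge a c + wedge b c.
Proof.
apply/ffunP => S; rewrite !ffunE -big_split; apply: eq_bigr => T _ /=.
by rewrite ffunE mulrDr mulrDl.
Qed.

Lemma wedgeDr a b c : wedge a (b + c) = wedge a b + wedge a c.
Proof.
apply/ffunP => S; rewrite !ffunE -big_split; apply: eq_bigr => T _ /=.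
by rewrite ffunE mulrDr.
Qed.

Lemma wedgeZl (x : R) a b : wedge (x *: a) b = x *: wedge a b.
Proof.
apply/ffunP => S; rewrite !ffunE scaler_sumr; apply: eq_bigr => T _ /=.
by rewrite ffunE /GRing.scale /= !mulrA; congr (_ * _ * _); rewrite mulrC.
Qed.

Lemma wedgeZr (x : R) a b : wedge a (x *: b) = x *: wedge a b.
Proof.
apply/ffunP => S; rewrite !ffunE scaler_sumr; apply: eq_bigr => T _ /=.
by rewrite ffunE /GRing.scale /= mulrCA.
Qed.

Lemma wedge0l a : wedge 0 a = 0.
Proof. by have := wedgeZl 0 0 a; rewrite !scale0r. Qed.

Lemma wedge0r a : wedge a 0 = 0.
Proof. by have := wedgeZr 0 a 0; rewrite !scale0r. Qed.

Lemma wedge_suml (I : finType) (F : I -> ext_alg R) b :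
  wedge (\sum_i F i) b = \sum_i wedge (F i) b.
Proof.
by elim/big_rec2: _ => [|i x y _ IH]; rewrite ?wedge0l ?wedgeDl ?IH.
Qed.

Lemma wedge_sumr (I : finType) (F : I -> ext_alg R) b :
  wedge b (\sum_i F i) = \sum_i wedge b (F i).
Proof.
by elim/big_rec2: _ => [|i x y _ IH]; rewrite ?wedge0r ?wedgeDr ?IH.
Qed.

Lemma wedge_set0 a b : wedge a b set0 = a set0 * b set0.
Proof.
rewrite ffunE (big_pred1 set0) => [|S]; last by rewrite /= subset0.
by rewrite set0D shuffle_signs0 mul1r.
Qed.

Definition basis_vec i : 'rV[R]_7 := delta_mx 0 i.
Local Notation e := basis_vec.

Lemma iprod_basis i a S :
  iprod (e i) a S = if i \in S then 0 else sg [set i] S * a (i |: S).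
Proof.
rewrite ffunE; case: ifPn => iS; last first.
  rewrite (bigD1 i) //= big1 => [|j /andP[_ neji]].
    by rewrite addr0 mxE !eqxx mulr1.
  by rewrite mxE eqxx (negPf neji) mulr0 mul0r.
rewrite big1 // => j jS; have /negPf neji: j != i by apply: contraNneq jS => ->.
by rewrite mxE eqxx neji mulr0 mul0r.
Qed.

Lemma iprod_sum_basis v a : iprod v a = \sum_i v 0 i *: iprod (e i) a.
Proof.
apply/ffunP => S; rewrite sum_ffunE ffunE [RHS](bigID (fun i => i \notin S)) /=.
rewrite [X in _ = _ + X]big1 ?addr0 => [|i].
  apply: eq_bigr => i iS; rewrite ffunE iprod_basis (negPf iS) /GRing.scale /=.
  by rewrite mulrCA mulrA.
by rewrite negbK => iS; rewrite ffunE iprod_basis iS scaler0.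
Qed.

Lemma iprodDr v a b : iprod v (a + b) = iprod v a + iprod v b.
Proof.
apply/ffunP => S; rewrite !ffunE -big_split; apply: eq_bigr => i _ /=.
by rewrite ffunE mulrDr.
Qed.

Lemma iprodZr v (x : R) a : iprod v (x *: a) = x *: iprod v a.
Proof.
apply/ffunP => S; rewrite !ffunE scaler_sumr; apply: eq_bigr => i _ /=.
by rewrite ffunE /GRing.scale /= mulrCA.
Qed.

Lemma iprod0r v : iprod v 0 = 0.
Proof. by have := iprodZr v 0 0; rewrite !scale0r. Qed.

Lemma iprod_sumr (I : finType) (F : I -> ext_alg R) v :
  iprod v (\sum_i F i) = \sum_i iprod v (F i).
Proof.
by elim/big_rec2: _ => [|i x y _ IH]; rewrite ?iprod0r ?iprodDr ?IH.
Qed.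

Lemma iprodDl u v a : iprod (u + v) a = iprod u a + iprod v a.
Proof.
rewrite !iprod_sum_basis -big_split; apply: eq_bigr => i _ /=.
by rewrite mxE scalerDl.
Qed.

Lemma iprodZl (x : R) v a : iprod (x *: v) a = x *: iprod v a.
Proof.
rewrite !iprod_sum_basis scaler_sumr; apply: eq_bigr => i _ /=.
by rewrite mxE scalerA.
Qed.

Lemma iprod0l a : iprod 0 a = 0.
Proof. by have := iprodZl 0 0 a; rewrite !scale0r. Qed.

Lemma iprod_suml (I : finType) (F : I -> 'rV[R]_7) a :
  iprod (\sum_i F i) a = \sum_i iprod (F i) a.
Proof.
by elim/big_rec2: _ => [|i x y _ IH]; rewrite ?iprod0l ?iprodDl ?IH.
Qed.

(** The grading involution carries the signs of the graded Leibniz rule, so that the rule holds for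
    inhomogeneous forms as well. *)
Definition grade_inv a : ext_alg R :=
  [ffun S : {set 'I_7} => (-1) ^+ #|S| * a S].

Lemma sum_subsetU1 (V : nmodType) i S (F : {set 'I_7} -> V) : i \notin S ->
  \sum_(A : {set 'I_7} | A \subset i |: S) F A =
    \sum_(A : {set 'I_7} | A \subset S) F (i |: A) +
    \sum_(A : {set 'I_7} | A \subset S) F A.
Proof.
move=> iS; rewrite (bigID (fun A : {set 'I_7} => i \in A)) /=.
congr (_ + _); last first.
  apply: eq_bigl => A; rewrite -[in RHS](setU1K iS) subsetD1.
  by [].
rewrite (reindex_onto (fun A => i |: A) (fun A => A :\ i)) /=; last first.
  by move=> A /andP[_ iA]; rewrite setD1K.
apply: eq_bigl => A; rewrite setU11 andbT; apply/andP/idP => [[sAS /eqP eA]|sAS].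
  by rewrite -eA -(setU1K iS) setSD.
have iA : i \notin A by apply: contra iS; apply: (subsetP sAS).
by rewrite setUS // setU1K.
Qed.

(** The shuffles of [i |: S] are sorted by the factor that receives [i]; the additional sign counts
    the inversions of [i] with the other factor. *)
Lemma wedge_notin i a b S : i \notin S -> wedge a b (i |: S) =
  \sum_(A : {set 'I_7} | A \subset S)
    sg [set i] (S :\: A) * sg A (S :\: A) * a (i |: A) * b (S :\: A) +
  \sum_(A : {set 'I_7} | A \subset S)
    sg A [set i] * sg A (S :\: A) * a A * b (i |: (S :\: A)).
Proof.
move=> iS; rewrite ffunE sum_subsetU1 //; congr (_ + _); apply: eq_bigr => A sAS.
  have iA : i \notin A by apply: contra iS; apply: (subsetP sAS).
  have -> : (i |: S) :\: (i |: A) = S :\: A.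
    by apply/setP => j; rewrite !inE; case: eqP => [->|//]; rewrite (negPf iS) andbF.
  by rewrite shuffle_signU1l.
have iA : i \notin A by apply: contra iS; apply: (subsetP sAS).
have -> : (i |: S) :\: A = i |: (S :\: A).
  by apply/setP => j; rewrite !inE; case: eqP => [->|//]; rewrite iA.
by rewrite shuffle_signU1r // inE (negPf iS) andbF.
Qed.

Lemma iprod_wedge_basis i a b : iprod (e i) (wedge a b) =
  wedge (iprod (e i) a) b + wedge (grade_inv a) (iprod (e i) b).
Proof.
apply/ffunP => S; rewrite [RHS]ffunE iprod_basis; case: ifPn => iS.
  (* At a set containing [i], each product of a coefficient of [a] at [i |: A] with one of [b] at
     [i |: (T :\: A)] occurs twice, with opposite signs. *)
  rewrite -(setD1K iS); set T := S :\ i.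
  have iT : i \notin T by rewrite setD11.
  rewrite !wedge_notin // big1 ?add0r => [|A _]; last first.
    by rewrite iprod_basis setU11 mulr0 mul0r.
  rewrite [X in _ = _ + (_ + X)]big1 ?addr0 => [|A _]; last first.
    by rewrite iprod_basis setU11 mulr0.
  rewrite -big_split big1 // => A sAT /=.
  have iA : i \notin A by apply: contra iT; apply: (subsetP sAT).
  have iTA : i \notin T :\: A by rewrite inE (negPf iT) andbF.
  rewrite !iprod_basis (negPf iA) (negPf iTA) ffunE cardsU1 iA add1n exprS.
  rewrite -(shuffle_sign1C iA).
  have aux (x y z t p q : R) : x * x = 1 ->
      t * y * (z * p) * q + x * y * (-1 * (z * t) * p) * (x * q) = 0.
    move=> xx; have -> : x * y * (-1 * (z * t) * p) * (x * q) =
      - (x * x) * (t * y * (z * p) * q) by ring.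
    by rewrite xx mulN1r subrr.
  exact: aux (shuffle_signK _ _).
rewrite wedge_notin // mulrDr !big_distrr /=.
rewrite [X in _ = X + _]ffunE [X in _ = _ + X]ffunE /=.
congr (_ + _); apply: eq_bigr => A sAS.
  have iA : i \notin A by apply: contra iS; apply: (subsetP sAS).
  have iSA : i \notin S :\: A by rewrite inE (negPf iS) andbF.
  rewrite iprod_basis (negPf iA) -{1}(setID S A) (setIidPr sAS).
  rewrite shuffle_signUr; last by rewrite disjoints_subset setCD subsetUr.
  have aux (x y z p q : R) : x * x = 1 -> y * x * (x * z * p * q) = z * (y * p) * q.
    by move=> xx; rewrite -[RHS]mul1r -xx; ring.
  exact: aux (shuffle_signK _ _).
have iA : i \notin A by apply: contra iS; apply: (subsetP sAS).
have iSA : i \notin S :\: A by rewrite inE (negPf iS) andbF.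
rewrite iprod_basis (negPf iSA) ffunE -{1}(setID S A) (setIidPr sAS).
rewrite shuffle_signUr; last by rewrite disjoints_subset setCD subsetUr.
rewrite -(shuffle_sign1C iA).
have aux (x y z t p q : R) : y * x * (t * z * p * q) = z * (y * t * p) * (x * q).
  by ring.
exact: aux.
Qed.

Lemma iprod_wedge v a b : iprod v (wedge a b) =
  wedge (iprod v a) b + wedge (grade_inv a) (iprod v b).
Proof.
rewrite [LHS]iprod_sum_basis (iprod_sum_basis v a) (iprod_sum_basis v b).
rewrite wedge_suml wedge_sumr -big_split; apply: eq_bigr => i _ /=.
by rewrite wedgeZl wedgeZr iprod_wedge_basis scalerDr.
Qed.

Lemma iprod_basisC i j a : iprod (e i) (iprod (e j) a) = - iprod (e j) (iprod (e i) a).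
Proof.
apply/ffunP => S; rewrite [RHS]ffunE !iprod_basis !inE.
have [iS|iS] := boolP (i \in S); have [jS|jS] := boolP (j \in S); rewrite ?orbT ?orbF /= ?mulr0 ?oppr0 //.
have [->|nij] := eqVneq i j; first by rewrite /= !mulr0 oppr0.
rewrite /= !shuffle_signU1r // !shuffle_sign11 setUCA.
have -> : (-1) ^+ (i < j)%N = - (-1) ^+ (j < i)%N :> R.
  by move: nij; rewrite -val_eqE; case: ltngtP => //= _ _; rewrite ?expr0 ?expr1 ?opprK.
by ring.
Qed.

Lemma iprodC u v a : iprod u (iprod v a) = - iprod v (iprod u a).
Proof.
rewrite (iprod_sum_basis v a) (iprod_sum_basis v (iprod u a)) iprod_sumr -sumrN.
apply: eq_bigr => j _; rewrite iprodZr -scalerN; congr (_ *: _).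
rewrite !(iprod_sum_basis u) iprod_sumr -sumrN.
by apply: eq_bigr => i _; rewrite iprodZr -scalerN iprod_basisC.
Qed.

Lemma iprod2 v a : iprod v (iprod v a) = 0.
Proof.
apply/ffunP => S; have /ffunP /(_ S) := iprodC v v a; rewrite !ffunE => h.
by lra.
Qed.

(** The sign that brings f^i to the front of a monomial is the sign of the interior product with
    e_i. *)
Lemma ext_dE (L : structure_eqs R) a :
  ext_d L a = \sum_i wedge (tnth L i) (iprod (e i) a).
Proof.
rewrite /ext_d (eq_bigr (fun S => \sum_(i in S) a S *:
  (sg [set i] (S :\ i) *: wedge (tnth L i) (monomial R (S :\ i))))); last first.
  by move=> S _; rewrite scaler_sumr.
rewrite (exchange_big_dep predT) //=; apply: eq_bigr => i _.
transitivity (wedge (tnth L i) (\sum_(S : {set 'I_7} | i \in S)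
   (a S * sg [set i] (S :\ i)) *: monomial R (S :\ i))).
  rewrite big_mkcond [X in wedge _ X]big_mkcond wedge_sumr.
  apply: eq_bigr => S _; case: ifP => _; last by rewrite wedge0r.
  by rewrite wedgeZr scalerA.
congr wedge; apply/ffunP => T; rewrite sum_ffunE iprod_basis.
case: ifPn => iT.
  rewrite big1 // => S iS; rewrite !ffunE; case: eqP => [eT|_].
    by rewrite eT setD11 in iT.
  by rewrite scaler0.
rewrite (bigD1 (i |: T)) ?setU11 //= big1 ?addr0 => [|S /andP[iS neS]].
  by rewrite !ffunE setU1K // eqxx /GRing.scale /= mulr1 mulrC.
rewrite !ffunE; case: eqP => [eT|_]; last by rewrite scaler0.
by rewrite eT setD1K ?eqxx in neS.
Qed.

End ExteriorAlgebra.

(** * Pull-back of forms *)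

Section Pullback.

Variable R : realType.
Implicit Types (a b c : ext_alg R) (u v w : 'rV[R]_7) (i j k : 'I_7).
Implicit Types (S T U : {set 'I_7}) (A B P : 'M[R]_7).

Local Notation sg := (shuffle_sign R).
Local Notation e := (@basis_vec R).

(** Links two sign conventions: the shuffle sign of j against the rest of T is the parity of the
    position of j in the increasing enumeration, which is what a cofactor expansion sees. *)
Lemma enum_split j T : j \in T -> exists s1 s2,
  [/\ enum T = s1 ++ j :: s2, enum (T :\ j) = s1 ++ s2 &
      sg [set j] (T :\ j) = (-1) ^+ size s1].
Proof.
move=> jT; set E := enum 'I_7.
have jE : (j < size E)%N by rewrite size_enum_ord.
have idx k : index k E = k by rewrite index_enum_ord.
have memE k : k \in E by rewrite mem_enum.
have uE : uniq E by rewrite enum_uniq.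
have nthE : nth ord0 E j = j by rewrite -{2}(nth_index ord0 (memE j)) idx.
have defE : E = take j E ++ j :: drop j.+1 E.
  by rewrite -{1}(cat_take_drop j E) (drop_nth ord0 jE) nthE.
have enumE S : enum S = [seq x <- E | x \in S] by rewrite /enum_mem -enumT.
have ltj k : k \in take j E -> (k < j)%N by rewrite in_take // idx.
have gtj k : k \in drop j.+1 E -> (j < k)%N.
  move=> kd; rewrite ltnNge leq_eqVlt; apply/negP => /orP[/eqP/val_inj kj|kj].
    move: uE; rewrite defE cat_uniq /= => /and3P[_ _ /andP[/negP h _]].
    by apply: h; rewrite -{1}kj.
  have kt : k \in take j E by rewrite in_take // idx.
  move: uE; rewrite defE cat_uniq /= => /and3P[_ /norP[_ /hasPn/(_ k kd)]].
  by rewrite kt.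
pose s1 := [seq x <- take j E | x \in T]; pose s2 := [seq x <- drop j.+1 E | x \in T].
have e2 : enum (T :\ j) = s1 ++ s2.
  rewrite enumE defE filter_cat /= !inE eqxx /=; congr (_ ++ _).
    apply: eq_in_filter => x /ltj xj; rewrite !inE.
    by rewrite -val_eqE neq_ltn xj.
  apply: eq_in_filter => x /gtj xj; rewrite !inE.
  by rewrite -val_eqE neq_ltn xj orbT.
exists s1, s2; split=> //; first by rewrite enumE defE filter_cat /= jT.
rewrite shuffle_signE big_set1 -big_enum e2 big_cat /=.
rewrite [X in _ * X]big1_seq ?mulr1 => [|x]; last first.
  by rewrite mem_filter => /andP[_ /andP[_ xd]]; rewrite ltnNge (ltnW (gtj x xd)).
rewrite (eq_big_seq (fun=> -1)) => [|x]; last first.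
  by rewrite mem_filter => /andP[_ /ltj ->].
by rewrite big_const_seq count_predT iter_mulr_1.
Qed.

Definition minor n A S T : R :=
  \det (\matrix_(i < n, j < n) A (nth ord0 (enum S) i) (nth ord0 (enum T) j)).

Lemma nth_cat_lift n (r : 'I_n) (s1 s2 : seq 'I_7) j (k : 'I_n.+1) :
  k = size s1 :> nat -> nth ord0 (s1 ++ j :: s2) (lift k r) = nth ord0 (s1 ++ s2) r.
Proof.
move=> ks; rewrite !nth_cat /= /bump ks; case: (leqP (size s1) r) => rs /=.
  by rewrite add1n ltnNge (leqW rs) /= subSn.
by rewrite add0n rs.
Qed.

Lemma minor_laplace n i S T A : i \notin S -> #|S| = n -> #|T| = n.+1 ->
  sg [set i] S * minor n.+1 A (i |: S) T =
  \sum_(j in T) sg [set j] (T :\ j) * A i j * minor n A S (T :\ j).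
Proof.
move=> iS cS cT.
have [s1 [s2 []]] := enum_split (setU11 i S); rewrite setU1K // => eU eS ->.
have sz : (size s1 < n.+1)%N.
  by rewrite ltnS -cS cardE eS size_cat leq_addr.
rewrite /minor (expand_det_row _ (Ordinal sz)) mulr_sumr.
have sumE (F : 'I_7 -> R) :
    \sum_(j in T) F j = \sum_(c < n.+1) F (nth ord0 (enum T) c).
  rewrite -(big_mkord xpredT (fun l : nat => F (nth ord0 (enum T) l))) -cT cardE.
  by rewrite -(big_nth ord0 xpredT F) big_enum.
rewrite sumE.
apply: eq_bigr => c _; set j := nth _ _ _.
have jT : j \in T by rewrite -mem_enum mem_nth // -cardE cT.
have [t1 [t2 [eT eTj ->]]] := enum_split jT.
have ct : c = size t1 :> nat.
  have := enum_uniq T; rewrite eT => u.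
  have cl : (c < size (enum T))%N by rewrite -cardE cT.
  have := index_uniq ord0 cl (enum_uniq T); rewrite -/j => <-.
  rewrite eT index_cat /= eqxx addn0; case: ifP => // jt1.
  by move: u; rewrite cat_uniq => /and3P[_ /hasPn/(_ j)]; rewrite mem_head jt1 => /(_ isT).
rewrite mxE /= eU nth_cat ltnn subnn /= /cofactor /= -/j {1}ct.
have -> : \det (row' (Ordinal sz) (col' c
   (\matrix_(i0, j0) A (nth ord0 (s1 ++ i :: s2) i0) (nth ord0 (enum T) j0)))) =
  \det (\matrix_(i0 < n, j0 < n) A (nth ord0 (enum S) i0) (nth ord0 (enum (T :\ j)) j0)).
  congr (\det _); apply/matrixP => x y; rewrite !mxE eT eS eTj.
  by rewrite !nth_cat_lift.
set D := \det _; rewrite exprD.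
have h : (-1) ^+ size s1 * (-1) ^+ size s1 = 1 :> R by rewrite -expr2 sqrr_sign.
set x := (-1) ^+ size s1 in h *; set y := (-1) ^+ size t1.
transitivity ((x * x) * (y * A i j * D)); last by rewrite h mul1r.
by ring.
Qed.

(** Pull-back along [x |-> x *m P], so that row i of P is the image of e_i. It is defined by minors,
    like [gram_minor], which makes the metric on forms itself a pull-back ([form_innerE]). *)
Definition pull P a : ext_alg R :=
  [ffun S : {set 'I_7} => \sum_(T : {set 'I_7} | #|T| == #|S|) a T * minor #|S| P S T].

Lemma pullD P a b : pull P (a + b) = pull P a + pull P b.
Proof.
apply/ffunP => S; rewrite !ffunE -big_split; apply: eq_bigr => T _ /=.
by rewrite ffunE mulrDl.
Qed.

Lemma pullZ P (x : R) a : pull P (x *: a) = x *: pull P a.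
Proof.
apply/ffunP => S; rewrite !ffunE scaler_sumr; apply: eq_bigr => T _ /=.
by rewrite ffunE /GRing.scale /= mulrA.
Qed.

Lemma pull0 P : pull P 0 = 0.
Proof. by have := pullZ P 0 0; rewrite !scale0r. Qed.

Lemma pull_sum (I : finType) (F : I -> ext_alg R) P :
  pull P (\sum_i F i) = \sum_i pull P (F i).
Proof.
by elim/big_rec2: _ => [|i x y _ IH]; rewrite ?pull0 ?pullD ?IH.
Qed.

Lemma pull_homog P (k : nat) a : homog k a -> homog k (pull P a).
Proof.
move=> ha S; rewrite ffunE => nz; apply/eqP; apply: contraNT nz => cS.
rewrite big1 // => T /eqP cT; case: (eqVneq (a T) 0) => [->|/ha kT].
  by rewrite mul0r.
by rewrite -cT kT eqxx in cS.
Qed.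

Lemma pull_set0 P a : pull P a set0 = a set0.
Proof.
rewrite ffunE cards0 (big_pred1 set0) => [|T]; last by rewrite /= cards_eq0.
by rewrite /minor det_mx00 mulr1.
Qed.

Lemma pull_setT P a : pull P a [set: 'I_7] = \det P * a [set: 'I_7].
Proof.
rewrite ffunE (big_pred1 [set: 'I_7]) => [|T]; last first.
  by rewrite /= eqEcard subsetT /= eqn_leq [X in X && _]subset_leq_card ?subsetT.
rewrite mulrC; congr (_ * _); rewrite cardsT card_ord /minor.
congr (\det _); apply/matrixP => i j; rewrite mxE enum_setT -enumT.
have h (k : 'I_7) : nth ord0 (enum 'I_7) k = k by apply: nth_ord_enum.
by rewrite !h.
Qed.

Lemma pull_iprod_notin P i S a : i \notin S ->
  pull P (iprod (row i P) a) S = sg [set i] S * pull P a (i |: S).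
Proof.
move=> iS; transitivity (\sum_j \sum_(T : {set 'I_7} | (#|T| == #|S|) && (j \notin T))
   sg [set j] T * P i j * a (j |: T) * minor #|S| P S T).
  rewrite ffunE (exchange_big_dep (fun T : {set 'I_7} => #|T| == #|S|)) /=; last first.
    by move=> j T _ /andP[].
  apply: eq_bigr => T cT; rewrite ffunE mulr_suml; apply: eq_big => j.
    by rewrite cT.
  by rewrite mxE.
rewrite ffunE mulr_sumr cardsU1 iS add1n.
rewrite (eq_bigr (fun T => \sum_(j in T)
    sg [set j] (T :\ j) * P i j * a T * minor #|S| P S (T :\ j))); last first.
  move=> T /eqP cT; rewrite mulrCA (minor_laplace _ iS) // mulr_sumr.
  by apply: eq_bigr => j _; ring.
rewrite [RHS](exchange_big_dep predT) //=; apply: eq_bigr => j _.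
rewrite [RHS](reindex_onto (fun T => j |: T) (fun T => T :\ j)) /=; last first.
  by move=> T /andP[_ jT]; rewrite setD1K.
apply: eq_big => [T|T /andP[_ jT]]; last by rewrite setU1K.
rewrite setU11 andbT; apply/andP/andP => -[cT].
  move=> jT; rewrite cardsU1 jT add1n eqSS setU1K //.
move=> /eqP eT; have jT : j \notin T by rewrite -eT setD11.
by move: cT; rewrite cardsU1 jT add1n eqSS.
Qed.

Lemma iprod_pull_basis P i a : iprod (e i) (pull P a) = pull P (iprod (row i P) a).
Proof.
apply/ffunP => S; rewrite iprod_basis; case: ifPn => iS; last first.
  by rewrite pull_iprod_notin.
(* Contracting twice with row i of P gives 0; read at [S :\ i], this says that the single
   contraction has no coefficient at S. *)
have iS' : i \notin S :\ i by rewrite setD11.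
have := pull_iprod_notin P (iprod (row i P) a) iS'.
rewrite iprod2 pull0 ffunE setD1K // => /esym/eqP.
by rewrite mulf_eq0 signr_eq0 /= => /eqP ->.
Qed.

Lemma iprod_pull P v a : iprod v (pull P a) = pull P (iprod (v *m P) a).
Proof.
have -> : v *m P = \sum_i v 0 i *: row i P by rewrite mulmx_sum_row.
rewrite iprod_sum_basis iprod_suml pull_sum; apply: eq_bigr => i _.
by rewrite iprodZl pullZ iprod_pull_basis.
Qed.

Lemma pull_grade_inv P a : pull P (grade_inv a) = grade_inv (pull P a).
Proof.
apply/ffunP => S; rewrite !ffunE mulr_sumr; apply: eq_bigr => T /eqP cT.
by rewrite ffunE cT mulrA.
Qed.

(* A form is determined by its scalar part and its interior products. *)
Lemma pull_wedge P a b : pull P (wedge a b) = wedge (pull P a) (pull P b).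
Proof.
apply/ffunP => S; have [n] := ubnP #|S|; elim: n => // n IH in S a b *.
rewrite ltnS => cS; have [->|[i iS]] := set_0Vmem S.
  by rewrite pull_set0 !wedge_set0 !pull_set0.
have key c : c S = sg [set i] (S :\ i) * iprod (e i) c (S :\ i).
  by rewrite iprod_basis setD11 setD1K // mulrA shuffle_signK mul1r.
rewrite [LHS]key [RHS]key; congr (_ * _).
rewrite iprod_pull_basis !iprod_wedge pullD !ffunE.
have cS' : (#|S :\ i| < n)%N by move: cS; rewrite (cardsD1 i) iS.
have := IH (S :\ i) (iprod (row i P) a) b cS'.
have := IH (S :\ i) (grade_inv a) (iprod (row i P) b) cS'.
rewrite -!iprod_pull_basis pull_grade_inv !ffunE => -> -> //.
Qed.

Lemma pull_comp P A a : pull P (pull A a) = pull (P *m A) a.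
Proof.
apply/ffunP => S; have [n] := ubnP #|S|; elim: n => // n IH in S a *.
rewrite ltnS => cS; have [->|[i iS]] := set_0Vmem S.
  by rewrite !pull_set0.
have key c : c S = sg [set i] (S :\ i) * iprod (e i) c (S :\ i).
  by rewrite iprod_basis setD11 setD1K // mulrA shuffle_signK mul1r.
rewrite [LHS]key [RHS]key; congr (_ * _).
rewrite !iprod_pull_basis iprod_pull -row_mul.
by apply: IH; move: cS; rewrite (cardsD1 i) iS.
Qed.

Lemma pull1 a : pull 1%:M a = a.
Proof.
apply/ffunP => S; have [n] := ubnP #|S|; elim: n => // n IH in S a *.
rewrite ltnS => cS; have [->|[i iS]] := set_0Vmem S.
  by rewrite !pull_set0.
have key c : c S = sg [set i] (S :\ i) * iprod (e i) c (S :\ i).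
  by rewrite iprod_basis setD11 setD1K // mulrA shuffle_signK mul1r.
rewrite [LHS]key [RHS]key; congr (_ * _).
rewrite iprod_pull_basis rowE mulmx1 -/(e i) IH //.
by move: cS; rewrite (cardsD1 i) iS.
Qed.

Lemma pullVK P a : P \in unitmx -> pull P (pull (invmx P) a) = a.
Proof. by move=> uP; rewrite pull_comp mulmxV // pull1. Qed.

Definition dot a b : R := \sum_(S : {set 'I_7}) a S * b S.

Lemma form_innerE (G : 'M[R]_7) a b : form_inner G a b = dot a (pull (invmx G) b).
Proof.
apply: eq_bigr => S _; rewrite ffunE mulr_sumr; apply: eq_bigr => T /eqP cT.
rewrite -mulrA; congr (_ * (_ * _)).
Qed.

Lemma dot_pull P a b : dot (pull P a) b = dot a (pull P^T b).
Proof.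
rewrite /dot (eq_bigr (fun S => \sum_(T : {set 'I_7} | #|T| == #|S|)
  a T * minor #|S| P S T * b S)); last by move=> S _; rewrite ffunE mulr_suml.
rewrite (exchange_big_dep predT) //=; apply: eq_bigr => T _.
rewrite ffunE mulr_sumr; apply: eq_big => S; first by rewrite eq_sym.
move=> /eqP cS; rewrite -mulrA [minor _ _ _ _ * _]mulrC cS; congr (_ * (_ * _)).
by rewrite /minor -det_tr; congr (\det _); apply/matrixP => i j; rewrite !mxE.
Qed.

Lemma form_inner_pull P (G : 'M[R]_7) a b : P \in unitmx -> G \in unitmx ->
  form_inner (P *m G *m P^T) (pull P a) (pull P b) = form_inner G a b.
Proof.
move=> uP uG; have uPt : P^T \in unitmx by rewrite unitmx_tr.
rewrite !form_innerE dot_pull !pull_comp; congr (dot a (pull _ b)).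
have uPG : P *m G *m P^T \in unitmx by rewrite !unitmx_mul uP uG uPt.
apply: (can_inj (mulKmx uG)); apply: (can_inj (mulKmx uP)).
rewrite mulmxV // mulmx1 !mulmxA mulmxV // mul1mx //.
Qed.

End Pullback.

(** * Coclosed forms and the torsion matrix *)

Section Calculus.

Variable R : realType.
Implicit Types (a b c : ext_alg R) (u v w : 'rV[R]_7) (i j k : 'I_7).
Implicit Types (S T U : {set 'I_7}) (A B P G : 'M[R]_7) (L : structure_eqs R).

Local Notation sg := (shuffle_sign R).
Local Notation e := (@basis_vec R).

Lemma coef_iprod c i S : i \in S ->
  c S = sg [set i] (S :\ i) * iprod (e i) c (S :\ i).
Proof.
by move=> iS; rewrite iprod_basis setD11 setD1K // mulrA shuffle_signK mul1r.
Qed.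

Lemma grade_inv_wedge a b :
  grade_inv (wedge a b) = wedge (grade_inv a) (grade_inv b).
Proof.
apply/ffunP => S; rewrite !ffunE mulr_sumr; apply: eq_bigr => A sAS.
rewrite !ffunE -(cardsID A S) (setIidPr sAS) exprD.
set x : R := (-1) ^+ #|A|; set y : R := (-1) ^+ #|S :\: A|.
have aux (s p q : R) : x * y * (s * p * q) = s * (x * p) * (y * q) by ring.
exact: aux.
Qed.

Lemma wedgeA a b c : wedge a (wedge b c) = wedge (wedge a b) c.
Proof.
apply/ffunP => S; have [n] := ubnP #|S|; elim: n => // n IH in S a b c *.
rewrite ltnS => cS; have [->|[i iS]] := set_0Vmem S.
  by rewrite !wedge_set0 mulrA.
rewrite [LHS](coef_iprod _ iS) [RHS](coef_iprod _ iS); congr (_ * _).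
have cS' : (#|S :\ i| < n)%N by move: cS; rewrite (cardsD1 i) iS.
rewrite !iprod_wedge grade_inv_wedge wedgeDl wedgeDr addrA.
by rewrite [LHS]ffunE [RHS]ffunE [X in X + _]ffunE [X in _ = X + _]ffunE !IH.
Qed.

Lemma iprod_grade_inv v a : iprod v (grade_inv a) = - grade_inv (iprod v a).
Proof.
apply/ffunP => S; rewrite !ffunE mulr_sumr -sumrN; apply: eq_bigr => i iS.
rewrite ffunE cardsU1 iS exprS mulN1r.
set x : R := (-1) ^+ #|S|.
have aux (s p q : R) : s * p * (- x * q) = - (x * (s * p * q)) by ring.
exact: aux.
Qed.

Lemma wedgeNl a b : wedge (- a) b = - wedge a b.
Proof. by rewrite -scaleN1r wedgeZl scaleN1r. Qed.

Lemma grade_invK a : grade_inv (grade_inv a) = a.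
Proof.
apply/ffunP => S; rewrite !ffunE mulrA.
have -> : (-1) ^+ #|S| * (-1) ^+ #|S| = 1 :> R by rewrite -expr2 sqrr_sign.
by rewrite mul1r.
Qed.

Lemma iprodNr v a : iprod v (- a) = - iprod v a.
Proof. by rewrite -scaleN1r iprodZr scaleN1r. Qed.

(** The even and the odd case are proved together by induction on the degree of the coefficient,
    because contracting [a] changes its parity. *)
Lemma wedge_graded_comm a b :
  (grade_inv a = a -> wedge a b = wedge b a) /\
  (grade_inv a = - a -> wedge a b = wedge (grade_inv b) a).
Proof.
suff H S : (grade_inv a = a -> wedge a b S = wedge b a S) /\
    (grade_inv a = - a -> wedge a b S = wedge (grade_inv b) a S).
  by split=> h; apply/ffunP => S; have [h1 h2] := H S; [apply: h1 | apply: h2].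
have [n] := ubnP #|S|; elim: n => // n IH in S a b *.
rewrite ltnS => cS; have [->|[i iS]] := set_0Vmem S.
  split=> _; rewrite !wedge_set0 ?ffunE ?cards0 ?mul1r; exact: mulrC.
have cS' : (#|S :\ i| < n)%N by move: cS; rewrite (cardsD1 i) iS.
split=> ga; rewrite [LHS](coef_iprod _ iS) [RHS](coef_iprod _ iS);
  congr (_ * _); rewrite !iprod_wedge [LHS]ffunE [RHS]ffunE addrC ga.
  have [h1 _] := IH (S :\ i) a (iprod (e i) b) cS'.
  have [_ h2] := IH (S :\ i) (iprod (e i) a) b cS'.
  rewrite (h1 ga) h2 // -[in RHS]ga iprod_grade_inv.
  by rewrite opprK.
have [_ h1] := IH (S :\ i) a (iprod (e i) b) cS'.
have [h2 _] := IH (S :\ i) (iprod (e i) a) b cS'.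
rewrite wedgeNl [X in X + _]ffunE h1 // h2; last first.
  by rewrite -[in LHS](opprK a) -ga iprodNr iprod_grade_inv opprK grade_invK.
by rewrite iprod_grade_inv wedgeNl [X in _ = X + _]ffunE grade_invK.
Qed.

Lemma homog_even a : homog 2 a -> grade_inv a = a.
Proof.
move=> ha; apply/ffunP => S; rewrite ffunE.
by have [->|/ha ->] := eqVneq (a S) 0; rewrite ?mulr0 // expr2 mulN1r opprK mul1r.
Qed.

Lemma wedgeC2 a b : homog 2 a -> wedge a b = wedge b a.
Proof. by move=> /homog_even; case: (wedge_graded_comm a b). Qed.

Lemma homog0 (k : nat) : homog k (0 : ext_alg R).
Proof. by move=> S; rewrite ffunE eqxx. Qed.

Lemma homogD (k : nat) a b : homog k a -> homog k b -> homog k (a + b).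
Proof.
move=> ha hb S; rewrite ffunE; have [->|/ha //] := eqVneq (a S) 0.
by rewrite add0r => /hb.
Qed.

Lemma homogZ (k : nat) (x : R) a : homog k a -> homog k (x *: a).
Proof. by move=> ha S; rewrite ffunE mulf_eq0 negb_or => /andP[_ /ha]. Qed.

Lemma homog_sum (k : nat) (I : finType) (F : I -> ext_alg R) :
  (forall x, homog k (F x)) -> homog k (\sum_x F x).
Proof.
by move=> h; elim/big_ind: _ => // [|x y hx hy]; [exact: homog0 | exact: homogD].
Qed.

Lemma homog_wedge (k l : nat) a b : homog k a -> homog l b -> homog (k + l) (wedge a b).
Proof.
move=> ha hb S; rewrite ffunE => /eqP nz; apply/eqP; apply: contra_notT nz => cS.
apply: big1 => A sAS; have [->|/ha cA] := eqVneq (a A) 0.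
  by rewrite mulr0 mul0r.
have [->|/hb cB] := eqVneq (b (S :\: A)) 0; first by rewrite mulr0.
by rewrite -(cardsID A S) (setIidPr sAS) cA cB eqxx in cS.
Qed.

Lemma homog_iprod (k : nat) v a : homog k.+1 a -> homog k (iprod v a).
Proof.
move=> ha S; rewrite ffunE => /eqP nz; apply/eqP; apply: contra_notT nz => cS.
apply: big1 => i iS; have [->|/ha] := eqVneq (a (i |: S)) 0.
  by rewrite mulr0.
by rewrite cardsU1 iS add1n => -[kS]; rewrite kS eqxx in cS.
Qed.

Lemma homog_monomial S : homog #|S| (monomial R S).
Proof. by move=> T; rewrite ffunE; case: (T =P S) => [->|_] //; rewrite eqxx. Qed.

Lemma homog_ext_d (k : nat) L a : (forall i, homog 2 (tnth L i)) -> homog k.+1 a ->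
  homog k.+2 (ext_d L a).
Proof.
move=> hL ha; rewrite ext_dE; apply: homog_sum => i; rewrite -[k.+2]add2n.
by apply: homog_wedge => //; apply: homog_iprod.
Qed.

Lemma homog7_eq0 a : homog 7 a -> a [set: 'I_7] = 0 -> a = 0.
Proof.
move=> ha aT; apply/ffunP => S; rewrite ffunE; apply/eqP; apply: contraT => aS.
have cS := ha S aS; rewrite -aT (_ : S = [set: 'I_7]) ?eqxx // in aS.
by apply/eqP; rewrite eqEcard subsetT cardsT card_ord cS.
Qed.

Lemma homog_hodge (k : nat) G vol b : (k <= 7)%N -> homog k b ->
  homog (7 - k) (hodge G vol b).
Proof.
move=> k7 hb S; rewrite ffunE => /eqP nz; apply/eqP; apply: contra_notT nz => cS.
have cSC := cardsC S; rewrite card_ord in cSC.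
suff -> : form_inner G (monomial R (~: S)) b = 0 by rewrite mulr0 mul0r.
rewrite form_innerE /dot (bigD1 (~: S)) //= big1 ?addr0 => [|T /negPf neT].
  have [->|/(pull_homog hb) kS] := eqVneq (pull (invmx G) b (~: S)) 0.
    by rewrite mulr0.
  by move/eqP: cS; lia.
by rewrite ffunE neT mul0r.
Qed.

(** Every ad_x has zero diagonal in the standard basis; in particular its trace vanishes, which is
    what makes d zero in top degree. *)
Definition unimodular_eqs L := forall i, iprod (e i) (tnth L i) = 0.

Lemma ext_d_setT L a : unimodular_eqs L -> ext_d L a [set: 'I_7] = 0.
Proof.
move=> uL; rewrite ext_dE sum_ffunE big1 // => i _.
by rewrite (coef_iprod _ (in_setT i)) iprod_wedge uL wedge0l iprod2 wedge0r addr0 ffunE mulr0.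
Qed.

Lemma ext_d_wedge L a b : (forall i, homog 2 (tnth L i)) -> homog 2 a ->
  ext_d L (wedge a b) = wedge (ext_d L a) b + wedge a (ext_d L b).
Proof.
move=> hL ha; rewrite !ext_dE wedge_suml wedge_sumr -big_split.
apply: eq_bigr => i _ /=; rewrite iprod_wedge wedgeDr wedgeA; congr (_ + _).
by rewrite (homog_even ha) !wedgeA (wedgeC2 _ (hL i)).
Qed.

(** Since d(a ∧ ⋆phi) is zero in top degree, a ∧ d⋆phi = - da ∧ ⋆phi = - <da, phi> vol, and a 5-form
    is determined by its products with 2-forms. This removes the Hodge operator from the
    condition. *)
Lemma coclosed_dual L G vol phi : (forall i, homog 2 (tnth L i)) ->
  unimodular_eqs L -> homog 7 vol -> vol [set: 'I_7] != 0 -> homog 3 phi ->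
  (ext_d L (hodge G vol phi) = 0 <->
   forall a, homog 2 a -> form_inner G (ext_d L a) phi = 0).
Proof.
move=> hL uL hvol vol0 hphi.
have key a : homog 2 a -> wedge a (ext_d L (hodge G vol phi)) [set: 'I_7] =
    - form_inner G (ext_d L a) phi * vol [set: 'I_7].
  move=> ha; have := ext_d_setT (wedge a (hodge G vol phi)) uL.
  rewrite ext_d_wedge // (wedge_hodge _ hvol (homog_ext_d hL ha) hphi) !ffunE.
  by move=> /eqP; rewrite addrC addr_eq0 => /eqP ->; rewrite mulNr.
split=> [d0 a ha|d0].
  have := key a ha; rewrite d0 wedge0r ffunE => /esym/eqP.
  by rewrite mulf_eq0 oppr_eq0 (negPf vol0) orbF => /eqP.
apply/ffunP => S; rewrite [RHS]ffunE; apply/eqP; apply: contraT => nz.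
have cS : #|S| = 5 by apply: (homog_ext_d hL (@homog_hodge 3 G vol phi isT hphi)).
have hm : homog 2 (monomial R (~: S)).
  have c2 : #|~: S| = 2 by have := cardsC S; rewrite card_ord; lia.
  by have := @homog_monomial (~: S); rewrite c2.
have := key _ hm; rewrite d0 // oppr0 mul0r ffunE (bigD1 (~: S)) ?subsetT //=.
rewrite big1 ?addr0 => [|T /andP[_ /negPf neT]]; last by rewrite ffunE neT mulr0 mul0r.
rewrite setTD setCK ffunE eqxx mulr1 => /eqP.
by rewrite mulf_eq0 signr_eq0 (negPf nz).
Qed.

(** The structure equations in the frame formed by the rows of P. The dual coframe is f'^k = Σ_i
    (P^-1)_ik f^i, whence the coefficients. *)
Definition transport P L : structure_eqs R :=
  [tuple \sum_i invmx P i k *: pull P (tnth L i) | k < 7].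

Lemma transportE P L k :
  tnth (transport P L) k = \sum_i invmx P i k *: pull P (tnth L i).
Proof. by rewrite tnth_mktuple. Qed.

Lemma pull_ext_d P L a : P \in unitmx ->
  pull P (ext_d L a) = ext_d (transport P L) (pull P a).
Proof.
move=> uP; rewrite !ext_dE pull_sum.
transitivity (\sum_i \sum_k invmx P i k *:
   wedge (pull P (tnth L i)) (iprod (e k) (pull P a))); last first.
  rewrite exchange_big; apply: eq_bigr => k _; rewrite transportE wedge_suml.
  by apply: eq_bigr => i _; rewrite wedgeZl.
apply: eq_bigr => i _; rewrite pull_wedge.
have -> : pull P (iprod (e i) a) = iprod (row i (invmx P)) (pull P a).
  by rewrite iprod_pull -row_mul mulVmx // rowE mulmx1.
by rewrite iprod_sum_basis wedge_sumr; apply: eq_bigr => k _; rewrite wedgeZr mxE.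
Qed.

(** Each S is counted once for each of its k elements. Iterated, this turns inner products of forms
    into sums over ordered tuples of indices. *)
Lemma dot_euler (k : nat) a b : homog k a ->
  k%:R * dot a b = \sum_i dot (iprod (e i) a) (iprod (e i) b).
Proof.
move=> ha; transitivity (\sum_i \sum_(S : {set 'I_7} | i \in S) a S * b S).
  rewrite (exchange_big_dep predT) //= mulr_sumr; apply: eq_bigr => S _.
  rewrite sumr_const; have [->|/ha ->] := eqVneq (a S) 0.
    by rewrite !mul0r mulr0 mul0rn.
  by rewrite mulr_natl.
apply: eq_bigr => i _; rewrite [RHS](bigID (fun S => i \in S)) /= [X in _ = X + _]big1 ?add0r.
  rewrite [LHS](reindex_onto (fun S => i |: S) (fun S => S :\ i)) /=; last first.
    by move=> S iS; rewrite setD1K.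
  apply: eq_big => [S|S /andP[_ /eqP eS]].
    rewrite setU11 /=; apply/eqP/idP => [<-|iS]; first by rewrite setD11.
    by rewrite setU1K.
  have iS : i \notin S by rewrite -eS setD11.
  rewrite !iprod_basis (negPf iS).
  have aux (s p q : R) : s * s = 1 -> p * q = (s * p) * (s * q).
    by move=> ss; rewrite mulrACA ss mul1r.
  exact: (aux _ _ _ (shuffle_signK R [set i] S)).
by move=> S iS; rewrite iprod_basis iS mul0r.
Qed.

Lemma dot_homog0 a b : homog 0 a -> dot a b = a set0 * b set0.
Proof.
move=> ha; rewrite /dot (bigD1 set0) //= big1 ?addr0 // => S nS.
have [->|/ha/eqP] := eqVneq (a S) 0; first by rewrite mul0r.
by rewrite cards_eq0 (negPf nS).
Qed.

Definition coef2 a i j : R := iprod (e j) (iprod (e i) a) set0.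
Definition coef3 a i j k : R := iprod (e k) (iprod (e j) (iprod (e i) a)) set0.

Lemma dot2E a b : homog 2 a ->
  2 * dot a b = \sum_i \sum_j coef2 a i j * coef2 b i j.
Proof.
move=> ha; rewrite (dot_euler _ ha); apply: eq_bigr => i _.
have h1 := @homog_iprod 1 (e i) a ha; rewrite -[LHS]mul1r (dot_euler _ h1).
apply: eq_bigr => j _; rewrite dot_homog0 //; exact: homog_iprod.
Qed.

Lemma coef2C a i j : coef2 a i j = - coef2 a j i.
Proof. by rewrite /coef2 iprodC ffunE. Qed.

Lemma coef3C12 a i j k : coef3 a i j k = - coef3 a j i k.
Proof. by rewrite /coef3 [iprod (e j) _]iprodC iprodNr ffunE. Qed.

Lemma coef3C23 a i j k : coef3 a i j k = - coef3 a i k j.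
Proof. by rewrite /coef3 iprodC ffunE. Qed.

Lemma coef2_bilinear a v w : iprod w (iprod v a) set0 =
  (v *m (\matrix_(i, j) coef2 a i j) *m w^T) 0 0.
Proof.
rewrite (iprod_sum_basis v) iprod_sumr sum_ffunE.
transitivity (\sum_i \sum_j v 0 i * w 0 j * coef2 a i j).
  apply: eq_bigr => i _; rewrite iprodZr (iprod_sum_basis w) ffunE sum_ffunE.
  rewrite scaler_sumr; apply: eq_bigr => j _; rewrite ffunE /GRing.scale /=.
  exact: mulrA.
rewrite exchange_big mxE; apply: eq_bigr => j _; rewrite !mxE mulr_suml.
by apply: eq_bigr => i _; rewrite !mxE mulrAC.
Qed.

Lemma coef2_pull P a : \matrix_(i, j) coef2 (pull P a) i j =
  P *m (\matrix_(i, j) coef2 a i j) *m P^T.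
Proof.
apply/matrixP => i j; rewrite mxE /coef2 !iprod_pull pull_set0 -!rowE.
rewrite coef2_bilinear -row_mul tr_row [LHS]mxE [RHS]mxE.
by apply: eq_bigr => k _; rewrite [row _ _ _ _]mxE [col _ _ _ _]mxE.
Qed.

Lemma wedge_monomial1l i a b :
  dot (wedge (monomial R [set i]) a) b = dot a (iprod (e i) b).
Proof.
transitivity (\sum_(S : {set 'I_7} | i \in S) sg [set i] (S :\ i) * a (S :\ i) * b S).
  rewrite [RHS]big_mkcond; apply: eq_bigr => S _; rewrite ffunE mulr_suml.
  case: ifPn => iS.
    rewrite (bigD1 [set i]) ?sub1set //= big1 ?addr0 => [|A /andP[_ /negPf nA]].
      by rewrite ffunE eqxx mulr1.
    by rewrite ffunE nA mulr0 !mul0r.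
  rewrite big1 // => A sAS; rewrite ffunE; case: eqP => [eA|_]; last by rewrite mulr0 !mul0r.
  by rewrite eA sub1set (negPf iS) in sAS.
rewrite (reindex_onto (fun S => i |: S) (fun S => S :\ i)) /=; last first.
  by move=> S iS; rewrite setD1K.
rewrite /dot [RHS](bigID (fun S => i \in S)) /= [X in _ = X + _]big1 ?add0r; last first.
  by move=> S iS; rewrite iprod_basis iS mulr0.
apply: eq_big => [S|S /andP[_ /eqP eS]].
  rewrite setU11 /=; apply/eqP/idP => [<-|iS]; first by rewrite setD11.
  by rewrite setU1K.
have iS : i \notin S by rewrite -eS setD11.
by rewrite iprod_basis (negPf iS) setU1K // mulrAC mulrC mulrA.
Qed.

Lemma homog1E a : homog 1 a ->
  a = \sum_i iprod (e i) a set0 *: monomial R [set i].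
Proof.
move=> ha; apply/ffunP => S; rewrite sum_ffunE.
have [/eqP/cards1P[i ->]|nS] := eqVneq #|S| 1; last first.
  rewrite big1 => [|i _]; first by apply/eqP; apply: contraNT nS => /ha ->.
  rewrite !ffunE; case: eqP => [eS|_]; last by rewrite scaler0.
  by rewrite eS cards1 in nS.
rewrite (bigD1 i) //= big1 ?addr0 => [|j ji].
  by rewrite iprod_basis in_set0 shuffle_signs0 mul1r setU0 !ffunE eqxx /GRing.scale /= mulr1.
rewrite !ffunE; case: eqP => [/set1_inj eij|_]; last by rewrite scaler0.
by rewrite eij eqxx in ji.
Qed.

(** The matrix M of the overview with all seven indices; the rows with df^k = 0 vanish. *)
Definition torsion_mx L phi : 'M[R]_7 :=
  \matrix_(k, i) dot (tnth L k) (iprod (e i) phi).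

Lemma dot_ext_d L a phi : (forall i, homog 2 (tnth L i)) -> homog 2 a ->
  dot (ext_d L a) phi = \sum_k \sum_i coef2 a k i * torsion_mx L phi k i.
Proof.
move=> hL ha; rewrite ext_dE.
have dotD x y z : dot (x + y) z = dot x z + dot y z.
  rewrite /dot -big_split; apply: eq_bigr => S _ /=; rewrite ffunE; exact: mulrDl.
have dotZ (t : R) x z : dot (t *: x) z = t * dot x z.
  rewrite /dot mulr_sumr; apply: eq_bigr => S _ /=; rewrite ffunE; exact/esym/mulrA.
have dot_sum (F : 'I_7 -> ext_alg R) z : dot (\sum_i F i) z = \sum_i dot (F i) z.
  elim/big_rec2: _ => [|i x y _ IH]; last by rewrite dotD IH.
  by rewrite /dot big1 // => S _; rewrite ffunE mul0r.
rewrite dot_sum; apply: eq_bigr => k _; rewrite wedgeC2 //.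
rewrite {1}(homog1E (@homog_iprod 1 (e k) a ha)) wedge_suml dot_sum.
apply: eq_bigr => i _; rewrite wedgeZl dotZ wedge_monomial1l mxE //.
Qed.

(** By [dot_ext_d], <da, phi> contracts the skew matrix of [a] with the torsion matrix and sees only
    its skew part; a = f^k ∧ f^i isolates one entry of that part. *)
Lemma torsion_sym L phi : (forall i, homog 2 (tnth L i)) ->
  (forall a, homog 2 a -> dot (ext_d L a) phi = 0) <->
  (forall i k, torsion_mx L phi k i = torsion_mx L phi i k).
Proof.
move=> hL; split=> [h i k|h a ha]; last first.
  rewrite dot_ext_d //; set s := \sum_k _.
  suff : s = - s by move=> ss; lra.
  rewrite {1}/s exchange_big -sumrN; apply: eq_bigr => k _; rewrite -sumrN.
  by apply: eq_bigr => i _; rewrite coef2C mulNr h.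
have [->//|nik] := eqVneq i k.
pose a := monomial R [set k; i].
have ha : homog 2 a.
  by have := @homog_monomial [set k; i]; rewrite cards2 eq_sym nik.
have c2a x y : coef2 a x y =
    sg [set k] [set i] * ((x == k)%:R * (y == i)%:R - (x == i)%:R * (y == k)%:R).
  rewrite /coef2 iprod_basis in_set0 setU0 shuffle_signs0 mul1r iprod_basis inE ffunE.
  have [->|nxy] := eqVneq x y.
    by rewrite [_ * (y == k)%:R]mulrC subrr mulr0.
  case: eqP => [E|nE].
    have /set2P[xk|xi] : x \in [set k; i] by rewrite -E set21.
      have /set2P[yk|yi] : y \in [set k; i] by rewrite -E set22.
        by rewrite xk yk eqxx in nxy.
      by rewrite xk yi !eqxx (negPf nik) mulr1 mulr1 [k == i]eq_sym (negPf nik) mul0r subr0 mulr1.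
    have /set2P[yk|yi] : y \in [set k; i] by rewrite -E set22.
      rewrite xi yk !eqxx [k == i]eq_sym (negPf nik) mul0r sub0r !shuffle_sign11.
      move: nik; rewrite -val_eqE; case: ltngtP => //= _ _; rewrite ?expr0 ?expr1; ring.
    by rewrite xi yi eqxx in nxy.
  rewrite mulr0; have [xk|nxk] := eqVneq x k.
    have [yi|nyi] := eqVneq y i; first by exfalso; apply: nE; rewrite xk yi.
    by rewrite xk [k == i]eq_sym (negPf nik) mulr0 mul0r subr0 mulr0.
  have [xi|nxi] := eqVneq x i; last by rewrite !mul0r subr0 mulr0.
  have [yk|nyk] := eqVneq y k; first by exfalso; apply: nE; rewrite xi yk setUC.
  by rewrite mul0r mulr0 subr0 mulr0.
have := h a ha; rewrite dot_ext_d //.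
have delta_sum (x0 y0 : 'I_7) (M : 'I_7 -> 'I_7 -> R) :
    \sum_x \sum_y (x == x0)%:R * (y == y0)%:R * M x y = M x0 y0.
  rewrite (bigD1 x0) //= [X in _ + X]big1 ?addr0 => [|x /negPf xx0]; last first.
    by rewrite big1 // => y _; rewrite xx0 !mul0r.
  rewrite (bigD1 y0) //= big1 ?addr0 => [|y /negPf yy0]; last by rewrite yy0 mulr0 mul0r.
  by rewrite !eqxx !mul1r.
under eq_bigr => x _ do under eq_bigr => y _ do
  rewrite c2a -mulrA mulrBl.
under eq_bigr => x _ do rewrite -mulr_sumr sumrB.
rewrite -mulr_sumr sumrB !delta_sum => /eqP.
by rewrite mulf_eq0 signr_eq0 subr_eq0 => /eqP.
Qed.

End Calculus.

(** * Triple wedge products in coordinates, through explicit lists of shuffles *)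

Fixpoint subseqs (k : nat) (s : seq nat) : seq (seq nat) :=
  match k, s with
  | 0, _ => [:: [::]]
  | k'.+1, [::] => [::]
  | k'.+1, x :: s' => map (cons x) (subseqs k' s') ++ subseqs k s'
  end.

Definition inversions (s t : seq nat) : nat :=
  sumn [seq count (fun y => y < x)%N t | x <- s].

Definition seq_diff (s t : seq nat) := [seq x <- s | x \notin t].

Definition splittings k s : seq (bool * (seq nat * seq nat)) :=
  [seq (odd (inversions t (seq_diff s t)), (t, seq_diff s t)) | t <- subseqs k s].

(* ((sign, A), (B, C)) with {0..6} the disjoint union of A, B, C of sizes 2, 2, 3 *)
Definition shuffles223 : seq ((bool * seq nat) * (seq nat * seq nat)) :=
  Eval vm_compute in flatten [seq [seq ((x.1 (+) y.1, y.2.1), (y.2.2, x.2.2))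
    | y <- splittings 2 x.2.1] | x <- splittings 4 (iota 0 7)].

Section SeqSets.

Variable R : realType.
Implicit Types (a b c : ext_alg R) (i j : 'I_7) (s t : seq nat).

Local Notation sg := (shuffle_sign R).
Local Notation e := (@basis_vec R).

Definition nat_set s : {set 'I_7} := [set i : 'I_7 | val i \in s].

Lemma nat_set_cons x s : (x < 7)%N -> nat_set (x :: s) = inord x |: nat_set s.
Proof.
by move=> x7; apply/setP => i; rewrite !inE -val_eqE /= inordK.
Qed.

Lemma in_nat_set x s : (x < 7)%N -> (inord x \in nat_set s) = (x \in s).
Proof. by move=> x7; rewrite inE /= inordK. Qed.

Lemma nat_set_nil : nat_set [::] = set0.
Proof. by apply/setP => i; rewrite !inE. Qed.

Lemma card_nat_set s : uniq s -> all (fun x => x < 7)%N s -> #|nat_set s| = size s.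
Proof.
elim: s => [|x s IH] /=; first by rewrite nat_set_nil cards0.
by move=> /andP[xs us] /andP[x7 s7]; rewrite nat_set_cons // cardsU1 in_nat_set // xs IH.
Qed.

Lemma sum_subseqs (V : nmodType) k s (F : {set 'I_7} -> V) :
  uniq s -> all (fun x => x < 7)%N s ->
  \sum_(A : {set 'I_7} | (A \subset nat_set s) && (#|A| == k)) F A =
  \sum_(t <- subseqs k s) F (nat_set t).
Proof.
elim: s k F => [|x s IH] k F /=.
  move=> _ _; rewrite nat_set_nil; case: k => [|k] /=.
    rewrite big_seq1 nat_set_nil (big_pred1 set0) // => A /=; rewrite subset0.
    by case: eqP => // ->; rewrite cards0.
  rewrite big_nil big_pred0 // => A; rewrite subset0.
  by case: eqP => // ->; rewrite cards0.
move=> /andP[xs us] /andP[x7 s7]; rewrite nat_set_cons // big_mkcondr.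
have nx : inord x \notin nat_set s by rewrite in_nat_set.
rewrite sum_subsetU1 // -!big_mkcondr /=; case: k => [|k] /=.
  rewrite [X in X + _]big_pred0 => [|A]; last first.
    by rewrite cards_eq0 -subset0 subUset sub1set in_set0 /= andbF.
  rewrite add0r (IH 0) // ; case: (s) => //=.
rewrite big_cat big_map /=; congr (_ + _); last exact: IH.
rewrite (eq_bigl (fun A : {set 'I_7} => (A \subset nat_set s) && (#|A| == k))); last first.
  move=> A /=; case sA: (A \subset _) => //=; rewrite cardsU1.
  by rewrite (contra (subsetP sA _) nx).
rewrite (IH k (fun A => F (inord x |: A))) //; apply: eq_big_seq => t _.
by rewrite nat_set_cons.
Qed.

Lemma subseqs_subseq k s t : t \in subseqs k s -> subseq t s.
Proof.
elim: s k t => [|x s IH] [|k] t /=; rewrite ?inE ?mem_cat.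
- by move/eqP->.
- by [].
- by move/eqP->.
move=> /orP[/mapP[u /IH us ->]|/IH ts] /=; first by rewrite eqxx.
exact: subseq_trans ts (subseq_cons _ _).
Qed.

Lemma prod_nat_set (F : 'I_7 -> R) s : uniq s -> all (fun x => x < 7)%N s ->
  \prod_(i in nat_set s) F i = \prod_(x <- s) F (inord x).
Proof.
elim: s => [|x s IH] /=; first by rewrite nat_set_nil big_set0 big_nil.
move=> /andP[xs us] /andP[x7 s7].
by rewrite nat_set_cons // big_setU1 ?in_nat_set //= big_cons IH.
Qed.

Lemma shuffle_sign_nat_set s t :
  uniq s -> all (fun x => x < 7)%N s -> uniq t -> all (fun x => x < 7)%N t ->
  sg (nat_set s) (nat_set t) = (-1) ^+ odd (inversions s t).
Proof.
move=> us s7 ut t7; rewrite signr_odd shuffle_signE prod_nat_set // /inversions.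
rewrite sumnE big_map -prodrXr; apply: eq_big_seq => x xs.
rewrite prod_nat_set // -sum1_count -prodrXr [RHS]big_mkcond /=.
apply: eq_big_seq => y yt; rewrite !inordK ?(allP s7 x xs) ?(allP t7 y yt) //.
by case: ltnP.
Qed.

Lemma wedge_nat_set k a b s : uniq s -> all (fun x => x < 7)%N s -> homog k a ->
  wedge a b (nat_set s) = \sum_(x <- splittings k s)
    (-1) ^+ x.1 * a (nat_set x.2.1) * b (nat_set x.2.2).
Proof.
move=> us s7 ha; rewrite ffunE (bigID (fun A : {set 'I_7} => #|A| == k)) /=.
rewrite [X in _ + X]big1 ?addr0 => [|A /andP[_ nA]]; last first.
  have [->|/ha cA] := eqVneq (a A) 0; first by rewrite mulr0 mul0r.
  by rewrite cA eqxx in nA.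
rewrite sum_subseqs // big_map; apply: eq_big_seq => t /subseqs_subseq ts /=.
have ut : uniq t by apply: subseq_uniq ts us.
have t7 : all (fun x => x < 7)%N t by apply/allP => x /(mem_subseq ts); apply: (allP s7).
have ud : uniq (seq_diff s t) by apply: filter_uniq.
have d7 : all (fun x => x < 7)%N (seq_diff s t).
  by apply/allP => x; rewrite mem_filter => /andP[_]; apply: (allP s7).
have -> : nat_set s :\: nat_set t = nat_set (seq_diff s t).
  by apply/setP => i; rewrite !inE mem_filter.
by rewrite shuffle_sign_nat_set.
Qed.

Definition top3 a b c : R := wedge (wedge a b) c [set: 'I_7].

Lemma top3_shuffles a b c : homog 2 a -> homog 2 b ->
  top3 a b c = \sum_(x <- shuffles223) (-1) ^+ x.1.1 *
    (a (nat_set x.1.2) * b (nat_set x.2.1) * c (nat_set x.2.2)).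
Proof.
move=> ha hb; have -> : shuffles223 = flatten [seq [seq ((x.1 (+) y.1, y.2.1), (y.2.2, x.2.2))
    | y <- splittings 2 x.2.1] | x <- splittings 4 (iota 0 7)] by [].
have eT : [set: 'I_7] = nat_set (iota 0 7).
  apply/setP => i; rewrite in_setT in_set.
  by have -> : val i \in iota 0 7 by rewrite mem_iota ltn_ord.
rewrite /top3 eT (@wedge_nat_set 4) ?iota_uniq //; last exact: (@homog_wedge _ 2 2).
rewrite big_flatten [RHS]big_map; apply: eq_big_seq => x.
move=> /mapP[t /subseqs_subseq ts ->] /=.
rewrite [RHS]big_map /= (@wedge_nat_set 2) //; last 2 first.
- exact: subseq_uniq ts (iota_uniq 0 7).
- by apply/allP => z /(mem_subseq ts); rewrite mem_iota.
rewrite mulr_sumr mulr_suml; apply: eq_bigr => y _ /=; rewrite signr_addb.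
have aux (p q u v w : R) : p * (q * u * v) * w = p * q * (u * v * w) by ring.
exact: aux.
Qed.

Lemma coef2_nat_set a i j : (i < j)%N -> a (nat_set [:: val i; val j]) = coef2 a i j.
Proof.
move=> ij; rewrite /coef2 iprod_basis in_set0 shuffle_signs0 mul1r setU0 iprod_basis inE.
have /negPf -> : i != j by rewrite -val_eqE neq_ltn ij.
rewrite shuffle_sign11 ltnNge (ltnW ij) mul1r; congr (a _).
by apply/setP => k; rewrite !inE.
Qed.

Lemma coef3_nat_set a i j (k : 'I_7) : (i < j)%N -> (j < k)%N ->
  a (nat_set [:: val i; val j; val k]) = coef3 a i j k.
Proof.
move=> ij jk; rewrite -[coef3 _ _ _ _]/(coef2 (iprod (e i) a) j k) -coef2_nat_set //.
rewrite iprod_basis inE !inE /= ltn_eqF // ltn_eqF ?(ltn_trans ij) //=.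
rewrite shuffle_signE big_set1 big1 ?mul1r => [|l].
  by congr (a _); apply/setP => l; rewrite !inE.
by rewrite !inE => /orP[/eqP ->|/eqP ->]; rewrite ltnNge ltnW //= (ltn_trans ij).
Qed.

End SeqSets.

(* Polynomials in the coefficients [T a b c] (a < b < c) of a 3-form, over
   abstract operations so that they can be expanded by computation. *)
Section Polynomials.

Variables (A : Type) (add mul : A -> A -> A) (opp : A -> A) (zero : A).
Variable T : nat -> nat -> nat -> A.

Definition alt3 i j k : A :=
  (if i < j then if j < k then T i j k
     else if j == k then zero
     else if i < k then opp (T i k j) else if i == k then zero else T k i j
   else if i == j then zero
   else if i < k then opp (T j i k)
   else if i == k then zero
   else if j < k then T j k i else if j == k then zero else opp (T k j i))%N.

Definition sum_of (I : Type) (F : I -> A) (s : seq I) : A :=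
  foldr (fun x => add (F x)) zero s.

Definition signed (b : bool) (x : A) := if b then opp x else x.

Definition top3_poly (f g : nat -> nat -> A) (h : nat -> nat -> nat -> A) : A :=
  sum_of (fun x => signed x.1.1 (mul (mul (f (nth 0 x.1.2 0) (nth 0 x.1.2 1))
    (g (nth 0 x.2.1 0) (nth 0 x.2.1 1)))
    (h (nth 0 x.2.2 0) (nth 0 x.2.2 1) (nth 0 x.2.2 2))))%N shuffles223.

(* coefficient of f^i ^ f^j ^ (e_v _| phi) ^ phi for i < j *)
Definition star_poly0 v i j : A :=
  sum_of (fun x => signed x.1.1 (mul (alt3 v (nth 0 x.2.1 0) (nth 0 x.2.1 1))
    (alt3 (nth 0 x.2.2 0) (nth 0 x.2.2 1) (nth 0 x.2.2 2))))%N
    [seq x <- shuffles223 | x.1.2 == [:: i; j]].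

Definition star_poly v i j : A :=
  (if i < j then star_poly0 v i j
   else if j < i then opp (star_poly0 v j i) else zero)%N.

Definition metric_poly k l : A := top3_poly (alt3 k) (alt3 l) alt3.

Definition triple x := add x (add x x).

Definition s6 := iota 1 6.

(** In this and the following relations phi = f^0 ∧ omega + rho, with omega and rho forms on <e_1,
    ..., e_6>, and [metric_poly k l] is six times the top coefficient of g(e_k, e_l) vol. Here
    [star_poly 0 0 j] are the components of omega ∧ rho. *)
Definition metric0_rel l : A :=
  add (metric_poly 0 l)
    (triple (sum_of (fun j => mul (alt3 0 l j) (star_poly 0 0 j)) s6)).

(** For positive m and k, [star_poly 0 m k] is the coefficient of f^0 ∧ f^m ∧ f^k ∧ omega^2, an
    entry of the Pfaffian adjoint of omega; [metric_poly 0 0] comes from omega^3. *)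
Definition pfaffian_rel l k : A :=
  add (triple (sum_of (fun m => mul (alt3 0 l m) (star_poly 0 m k)) s6))
    (if l == k then metric_poly 0 0 else zero).

(** [star_poly k 0 m] comes from f^0 ∧ f^m ∧ (e_k _| rho) ∧ rho, that is, from Hitchin's
    endomorphism. The metric on <e_1, ..., e_6> is omega composed with it, up to a term in omega ∧
    rho. *)
Definition metric_rel l k : A :=
  add (metric_poly k l)
   (triple (add (sum_of (fun m => mul (alt3 0 l m) (star_poly k 0 m)) s6)
     (opp (sum_of (fun j => mul (star_poly 0 0 j) (alt3 l k j)) s6)))).

(* Hitchin: for rho the restriction of phi to <e_1, ..., e_6>, the endomorphism
   v |-> (v _| rho) ^ rho of R^6 (up to a volume form) has scalar square. *)
Definition hitchin_rel m k : A :=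
  add (sum_of (fun l => mul (star_poly l 0 m) (star_poly k 0 l)) s6)
    (if m == k then
       opp (sum_of (fun l => mul (star_poly l 0 1) (star_poly 1 0 l)) s6)
     else zero).

Definition pairs7 : seq (nat * nat) :=
  Eval vm_compute in
    [seq p <- allpairs pair (iota 0 7) (iota 0 7) | p.1 < p.2]%N.

Definition star_rel (f : nat -> nat -> A) : A :=
  add (top3_poly f (alt3 0) alt3)
    (opp (sum_of (fun p => mul (f p.1 p.2) (star_poly 0 p.1 p.2)) pairs7)).

End Polynomials.

(** The computation runs with the operations as variables: the polynomial gets written out while the
    operations of the ring stay opaque, which leaves a goal for [ring]. *)
Ltac expand F l k :=
  let f := eval vm_compute in
    (fun A add mul opp zero U => @F A add mul opp zero U l k) in
  let E := fresh in
  assert (forall A add mul opp zero U,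
    @F A add mul opp zero U l k = f A add mul opp zero U) as E
    by (vm_compute; reflexivity);
  rewrite {}E; cbv beta.

(** * Polynomial identities valid for every 3-form on R^7 *)

Section Relations.

Variable R : comPzRingType.
Variable T : nat -> nat -> nat -> R.

Lemma metric0_rel_eq0 l : l \in s6 -> metric0_rel +%R *%R -%R 0 T l = 0.
Proof.
pose F A add mul opp zero U l (k : nat) := @metric0_rel A add mul opp zero U l.
rewrite -[metric0_rel _ _ _ _ _ _]/(F R +%R *%R -%R 0 T l 0%N) !inE.
by do ?[case/orP]; move/eqP->; match goal with |- F _ _ _ _ _ _ ?l ?k = 0 => expand F l k end; ring.
Qed.

Lemma pfaffian_rel_eq0 l k : l \in s6 -> k \in s6 ->
  pfaffian_rel +%R *%R -%R 0 T l k = 0.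
Proof.
rewrite !inE.
by do ?[case/orP]; move/eqP->; do ?[case/orP]; move/eqP->;
  match goal with |- pfaffian_rel _ _ _ _ _ ?l ?k = 0 => expand (@pfaffian_rel) l k end; ring.
Qed.

Lemma metric_rel_eq0 l k : l \in s6 -> k \in s6 ->
  metric_rel +%R *%R -%R 0 T l k = 0.
Proof.
rewrite !inE.
by do ?[case/orP]; move/eqP->; do ?[case/orP]; move/eqP->;
  match goal with |- metric_rel _ _ _ _ _ ?l ?k = 0 => expand (@metric_rel) l k end; ring.
Qed.

Lemma hitchin_rel_eq0 l k : l \in s6 -> k \in s6 ->
  hitchin_rel +%R *%R -%R 0 T l k = 0.
Proof.
rewrite !inE.
by do ?[case/orP]; move/eqP->; do ?[case/orP]; move/eqP->;
  match goal with |- hitchin_rel _ _ _ _ _ ?l ?k = 0 => expand (@hitchin_rel) l k end; ring.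
Qed.

Lemma star_rel_eq0 (f : nat -> nat -> R) : star_rel +%R *%R -%R 0 T f = 0.
Proof.
pose F A add mul opp zero U (l k : nat) :=
  fun g : nat -> nat -> A => @star_rel A add mul opp zero U g.
rewrite -[star_rel _ _ _ _ _ _]/(F R +%R *%R -%R 0 T 0%N 0%N f).
by expand F 0%N 0%N; ring.
Qed.

End Relations.

(** * The cross product of a G2-structure *)

Section Frame.

Variable R : realType.
Variable T : nat -> nat -> nat -> R.

Local Notation t := (alt3 -%R 0 T).
Local Notation star := (star_poly +%R *%R -%R 0 T).

Lemma alt3_swap23 i j k : t i j k = - t i k j.
Proof.
rewrite /alt3 [(k == j)%N]eq_sym; case: (ltngtP i j); case: (ltngtP i k);
  case: (ltngtP j k) => //= *; rewrite ?opprK ?oppr0 //; lia.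
Qed.

Lemma alt3_swap12 i j k : t i j k = - t j i k.
Proof.
rewrite /alt3 [(j == i)%N]eq_sym; case: (ltngtP i j); case: (ltngtP i k);
  case: (ltngtP j k) => //= *; rewrite ?opprK ?oppr0 //; lia.
Qed.

Lemma alt3_diag12 i j : t i i j = 0.
Proof. by have := alt3_swap12 i i j; lra. Qed.

Lemma sum_s6 (F : nat -> R) : sum_of +%R 0 F s6 = \sum_(m < 6) F m.+1.
Proof. by rewrite /sum_of /= !big_ord_recl big_ord0. Qed.

Lemma ord_s6 (i : 'I_6) : i.+1 \in s6.
Proof. by rewrite mem_iota /= ltnS. Qed.

Lemma ord6_lt7 (i : 'I_6) : (i.+1 < 7)%N.
Proof. by rewrite ltnS. Qed.

(** J, P, x and K are the matrices of omega, omega^2, omega ∧ rho and of Hitchin's endomorphism. The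
    relations turn orthonormality into J P = -2c, J x = 0 and, as x then vanishes, J K = -2c. Since
    K^2 is scalar, so is J^2, and P is a multiple of J. *)
Lemma frame_cross_product (c : R) : c != 0 ->
  (forall k l, (k < 7)%N -> (l < 7)%N ->
     metric_poly +%R *%R -%R 0 T k l = 6 * c * (k == l)%:R) ->
  exists2 s, 0 < s &
    (forall i j : 'I_7, \sum_(m < 7) t 0 i m * t 0 j m =
       s * ((i == j)%:R - (i == ord0)%:R * (j == ord0)%:R)) /\
    (forall i j, (i < 7)%N -> (j < 7)%N -> star 0%N i j = 2 * c / s * t 0 i j).
Proof.
move=> c0 hB.
pose J : 'M[R]_6 := \matrix_(i, j) t 0 i.+1 j.+1.
pose P : 'M[R]_6 := \matrix_(i, j) star 0%N i.+1 j.+1.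
pose K : 'M[R]_6 := \matrix_(i, j) star j.+1 0%N i.+1.
pose x : 'cV[R]_6 := \col_j star 0%N 0%N j.+1.
have JP : J *m P = (- 2 * c)%:M.
  apply/matrixP => l k; rewrite !mxE.
  under eq_bigr => m _ do rewrite !mxE.
  have := pfaffian_rel_eq0 T (ord_s6 l) (ord_s6 k).
  rewrite /pfaffian_rel sum_s6 /triple eqSS val_eqE (hB 0%N 0%N) //.
  by case: eqP => _; rewrite ?mulr1n ?mulr0n; lra.
have uJ : J \in unitmx.
  have /mulmx1_unit[] // : J *m ((- 2 * c)^-1 *: P) = 1%:M.
  rewrite -scalemxAr JP scale_scalar_mx mulVf //.
  by rewrite mulf_neq0 // oppr_eq0 pnatr_eq0.
have x0 : x = 0.
  apply: (can_inj (mulKmx uJ)); rewrite mulmx0; apply/matrixP => l k; rewrite !mxE.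
  under eq_bigr => m _ do rewrite !mxE.
  have := metric0_rel_eq0 T (ord_s6 l); rewrite /metric0_rel sum_s6 /triple hB ?ord6_lt7 //.
  by rewrite /= mulr0 add0r; lra.
have star00 j : star 0%N 0%N j.+1 = 0 \/ (6 <= j)%N.
  case: (ltnP j 6) => [j6|]; last by right.
  by left; have /matrixP/(_ (Ordinal j6) 0) := x0; rewrite !mxE.
have JK : J *m K = (- 2 * c)%:M.
  apply/matrixP => l k; rewrite !mxE.
  under eq_bigr => m _ do rewrite !mxE.
  have := metric_rel_eq0 T (ord_s6 l) (ord_s6 k).
  rewrite /metric_rel !sum_s6 /triple hB ?ord6_lt7 // eqSS val_eqE.
  rewrite [X in _ - X]big1 => [|j _]; last first.
    by case: (star00 j) => [->|]; rewrite ?mul0r // leqNgt ltn_ord.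
  by rewrite eq_sym; case: eqP => _; rewrite ?mulr1n ?mulr0n; lra.
pose lam := (K *m K) 0 0.
have KK : K *m K = lam%:M.
  apply/matrixP => m k; rewrite [in RHS]mxE /lam !mxE.
  under eq_bigr => l _ do rewrite !mxE.
  under [in RHS]eq_bigr => l _ do rewrite !mxE.
  have := hitchin_rel_eq0 T (ord_s6 m) (ord_s6 k).
  rewrite /hitchin_rel !sum_s6 eqSS val_eqE.
  by case: eqP => _; rewrite ?mulr1n ?mulr0n ?addr0 // => /eqP; rewrite subr_eq0 => /eqP.
(* J J K K is evaluated in two ways: through K^2 = lam and through J K = -2c. *)
have JJ : lam *: (J *m J) = (4 * c ^+ 2)%:M.
  transitivity (J *m (J *m K) *m K); last first.
    rewrite JK mul_mx_scalar -scalemxAl JK scale_scalar_mx; congr (_%:M); ring.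
  by rewrite mulmxA -mulmxA KK mul_mx_scalar.
have lam0 : lam != 0.
  apply/eqP => l0; move: JJ; rewrite l0 scale0r => /matrixP/(_ 0 0).
  by rewrite !mxE mulr1n => /esym/eqP; rewrite mulf_eq0 expf_eq0 (negPf c0) pnatr_eq0.
pose s := - (4 * c ^+ 2 / lam).
have JJs : J *m J = (- s)%:M.
  by rewrite -[LHS]scale1r -(mulVf lam0) -scalerA JJ scale_scalar_mx opprK mulrC.
have Jskew i j : J i j = - J j i by rewrite !mxE alt3_swap23.
have sE (i j : 'I_6) : \sum_m J i m * J j m = s * (i == j)%:R.
  have /matrixP/(_ i j) := JJs; rewrite !mxE => h.
  rewrite (eq_bigr (fun m => - (J i m * J m j))) => [|m _]; last first.
    by rewrite [J j m]Jskew mulrN.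
  by rewrite sumrN h; case: eqP => _; rewrite ?mulr1n ?mulr0n; ring.
(* J is skew, so s = - J^2 = J J^T, whose diagonal entries are sums of squares. *)
have s0 : 0 < s.
  rewrite lt_neqAle; apply/andP; split.
    by rewrite eq_sym oppr_eq0 !mulf_neq0 ?invr_eq0 ?expf_neq0 ?pnatr_eq0.
  have := sE 0 0; rewrite eqxx mulr1 => <-.
  by apply: sumr_ge0 => m _; rewrite -expr2 sqr_ge0.
exists s => //; split.
  move=> i j; case: (unliftP ord0 i) => [i'|] ->; last first.
    rewrite big1 => [|m _]; last by rewrite alt3_diag12 mul0r.
    by rewrite eqxx mul1r eq_sym subrr mulr0.
  case: (unliftP ord0 j) => [j'|] ->; last first.
    rewrite big1 => [|m _]; last by rewrite alt3_diag12 mulr0.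
    by rewrite eqxx mulr1 subrr mulr0.
  have t00 n : t 0 n 0 = 0 by rewrite alt3_swap23 alt3_diag12 oppr0.
  rewrite big_ord_recl [X in X + _](_ : _ = 0) ?add0r; last first.
    by apply/eqP; rewrite mulf_eq0; apply/orP; left; apply/eqP; exact: t00.
  rewrite (inj_eq lift_inj) mul0r subr0 -sE; apply: eq_bigr => m _.
  by rewrite !mxE.
have PJ : P = (2 * c / s) *: J.
  apply: (can_inj (mulKmx uJ)); rewrite JP -scalemxAr JJs scale_scalar_mx.
  by congr (_%:M); field; rewrite gt_eqF.
have skew i j : star 0%N i j = - star 0%N j i.
  by rewrite /star_poly; case: ltngtP; rewrite ?opprK ?oppr0.
move=> [|i] [|j] i7 j7.
- by rewrite alt3_diag12 mulr0.
- rewrite alt3_diag12 mulr0; case: (star00 j) => //; lia.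
- rewrite skew alt3_swap23 alt3_diag12; case: (star00 i) => [->|]; last lia.
  by rewrite oppr0 mulr0.
have /matrixP/(_ (Ordinal (i7 : (i < 6)%N)) (Ordinal (j7 : (j < 6)%N))) := PJ.
by rewrite !mxE.
Qed.

End Frame.

(** * The contraction identity, from one basis vector to all pairs *)

Section G2Contraction.

Variable R : realType.
Implicit Types (a b c : ext_alg R) (u v w : 'rV[R]_7) (i j k l : 'I_7).
Implicit Types (O : 'M[R]_7) (phi beta : ext_alg R).

Local Notation e := (@basis_vec R).

Definition coefs phi (i j k : nat) : R := coef3 phi (inord i) (inord j) (inord k).

Lemma alt3_coefs phi i j k : alt3 -%R 0 (coefs phi) i j k = coef3 phi i j k.
Proof.
have d12 x y : coef3 phi x x y = 0 by have := coef3C12 phi x x y; lra.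
have d23 x y : coef3 phi x y y = 0 by have := coef3C23 phi x y y; lra.
have c12 x y z := coef3C12 phi x y z; have c23 x y z := coef3C23 phi x y z.
rewrite /alt3 /coefs !inord_val.
case: ltngtP => [ij|ij|/val_inj ij].
- case: ltngtP => [//|jk|/val_inj <-]; last by rewrite d23.
  case: ltngtP => [_|_|/val_inj ik].
  + by rewrite -c23.
  + by rewrite [RHS]c23 [in RHS]c12 opprK.
  + by rewrite -ik c23 d12 oppr0.
- case: ltngtP => [ik|ik|/val_inj <-].
  + by rewrite -c12.
  + case: ltngtP => [_|_|/val_inj jk].
    * by rewrite [RHS]c12 [in RHS]c23 opprK.
    * by rewrite [RHS]c12 [in RHS]c23 [in RHS]c12 opprK.
    * by rewrite -jk d23.
  + by rewrite c23 d12 oppr0.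
- by rewrite ij d12.
Qed.

Lemma sum_ofE (I : eqType) (F : I -> R) (s : seq I) :
  sum_of +%R 0 F s = \sum_(x <- s) F x.
Proof. by elim: s => [|x s IH]; rewrite ?big_nil // big_cons -IH. Qed.

Definition coefs2 a (i j : nat) : R := coef2 a (inord i) (inord j).

Lemma coefs2_nat_set a (i j : nat) : (i < j)%N -> (j < 7)%N ->
  a (nat_set [:: i; j]) = coefs2 a i j.
Proof.
move=> ij j7; have i7 := ltn_trans ij j7.
by rewrite /coefs2 -coef2_nat_set /= !inordK.
Qed.

Lemma coefs_nat_set a (i j k : nat) : (i < j)%N -> (j < k)%N -> (k < 7)%N ->
  a (nat_set [:: i; j; k]) = coefs a i j k.
Proof.
move=> ij jk k7; have j7 := ltn_trans jk k7; have i7 := ltn_trans ij j7.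
by rewrite /coefs -coef3_nat_set /= !inordK.
Qed.

Lemma shuffles223P : all (fun x => [&& sorted ltn x.1.2, sorted ltn x.2.1,
   sorted ltn x.2.2, all (fun i : nat => i < 7)%N (x.1.2 ++ x.2.1 ++ x.2.2),
   size x.1.2 == 2, size x.2.1 == 2 & size x.2.2 == 3]) shuffles223.
Proof. by []. Qed.

Lemma top3_polyE a b c : homog 2 a -> homog 2 b ->
  top3 a b c = top3_poly +%R *%R -%R 0 (coefs2 a) (coefs2 b) (coefs c).
Proof.
move=> ha hb; rewrite top3_shuffles // /top3_poly sum_ofE.
apply: eq_big_seq => -[[s A] [B C]] /(allP shuffles223P) /=.
move=> /and5P[sA sB sC l7 /and3P[/eqP zA /eqP zB /eqP zC]].
case: A zA sA l7 => [|a1 [|a2 []]] // _ sA.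
case: B zB sB => [|b1 [|b2 []]] // _ sB.
case: C zC sC => [|c1 [|c2 [|c3 []]]] // _ sC.
move: sA sB sC; rewrite /= !andbT.
move=> a12 b12 /andP[c12 c23] /and5P[a17 a27 b17 b27 /and3P[c17 c27 c37]].
rewrite !coefs2_nat_set // coefs_nat_set // /signed.
by case: s; rewrite ?expr0 ?expr1 ?mulN1r ?mul1r.
Qed.

Lemma eq_top3_poly (f f' g g' : nat -> nat -> R) (h h' : nat -> nat -> nat -> R) :
  (forall i j : nat, (i < 7)%N -> (j < 7)%N -> f i j = f' i j) ->
  (forall i j : nat, (i < 7)%N -> (j < 7)%N -> g i j = g' i j) ->
  (forall i j k : nat, (i < 7)%N -> (j < 7)%N -> (k < 7)%N -> h i j k = h' i j k) ->
  top3_poly +%R *%R -%R 0 f g h = top3_poly +%R *%R -%R 0 f' g' h'.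
Proof.
move=> ff gg hh; rewrite /top3_poly !sum_ofE.
apply: eq_big_seq => -[[s A] [B C]] /(allP shuffles223P) /=.
move=> /and5P[sA sB sC l7 /and3P[/eqP zA /eqP zB /eqP zC]].
case: A zA sA l7 => [|a1 [|a2 []]] // _ sA.
case: B zB sB => [|b1 [|b2 []]] // _ sB.
case: C zC sC => [|c1 [|c2 [|c3 []]]] // _ sC.
move: sA sB sC; rewrite /= !andbT.
move=> _ _ _ /and5P[a17 a27 b17 b27 /and3P[c17 c27 c37]].
by rewrite ff // gg // hh.
Qed.

Lemma dot_pairs a b : homog 2 a ->
  dot a b = \sum_(p <- pairs7) coefs2 a p.1 p.2 * coefs2 b p.1 p.2.
Proof.
move=> ha; rewrite /dot (bigID (fun A : {set 'I_7} => #|A| == 2)) /=.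
rewrite [X in _ + X]big1 ?addr0 => [|A nA]; last first.
  have [->|/ha cA] := eqVneq (a A) 0; first by rewrite mul0r.
  by rewrite cA eqxx in nA.
rewrite (eq_bigl (fun A : {set 'I_7} => (A \subset nat_set (iota 0 7)) && (#|A| == 2))).
  rewrite sum_subseqs ?iota_uniq //.
  have -> : subseqs 2 (iota 0 7) = [seq [:: p.1; p.2] | p <- pairs7] by [].
  rewrite big_map; apply: eq_big_seq => -[i j] ij /=.
  have /andP[lij j7] : (i < j)%N && (j < 7)%N.
    have : all (fun p => (p.1 < p.2) && (p.2 < 7))%N pairs7 by [].
    by move=> /allP/(_ _ ij).
  by rewrite !coefs2_nat_set.
move=> A; rewrite (_ : A \subset _) //; apply/subsetP => i _; rewrite inE.
by have -> : val i \in iota 0 7 by rewrite mem_iota ltn_ord.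
Qed.

(** The standard basis is orthonormal for g_phi, with c the top coefficient of the volume form. An
    orthogonal change of frame multiplies c by its determinant, so c is kept as a parameter. *)
Definition G2_frame phi (c : R) : Prop :=
  [/\ homog 3 phi, c != 0 & forall k l : 'I_7,
    top3 (iprod (e k) phi) (iprod (e l) phi) phi = 6 * c * (k == l)%:R].

Lemma G2_frame_e0 phi (c : R) : G2_frame phi c -> exists2 s, 0 < s &
  (forall i j, \sum_m coef3 phi ord0 i m * coef3 phi ord0 j m =
     s * ((i == j)%:R - (i == ord0)%:R * (j == ord0)%:R)) /\
  (forall a, homog 2 a ->
     top3 a (iprod (e ord0) phi) phi = 2 * c / s * dot a (iprod (e ord0) phi)).
Proof.
move=> [h3 c0 hB]; have hi k : homog 2 (iprod (e k) phi) by apply: homog_iprod.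
have alt (i j k : nat) : (i < 7)%N -> (j < 7)%N -> (k < 7)%N ->
    coefs phi i j k = alt3 -%R 0 (coefs phi) i j k.
  by move=> i7 j7 k7; rewrite /coefs -alt3_coefs !inordK.
have top3E a k : homog 2 a -> top3 a (iprod (e k) phi) phi =
    top3_poly +%R *%R -%R 0 (coefs2 a) (alt3 -%R 0 (coefs phi) k)
      (alt3 -%R 0 (coefs phi)).
  move=> ha; rewrite top3_polyE //; apply: eq_top3_poly => // i j i7 j7.
  by rewrite -alt // /coefs inord_val.
have [k l k7 l7|s s0 [h1 h2]] := @frame_cross_product R (coefs phi) c c0.
  rewrite /metric_poly -(inordK k7) -(inordK l7) val_eqE -hB top3E //.
  apply: eq_top3_poly => // i j i7 j7.
  by rewrite -alt // /coefs inord_val.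
exists s => //; split=> [i j|a ha].
  rewrite -h1; apply: eq_bigr => m _.
  by rewrite -!alt3_coefs.
rewrite top3E // dot_pairs // mulr_sumr.
have := star_rel_eq0 (coefs phi) (coefs2 a); rewrite /star_rel => /eqP.
rewrite subr_eq0 => /eqP ->; rewrite sum_ofE; apply: eq_big_seq => -[i j] ij /=.
have /andP[lij j7] : (i < j)%N && (j < 7)%N.
  have : all (fun p => (p.1 < p.2) && (p.2 < 7))%N pairs7 by [].
  by move=> /allP/(_ _ ij).
have i7 := ltn_trans lij j7.
have i00 : inord 0 = ord0 :> 'I_7 by apply/val_inj; rewrite /= inordK.
by rewrite h2 // -alt // mulrCA; congr (_ * (_ * _)); rewrite /coefs i00.
Qed.

Lemma top3_pull P a b c : top3 (pull P a) (pull P b) (pull P c) = \det P * top3 a b c.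
Proof. by rewrite /top3 -!pull_wedge pull_setT. Qed.

Lemma top3Zl (x : R) a b c : top3 (x *: a) b c = x * top3 a b c.
Proof. by rewrite /top3 !wedgeZl ffunE. Qed.

Lemma top3Zr (x : R) a b c : top3 a (x *: b) c = x * top3 a b c.
Proof. by rewrite /top3 wedgeZr wedgeZl ffunE. Qed.

Lemma top3_suml (F : 'I_7 -> ext_alg R) b c :
  top3 (\sum_i F i) b c = \sum_i top3 (F i) b c.
Proof. by rewrite /top3 !wedge_suml sum_ffunE. Qed.

Lemma top3_sumr (F : 'I_7 -> ext_alg R) b c :
  top3 b (\sum_i F i) c = \sum_i top3 b (F i) c.
Proof. by rewrite /top3 wedge_sumr wedge_suml sum_ffunE. Qed.

Lemma G2_frame_form phi (x : R) v w : G2_frame phi x ->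
  top3 (iprod v phi) (iprod w phi) phi = 6 * x * (v *m w^T) 0 0.
Proof.
move=> [_ _ hB]; rewrite (iprod_sum_basis v) (iprod_sum_basis w).
rewrite top3_suml mxE mulr_sumr; apply: eq_bigr => i _.
rewrite top3_sumr (bigD1 i) //= big1 ?addr0 => [|j /negPf ji].
  by rewrite top3Zl top3Zr hB eqxx !mxE mulr1; ring.
by rewrite top3Zl top3Zr hB eq_sym ji !mulr0.
Qed.

Lemma G2_frame_pull O phi (x : R) : O *m O^T = 1%:M -> G2_frame phi x ->
  G2_frame (pull O phi) (\det O * x).
Proof.
move=> hO h; have [h3 x0 hB] := h; split.
- exact: pull_homog.
- rewrite mulf_neq0 // -unitfE -unitmxE; exact: (mulmx1_unit hO).1.
move=> k l; rewrite !iprod_pull top3_pull (G2_frame_form _ _ h) -!rowE.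
have -> : (row k O *m (row l O)^T) 0 0 = (k == l)%:R.
  have /matrixP/(_ k l) := hO; rewrite mxE [1%:M k l]mxE => <-.
  by rewrite mxE; apply: eq_bigr => i _; rewrite !mxE.
by ring.
Qed.

(* Householder reflection *)
Lemma orthogonal_extension v : v *m v^T = 1%:M ->
  exists O, O *m O^T = 1%:M /\ row ord0 O = v.
Proof.
move=> v1; have [->|ve] := eqVneq v (e ord0).
  by exists 1%:M; rewrite trmx1 mulmx1 rowE mulmx1.
pose n := v - e ord0; pose q := (n *m n^T) 0 0.
have e1 : e ord0 *m (e ord0)^T = 1%:M.
  by rewrite trmx_delta mul_delta_mx; apply/matrixP => i j; rewrite !ord1 !mxE.
pose r := (e ord0 *m v^T) 0 0.
have er : e ord0 *m v^T = r%:M by rewrite [LHS]mx11_scalar.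
have re : v *m (e ord0)^T = r%:M by rewrite -[LHS]trmxK trmx_mul trmxK er tr_scalar_mx.
have qE : q = 2 - 2 * r.
  rewrite /q /n linearB /= mulmxBl !mulmxBr v1 e1 er re !mxE !mulr1n; ring.
have nn : n *m n^T = q%:M by rewrite [LHS]mx11_scalar.
have q0 : q != 0.
  apply/eqP => q0; case/eqP: ve; apply/eqP; rewrite -subr_eq0 -/n; apply/eqP.
  have : \sum_i n 0 i ^+ 2 = 0.
    rewrite -[RHS]q0 /q [RHS]mxE; apply: eq_bigr => i _; by rewrite [n^T _ _]mxE expr2.
  move=> /psumr_eq0P h; apply/rowP => i; rewrite [RHS]mxE.
  by apply/eqP; rewrite -sqrf_eq0; apply/eqP/h => // j _; apply: sqr_ge0.
pose O : 'M[R]_7 := 1%:M - (2 / q) *: (n^T *m n).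
have tO : O^T = O.
  by rewrite /O linearB /= trmx1 linearZ /= trmx_mul trmxK.
exists O; split.
  pose N := n^T *m n; pose k := 2 / q.
  have NN : N *m N = q *: N.
    by rewrite /N mulmxA -[n^T *m n *m n^T]mulmxA nn mul_mx_scalar scalemxAl.
  rewrite tO -[O]/(1%:M - k *: N) mulmxBr mulmx1 mulmxBl mul1mx.
  rewrite -scalemxAl -scalemxAr NN; move: (N) => M; apply/matrixP => i j.
  by rewrite !mxE /k; field.
rewrite rowE /O mulmxBr mulmx1 -scalemxAr mulmxA.
have -> : delta_mx 0 ord0 *m n^T = (r - 1)%:M.
  by rewrite /n linearB /= mulmxBr er e1 [RHS]raddfB.
rewrite mul_scalar_mx scalerA (_ : 2 / q * (r - 1) = -1).
  by rewrite scaleN1r opprK addrC subrK.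
have : 2 - 2 * r != 0 by rewrite -qE.
by rewrite qE => h; field.
Qed.

Definition form_mx phi v : 'M[R]_7 := \matrix_(i, j) coef2 (iprod v phi) i j.

Lemma dot_pull_orthogonal O a b : O *m O^T = 1%:M ->
  dot (pull O a) (pull O b) = dot a b.
Proof. by move=> /mulmx1C hO; rewrite dot_pull pull_comp hO pull1. Qed.

(** An orthogonal matrix with first row v reduces the claim to e_0. At this stage s may depend on
    v. *)
Lemma G2_frame_unit phi (x : R) v : G2_frame phi x -> v *m v^T = 1%:M ->
  exists2 s, 0 < s &
  form_mx phi v *m (form_mx phi v)^T = s *: (1%:M - v^T *m v) /\
  (forall a, homog 2 a ->
     top3 a (iprod v phi) phi = 2 * x / s * dot a (iprod v phi)).
Proof.
move=> h /orthogonal_extension[O [hO Ov]].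
have hO' := mulmx1C hO.
have [s s0 [h1 h2]] := G2_frame_e0 (G2_frame_pull hO h).
have iv : iprod (e ord0) (pull O phi) = pull O (iprod v phi).
  by rewrite iprod_pull -rowE Ov.
exists s => //; split=> [|a ha].
  have fE : form_mx (pull O phi) (e ord0) = O *m form_mx phi v *m O^T.
    by rewrite /form_mx iv coef2_pull.
  have : form_mx (pull O phi) (e ord0) *m (form_mx (pull O phi) (e ord0))^T =
      s *: (1%:M - (e ord0)^T *m e ord0).
    apply/matrixP => i j; rewrite mxE; under eq_bigr => m _ do rewrite !mxE.
    by rewrite h1 !mxE big_ord1 !mxE !eqxx.
  rewrite fE !trmx_mul trmxK => /(congr1 (fun M => O^T *m M *m O)).
  rewrite !mulmxA hO' mul1mx -[_ *m O^T *m O]mulmxA hO' mulmx1.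
  rewrite -[_ *m O^T *m O]mulmxA hO' mulmx1 => ->.
  rewrite -scalemxAr -scalemxAl mulmxBr mulmx1 mulmxBl hO' !mulmxA.
  by rewrite -trmx_mul -mulmxA -rowE Ov.
have dO : \det O != 0 by rewrite -unitfE -unitmxE; exact: (mulmx1_unit hO).1.
apply: (mulfI dO); rewrite -top3_pull -iv h2 ?iv ?dot_pull_orthogonal //.
  by rewrite !mulrA; congr (_ * _); ring.
exact: pull_homog.
Qed.

Lemma form_mx_basis phi i j k : form_mx phi (e i) j k = coef3 phi i j k.
Proof. by rewrite mxE. Qed.

Lemma form_mx_lin phi (x y : R) v w :
  form_mx phi (x *: v + y *: w) = x *: form_mx phi v + y *: form_mx phi w.
Proof.
apply/matrixP => i j; rewrite !mxE /coef2 iprodDl !iprodZl.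
by rewrite !iprodDr !iprodZr !ffunE.
Qed.

Lemma basis_vec_dot i j : e i *m (e j)^T = (i == j)%:R%:M.
Proof.
apply/matrixP => k l; rewrite !ord1 trmx_delta [RHS]mxE mulr1n.
by rewrite /basis_vec mul_delta_mx_cond mulmxnE mxE !eqxx.
Qed.

(* Polarised form of u x (u x w) = - s (|u|^2 w - <u, w> u). *)
Lemma G2_frame_contraction phi (x : R) : G2_frame phi x -> exists2 s, 0 < s &
  (forall i j k l, \sum_m (coef3 phi i k m * coef3 phi j l m +
                          coef3 phi j k m * coef3 phi i l m) =
     s * (2 * (i == j)%:R * (k == l)%:R - (i == k)%:R * (j == l)%:R
        - (i == l)%:R * (j == k)%:R)) /\
  (forall i a, homog 2 a ->
     top3 a (iprod (e i) phi) phi = 2 * x / s * dot a (iprod (e i) phi)).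
Proof.
move=> h; pose F i := form_mx phi (e i).
have e1 i : e i *m (e i)^T = 1%:M by rewrite basis_vec_dot eqxx.
have FE i j k l : (F i *m (F j)^T) k l = \sum_m coef3 phi i k m * coef3 phi j l m.
  by rewrite mxE; apply: eq_bigr => m _; rewrite [_^T _ _]mxE !form_mx_basis.
have [s s0 [h1 h2]] := G2_frame_unit h (e1 ord0).
have ee (r : R) i k l : (r *: (1%:M - (e i)^T *m e i)) k l =
    r * ((k == l)%:R - ((i == k) && (i == l))%:R).
  by rewrite !mxE big_ord1 !mxE !eqxx /= -natrM mulnb ![_ == i]eq_sym.
have same i : F i *m (F i)^T = s *: (1%:M - (e i)^T *m e i) /\
    (forall a, homog 2 a ->
     top3 a (iprod (e i) phi) phi = 2 * x / s * dot a (iprod (e i) phi)).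
  have [->//|ni] := eqVneq i ord0.
  have [s' s'0 [h1' h2']] := G2_frame_unit h (e1 i).
  (* The two scales agree because |e_i × e_0|^2 = |e_0 × e_i|^2. *)
  suff ss : s' = s by rewrite -{1}ss; split=> // a ha; rewrite -ss; apply: h2'.
  have /matrixP/(_ ord0 ord0) := h1'; rewrite -/(F i) FE ee.
  rewrite (negPf ni) /= subr0 mulr1 => <-.
  have /matrixP/(_ i i) := h1; rewrite -/(F ord0) FE ee.
  rewrite eq_sym (negPf ni) /= eqxx subr0 mulr1 => <-.
  by apply: eq_bigr => m _; rewrite coef3C12 mulrNN.
exists s => //; split=> [i j k l|i]; last by case: (same i).
rewrite big_split /= -!FE.
have [->|nij] := eqVneq i j.
  rewrite (same j).1 ee.
  case: (eqVneq k l) => [->|nkl].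
    by case: (j == l) => /=; ring.
  case: (eqVneq j k) => [jk|_]; last by rewrite /=; ring.
  by rewrite -jk in nkl; rewrite (negPf nkl) /=; ring.
(* A unit vector with rational coordinates, from 3^2 + 4^2 = 5^2; its cross term gives the polarised
   identity. *)
pose v := (3 / 5) *: e i + (4 / 5) *: e j.
have v1 : v *m v^T = 1%:M.
  rewrite /v linearD /= !linearZ /= mulmxDl !mulmxDr -!scalemxAl -!scalemxAr.
  rewrite !basis_vec_dot !eqxx [j == i]eq_sym (negPf nij).
  by apply/matrixP => a b; rewrite !ord1 !mxE /=; field.
have [s' s'0 [h1' _]] := G2_frame_unit h v1.
have FV : form_mx phi v = (3 / 5) *: F i + (4 / 5) *: F j by rewrite form_mx_lin.
have [d di dj] : exists2 d, d != i & d != j.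
  have [d] : exists d, d \in ~: [set i; j].
    by apply/set0Pn; rewrite -card_gt0 cardsCs setCK card_ord cards2 nij.
  by rewrite !inE negb_or => /andP[]; exists d.
have expand_kl k' l' : 9 / 25 * (F i *m (F i)^T) k' l' + 16 / 25 * (F j *m (F j)^T) k' l' +
    12 / 25 * ((F i *m (F j)^T) k' l' + (F j *m (F i)^T) k' l') =
    s' * ((k' == l')%:R - (9 / 25 * ((i == k') && (i == l'))%:R +
       16 / 25 * ((j == k') && (j == l'))%:R +
       12 / 25 * (((i == k') && (j == l'))%:R + ((j == k') && (i == l'))%:R))).
  have /matrixP/(_ k' l') := h1'; rewrite FV linearD /= !linearZ /= mulmxDl !mulmxDr.
  rewrite -!scalemxAl -!scalemxAr !mxE !big_ord1 !mxE /= => e1'.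
  rewrite ![k' == _]eq_sym ![l' == _]eq_sym in e1'.
  rewrite -!mulnb !natrM.
  move: e1'; set f1 := \sum_m _; set f2 := \sum_m _; set f3 := \sum_m _.
  by set f4 := \sum_m _ => e1'; apply: etrans (etrans e1' _); field.
(* Evaluated at a third direction d, the cross term becomes <e_d × e_i, e_d × e_j>, which vanishes
   by the identity for e_d; what remains compares s' with s. *)
have ss : s' = s.
  have := expand_kl d d; rewrite (same i).1 (same j).1 !FE.
  rewrite (eq_bigr (fun m => coef3 phi d i m * coef3 phi d j m)); last first.
    by move=> m _; rewrite coef3C12 [coef3 phi j d m]coef3C12 mulrNN.
  rewrite [X in _ + _ * (_ + X)](eq_bigr (fun m => coef3 phi d j m * coef3 phi d i m)); last first.
    by move=> m _; rewrite coef3C12 [coef3 phi i d m]coef3C12 mulrNN.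
  rewrite -!FE (same d).1 !ee !eqxx /=.
  rewrite ![i == d]eq_sym ![j == d]eq_sym (negPf di) (negPf dj) [j == i]eq_sym (negPf nij) /=.
  by move=> ?; lra.
have := expand_kl k l; rewrite (same i).1 (same j).1 ss.
rewrite !ee -!mulnb !natrM.
set p := (F i *m _) k l; set q := (F j *m _) k l.
by rewrite mulr0 mul0r => E; lra.
Qed.

End G2Contraction.

(** * Symmetric 3 x 3 matrices *)

Section SolitonAlgebra.

Variable R : realFieldType.

Lemma sum_ord3 (F : 'I_3 -> R) : \sum_i F i = F 0 + F 1 + F 2%:R.
Proof.
rewrite !big_ord_recl big_ord0 addr0 addrA.
by congr (_ + F _ + F _); apply: val_inj.
Qed.

Lemma ord3P (P : 'I_3 -> Prop) : P 0 -> P 1 -> P 2%:R -> forall i, P i.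
Proof.
move=> P0 P1 P2 [[|[|[|//]]] i3].
- by rewrite (_ : Ordinal i3 = 0) //; apply: val_inj.
- by rewrite (_ : Ordinal i3 = 1) //; apply: val_inj.
- by rewrite (_ : Ordinal i3 = 2%:R) //; apply: val_inj.
Qed.

Lemma mxtrace3 (A : 'M[R]_3) : \tr A = A 0 0 + A 1 1 + A 2%:R 2%:R.
Proof. exact: sum_ord3. Qed.

Lemma det2 (A : 'M[R]_2) : \det A = A 0 0 * A 1 1 - A 0 1 * A 1 0.
Proof.
rewrite (expand_det_row _ 0) !big_ord_recl big_ord0 /cofactor !det_mx11 !mxE.
have l (i : 'I_2) (j : 'I_1) k : bump i j = val k -> lift i j = k.
  by move=> h; apply: val_inj.
rewrite !(l 0 0 1, l 1 0 0) //= (_ : (0 + 1 %% 2)%N = 1%N) // (_ : (0 + 0)%N = 0%N) //.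
by rewrite expr0 expr1; ring.
Qed.

Lemma det3 (A : 'M[R]_3) : \det A =
  A 0 0 * (A 1 1 * A 2%:R 2%:R - A 1 2%:R * A 2%:R 1)
  - A 0 1 * (A 1 0 * A 2%:R 2%:R - A 1 2%:R * A 2%:R 0)
  + A 0 2%:R * (A 1 0 * A 2%:R 1 - A 1 1 * A 2%:R 0).
Proof.
rewrite (expand_det_row _ 0) sum_ord3 /cofactor !det2 !mxE.
have l (i : 'I_3) (j : 'I_2) k : bump i j = val k -> lift i j = k.
  by move=> h; apply: val_inj.
rewrite !(l 0 0 1, l 0 1 2%:R, l 1 0 0, l 1 1 2%:R, l 2%:R 0 0, l 2%:R 1 1) //=.
by rewrite !expr0 !expr1 ?addn0 ?add0n expr2; ring.
Qed.

(** The second elementary symmetric function of the eigenvalues. For a symmetric A with determinant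
    0, it is nonzero exactly when A has rank two. *)
Definition minors3 (A : 'M[R]_3) : R := ((\tr A) ^+ 2 - \tr (A *m A)) / 2.

Lemma cayley_hamilton3 (A : 'M[R]_3) :
  A *m A *m A = \tr A *: (A *m A) - minors3 A *: A + (\det A)%:M.
Proof.
rewrite /minors3 det3; apply/matrixP => i j.
rewrite !(mxE, mxtrace3, sum_ord3).
by move: i j; do 2!apply: ord3P; rewrite ?mulr1n ?mulr0n /=; field.
Qed.

(** Newton's identities: when e_1 = 0, the power sums of three numbers satisfy p_2 = -2 e_2 and p_4
    = 2 e_2^2. *)
Lemma trace_quartic3 (M : 'M[R]_3) : \tr M = 0 ->
  2 * \tr (M *m M *m (M *m M)) = (\tr (M *m M)) ^+ 2.
Proof.
move=> trM; have := trM; rewrite !(mxE, mxtrace3, sum_ord3) => t0.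
have -> : M 2%:R 2%:R = - M 0 0 - M 1 1 by rewrite -[RHS]add0r -t0; ring.
by ring.
Qed.

(** In terms of eigenvalues: those of N are among mu and mu/2, those of Z among 0, mu and -mu.
    Moreover B = 2 mu M^2 equals s (mu^2 + Z^2) + 2 mu q Z, so both sides of 2 tr B^2 = (tr B)^2 are
    functions of tr Z and tr Z^2. The last hypothesis expresses rank two by polynomial
    conditions. *)
Lemma soliton_contradiction (N Z M : 'M[R]_3) (mu s q : R) :
  N \in unitmx -> N^T = N -> Z^T = Z ->
  2 *: (N *m N) - Z *m Z = mu *: N -> 2 *: (N *m Z) - Z *m N = mu *: Z ->
  M^T = M -> \tr M = 0 -> M *m M = s *: N + q *: Z -> 0 < s ->
  (Z != 0 -> q ^+ 2 = s ^+ 2) ->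
  (Z != 0 -> \det Z = 0 /\ minors3 Z != 0) -> False.
Proof.
move=> uN tN tZ e1 e2 tM trM MM s0 hq hZ.
have NZc : N *m Z = Z *m N.
  have := congr1 trmx e2; rewrite linearB !linearZ /= !trmx_mul tN tZ -e2.
  move: (N *m Z) (Z *m N) => a b /matrixP h.
  by apply/matrixP => i j; have := h i j; rewrite !mxE => ?; lra.
have NZ : N *m Z = mu *: Z.
  move: e2; rewrite -NZc; move: (N *m Z) => a /matrixP h.
  by apply/matrixP => i j; have := h i j; rewrite !mxE => ?; lra.
have ZZ : Z *m Z = 2 *: (N *m N) - mu *: N by rewrite -e1 opprB addrC subrK.
(* Multiplying the first equation by N and using N Z^2 = mu Z^2 gives a cubic in N; N is invertible,
   and cancelling it leaves (2 N - mu)(N - mu) = 0. *)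
have NN : 2 *: (N *m N) = (3 * mu) *: N - (mu ^+ 2)%:M.
  suff h : N *m (2 *: (N *m N)) = N *m ((3 * mu) *: N - (mu ^+ 2)%:M).
    exact: (can_inj (mulKmx uN)) h.
  have h1 : N *m (Z *m Z) = mu *: (Z *m Z) by rewrite mulmxA NZ scalemxAl.
  move: h1; rewrite ZZ !mulmxBr -!scalemxAr mul_mx_scalar.
  move: (N *m (N *m N)) (N *m N) => a b /matrixP h1.
  by apply/matrixP => i j; have := h1 i j; rewrite !mxE => ?; lra.
have mu0 : mu != 0.
  apply/eqP => mu0; move: NN; rewrite mu0 mulr0 scale0r expr0n raddf0 subr0.
  move/eqP; rewrite scaler_eq0 pnatr_eq0 /= => /eqP NN0.
  by have := mulKmx uN N; rewrite NN0 mulmx0 => N0; move: uN; rewrite -N0 unitmxE det0 unitr0.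
have NE : (2 * mu) *: N = (mu ^+ 2)%:M + Z *m Z.
  move: NN; rewrite ZZ; move: (N *m N) => a /matrixP h1.
  by apply/matrixP => i j; have := h1 i j; rewrite !mxE => ?; lra.
have Z3 : Z *m Z *m Z = mu ^+ 2 *: Z.
  by rewrite ZZ mulmxBl -!scalemxAl -mulmxA NZ -scalemxAr NZ !scalerA -scalerBl; congr (_ *: _); ring.
have Z3' : Z *m (Z *m Z) = mu ^+ 2 *: Z by rewrite mulmxA.
have Z4 : Z *m Z *m (Z *m Z) = mu ^+ 2 *: (Z *m Z) by rewrite mulmxA Z3 scalemxAl.
have nz : (s * mu ^+ 2) ^+ 2 != 0.
  by apply/expf_neq0/mulf_neq0; [exact: lt0r_neq0 | exact: expf_neq0].
pose B := (2 * mu) *: (M *m M).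
have BE : B = (s * mu ^+ 2)%:M + s *: (Z *m Z) + (2 * mu * q) *: Z.
  rewrite /B MM scalerDr !scalerA [2 * mu * s]mulrC -[X in X + _]scalerA NE scalerDr.
  by rewrite scale_scalar_mx.
have trB : 2 * \tr (B *m B) = (\tr B) ^+ 2.
  have := trace_quartic3 trM; rewrite /B -scalemxAl -scalemxAr !linearZ /= exprMn => h.
  by rewrite -h; ring.
pose z := \tr Z; pose y := \tr (Z *m Z).
have tB : \tr B = 3 * s * mu ^+ 2 + s * y + 2 * mu * q * z.
  by rewrite BE !linearD /= mxtrace_scalar !linearZ /=; ring.
have tBB : \tr (B *m B) = 3 * (s * mu ^+ 2) ^+ 2 +
   (3 * s ^+ 2 * mu ^+ 2 + 4 * mu ^+ 2 * q ^+ 2) * y + 8 * s * q * mu ^+ 3 * z.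
  have -> : B *m B = (s * mu ^+ 2) ^+ 2 *: 1%:M + (3 * s ^+ 2 * mu ^+ 2 + 4 * mu ^+ 2 * q ^+ 2) *: (Z *m Z)
      + (8 * s * q * mu ^+ 3) *: Z.
    rewrite BE !mulmxDl !mulmxDr -!scalemxAl -!scalemxAr Z4 Z3 Z3'.
    rewrite !mul_scalar_mx !mul_mx_scalar !scale_scalar_mx.
    by move: (Z *m Z) => a; apply/matrixP => i j; rewrite !mxE; ring.
  by rewrite !linearD /= !linearZ /= mxtrace1; ring.
(* If Z = 0, then B is the scalar s mu^2, and the trace identity would say 2 · 3 = 3^2. *)
have [Z0|nZ] := eqVneq Z 0.
  have y0 : y = 0 by rewrite /y Z0 mul0mx linear0.
  have z0 : z = 0 by rewrite /z Z0 linear0.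
  move: trB; rewrite tB tBB y0 z0 => /eqP; rewrite -subr_eq0.
  have -> : 2 * (3 * (s * mu ^+ 2) ^+ 2 + (3 * s ^+ 2 * mu ^+ 2 + 4 * mu ^+ 2 * q ^+ 2) * 0 +
    8 * s * q * mu ^+ 3 * 0) - (3 * s * mu ^+ 2 + s * 0 + 2 * mu * q * 0) ^+ 2 = - (3 * (s * mu ^+ 2) ^+ 2) by ring.
  by rewrite oppr_eq0 mulf_eq0 (negPf nz) pnatr_eq0.
have {hq} hq := hq nZ; have {hZ} [dZ eZ] := hZ nZ.
pose e := minors3 Z.
have yE : y = z ^+ 2 - 2 * e by rewrite /e /minors3 -/y -/z; field.
(* Since det Z = 0, Cayley-Hamilton reads Z^3 = z Z^2 - e Z; it is compared with Z^3 = mu^2 Z. *)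
have ch : (mu ^+ 2 + e) *: Z = z *: (Z *m Z).
  have := cayley_hamilton3 Z; rewrite Z3 dZ raddf0 addr0 -/z -/e => h.
  by rewrite scalerDl h subrK.
have ch2 : (mu ^+ 2 + e) ^+ 2 = z ^+ 2 * mu ^+ 2.
  have := congr1 (fun A => (mu ^+ 2 + e) *: A) ch; rewrite /= !scalerA => h.
  have h2 : (mu ^+ 2 + e) * z *: (Z *m Z) = (z * z * mu ^+ 2) *: Z.
    transitivity (z *: ((mu ^+ 2 + e) *: (Z *m Z))); first by rewrite scalerA mulrC.
    by rewrite scalemxAl ch -scalemxAl Z3 !scalerA mulrA.
  move/eqP: h; rewrite h2 -subr_eq0 -scalerBl.
  rewrite scaler_eq0 (negPf nZ) orbF subr_eq0 => /eqP; rewrite !expr2 => ->; ring.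
have ch1 : (mu ^+ 2 + e) * z = z * y.
  by have := congr1 (fun A => \tr A) ch; rewrite /= !linearZ.
have mu2 : mu ^+ 2 != 0 by rewrite expf_neq0.
(* The two nonzero eigenvalues are mu or -mu, with opposite signs (z = 0) or equal signs. *)
have zy : y = 2 * mu ^+ 2 /\ (z = 0 \/ z ^+ 2 = 4 * mu ^+ 2).
  have [z0|z_neq0] := eqVneq z 0.
    split; last by left.
    move: ch2; rewrite z0 expr0n mul0r => /eqP; rewrite sqrf_eq0 addr_eq0 => /eqP h.
    by rewrite yE z0 h; ring.
  have yy : y = mu ^+ 2 + e.
    by apply: (mulfI z_neq0); rewrite -ch1 mulrC.
  have z2 : z ^+ 2 = mu ^+ 2 + 3 * e by move: yE; rewrite yy => h; rewrite -[LHS](subrK (2 * e)) -h; ring.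
  have e2q : e * (e - mu ^+ 2) = 0.
    by move: ch2; rewrite z2 => /eqP; rewrite -subr_eq0 => /eqP <-; ring.
  have em : e = mu ^+ 2.
    by apply/eqP; move/eqP: e2q; rewrite mulf_eq0 (negPf eZ) subr_eq0.
  by split; [rewrite yy em; ring | right; rewrite z2 em; ring].
case: zy => yv zv; move: trB; rewrite tB tBB yv hq.
case: zv => [->|z2] => /eqP; rewrite -subr_eq0.
  have -> : 2 * (3 * (s * mu ^+ 2) ^+ 2 + (3 * s ^+ 2 * mu ^+ 2 + 4 * mu ^+ 2 * s ^+ 2) * (2 * mu ^+ 2) +
    8 * s * q * mu ^+ 3 * 0) - (3 * s * mu ^+ 2 + s * (2 * mu ^+ 2) + 2 * mu * q * 0) ^+ 2 =
     9 * (s * mu ^+ 2) ^+ 2 by ring.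
  by rewrite mulf_eq0 (negPf nz) pnatr_eq0.
have -> : 2 * (3 * (s * mu ^+ 2) ^+ 2 + (3 * s ^+ 2 * mu ^+ 2 + 4 * mu ^+ 2 * s ^+ 2) * (2 * mu ^+ 2) +
    8 * s * q * mu ^+ 3 * z) - (3 * s * mu ^+ 2 + s * (2 * mu ^+ 2) + 2 * mu * q * z) ^+ 2 =
     9 * s ^+ 2 * mu ^+ 4 - 4 * s * q * mu ^+ 3 * z - 4 * mu ^+ 2 * q ^+ 2 * z ^+ 2 by ring.
rewrite hq z2 => /eqP h.
have /eqP : (s * mu ^+ 2) * (7 * s * mu ^+ 2 + 4 * q * mu * z) = 0.
  by rewrite -[RHS]oppr0 -[in RHS]h; ring.
rewrite !mulf_eq0 gt_eqF //= (negPf mu0) /= addr_eq0 => /eqP h3.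
(* Squaring 7 s mu^2 = - 4 q mu z removes the unknown signs of q and z, and would give 49 = 64. *)
have : (7 * s * mu ^+ 2) ^+ 2 = 64 * s ^+ 2 * mu ^+ 4.
  rewrite h3 sqrrN !exprMn hq z2; ring.
move/eqP; rewrite -subr_eq0.
have -> : (7 * s * mu ^+ 2) ^+ 2 - 64 * s ^+ 2 * mu ^+ 4 = - 15 * (s * mu ^+ 2) ^+ 2 by ring.
by rewrite mulf_eq0 (negPf nz) oppr_eq0 pnatr_eq0.
Qed.

End SolitonAlgebra.

(** * Nilsoliton metrics on two-step algebras *)

Section NilsolitonTransport.

Variable R : realType.
Implicit Types (L : structure_eqs R) (G P D : 'M[R]_7) (x y z v w : 'rV[R]_7).

Local Notation e := (@basis_vec R).

Lemma bracket_linl L (a : R) x y z :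
  bracket L (a *: x + y) z = a *: bracket L x z + bracket L y z.
Proof.
apply/rowP => k; rewrite /bracket !mxE iprodDl iprodZl iprodDr iprodZr !ffunE.
by rewrite /GRing.scale /= opprD mulrN.
Qed.

Lemma bracket_linr L (a : R) x y z :
  bracket L z (a *: x + y) = a *: bracket L z x + bracket L z y.
Proof.
apply/rowP => k; rewrite /bracket !mxE iprodDl iprodZl !ffunE.
by rewrite /GRing.scale /= opprD mulrN.
Qed.

Lemma metric_linl G (a : R) x y z : metric G (a *: x + y) z = a * metric G x z + metric G y z.
Proof. by rewrite /metric !mulmxDl -!scalemxAl !mxE. Qed.

Lemma metric_linr G (a : R) x y z : metric G z (a *: x + y) = a * metric G z x + metric G z y.
Proof. by rewrite /metric linearD /= linearZ /= !mulmxDr -!scalemxAr !mxE. Qed.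

Lemma metric_mulmx G P x y : metric G (x *m P) (y *m P) = metric (P *m G *m P^T) x y.
Proof. by rewrite /metric trmx_mul !mulmxA. Qed.

Lemma koszul_lin1 L G (a : R) x x' y z : koszul L G (a *: x + x') y z =
  a * koszul L G x y z + koszul L G x' y z.
Proof. by rewrite /koszul bracket_linl bracket_linr !metric_linl metric_linr; ring. Qed.

Lemma koszul_lin2 L G (a : R) x y y' z : koszul L G x (a *: y + y') z =
  a * koszul L G x y z + koszul L G x y' z.
Proof. by rewrite /koszul bracket_linl bracket_linr !metric_linl metric_linr; ring. Qed.

Lemma koszul_lin3 L G (a : R) x y z z' : koszul L G x y (a *: z + z') =
  a * koszul L G x y z + koszul L G x y z'.
Proof. by rewrite /koszul bracket_linl bracket_linr !metric_linl metric_linr; ring. Qed.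

Lemma linear_form_row (f : 'rV[R]_7 -> R) :
  (forall (a : R) x y, f (a *: x + y) = a * f x + f y) ->
  forall z, f z = \sum_k z 0 k * f (e k).
Proof.
move=> lf z; have f0 : f 0 = 0.
  by have := lf (-1) 0 0; rewrite scaler0 addr0 mulN1r addNr.
rewrite {1}(row_sum_delta z); elim/big_rec2: _ => [//|k a b _ IH].
by rewrite lf IH.
Qed.

Lemma levi_civita_metric L G x y z : G \in unitmx ->
  metric G (levi_civita L G x y) z = 2^-1 * koszul L G x y z.
Proof.
move=> uG; rewrite /metric /levi_civita mulmxKV //.
rewrite (linear_form_row (fun a => koszul_lin3 L G a x y)) mxE mulr_sumr.
by apply: eq_bigr => k _; rewrite !mxE; ring.
Qed.

Lemma levi_civita_linl L G (a : R) x x' y : levi_civita L G (a *: x + x') y =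
  a *: levi_civita L G x y + levi_civita L G x' y.
Proof.
rewrite /levi_civita scalemxAl -mulmxDl; congr (_ *m _).
by apply/rowP => k; rewrite !mxE koszul_lin1; ring.
Qed.

Lemma levi_civita_linr L G (a : R) x y y' : levi_civita L G x (a *: y + y') =
  a *: levi_civita L G x y + levi_civita L G x y'.
Proof.
rewrite /levi_civita scalemxAl -mulmxDl; congr (_ *m _).
by apply/rowP => k; rewrite !mxE koszul_lin2; ring.
Qed.

Lemma curvature_lin L G (a : R) x x' y z : curvature L G (a *: x + x') y z =
  a *: curvature L G x y z + curvature L G x' y z.
Proof.
have aux (A A' B B' C C' : 'rV[R]_7) : a *: A + A' - (a *: B + B') - (a *: C + C') =
    a *: (A - B - C) + (A' - B' - C').
  by apply/rowP => k; rewrite !mxE; ring.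
rewrite /curvature bracket_linl !levi_civita_linl levi_civita_linr; exact: aux.
Qed.

Definition curvature_mx L G y z : 'M[R]_7 :=
  \matrix_(i, j) curvature L G (e i) y z 0 j.

Lemma curvature_mxE L G x y z : x *m curvature_mx L G y z = curvature L G x y z.
Proof.
apply/rowP => j; rewrite mxE.
rewrite (@linear_form_row (fun x => curvature L G x y z 0 j)); last first.
  by move=> a u v; rewrite curvature_lin mxE [X in X + _]mxE.
by apply: eq_bigr => k _; rewrite [curvature_mx _ _ _ _ _ _]mxE.
Qed.

(** For invertible P, the map [x |-> x *m P] is an isomorphism from the algebra of L' onto that of
    L. *)
Definition lie_iso P L L' : Prop :=
  forall x y, bracket L (x *m P) (y *m P) = bracket L' x y *m P.

Lemma lie_iso_inv P L L' : P \in unitmx -> lie_iso P L L' -> lie_iso (invmx P) L' L.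
Proof.
move=> uP h x y; have := h (x *m invmx P) (y *m invmx P).
by rewrite !mulmxKV // => ->; rewrite mulmxK.
Qed.

Lemma lie_iso_transport P L : P \in unitmx -> lie_iso P L (transport P L).
Proof.
move=> uP x y.
pose f : 'rV[R]_7 := \row_i iprod y (iprod x (pull P (tnth L i))) set0.
have -> : bracket L (x *m P) (y *m P) = - f.
  by apply/rowP => k; rewrite !mxE !iprod_pull pull_set0.
suff -> : bracket (transport P L) x y = - f *m invmx P by rewrite mulmxKV.
apply/rowP => j; rewrite !mxE transportE !iprod_sumr sum_ffunE -sumrN.
by apply: eq_bigr => i _; rewrite !iprodZr ffunE !mxE mulNr mulrC.
Qed.

Lemma mulmx_rV_inj n (A B : 'M[R]_(7, n)) : (forall x, x *m A = x *m B) -> A = B.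
Proof. by move=> h; apply/row_matrixP => i; rewrite !rowE h. Qed.

Lemma lie_iso_koszul P L L' G x y z : lie_iso P L L' ->
  koszul L G (x *m P) (y *m P) (z *m P) = koszul L' (P *m G *m P^T) x y z.
Proof. by move=> h; rewrite /koszul !h !metric_mulmx. Qed.

Lemma lie_iso_levi_civita P L L' G x y : P \in unitmx -> G \in unitmx ->
  lie_iso P L L' ->
  levi_civita L G (x *m P) (y *m P) = levi_civita L' (P *m G *m P^T) x y *m P.
Proof.
move=> uP uG h; set G' := P *m G *m P^T.
have uG' : G' \in unitmx by rewrite !unitmx_mul uP uG unitmx_tr.
have eqm z : metric G (levi_civita L G (x *m P) (y *m P)) (z *m P) =
    metric G (levi_civita L' G' x y *m P) (z *m P).
  by rewrite metric_mulmx !levi_civita_metric // (lie_iso_koszul _ _ _ _ h).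
have uGP : G *m P^T \in unitmx by rewrite unitmx_mul uG unitmx_tr.
apply: (can_inj (mulmxK uGP)); apply/rowP => k.
have mE u : metric G u (e k *m P) = (u *m (G *m P^T)) 0 k.
  by rewrite /metric trmx_mul !mulmxA trmx_delta -colE mxE.
by rewrite -!mE eqm.
Qed.

Lemma lie_iso_curvature P L L' G x y z : P \in unitmx -> G \in unitmx ->
  lie_iso P L L' ->
  curvature L G (x *m P) (y *m P) (z *m P) = curvature L' (P *m G *m P^T) x y z *m P.
Proof.
by move=> uP uG h; rewrite /curvature !(h, lie_iso_levi_civita _ _ uP uG h) !mulmxBl.
Qed.

(** Ricci is the trace of x |-> R(x, y) z, and the matrices of this map in the two algebras are
    conjugate by P. *)
Lemma lie_iso_ricci P L L' G y z : P \in unitmx -> G \in unitmx -> lie_iso P L L' ->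
  ricci L G (y *m P) (z *m P) = ricci L' (P *m G *m P^T) y z.
Proof.
move=> uP uG h.
have tr M u v : ricci L M u v = \tr (curvature_mx L M u v).
  by apply: eq_bigr => i _; rewrite [curvature_mx _ _ _ _ _ _]mxE.
have tr' M u v : ricci L' M u v = \tr (curvature_mx L' M u v).
  by apply: eq_bigr => i _; rewrite [curvature_mx _ _ _ _ _ _]mxE.
rewrite tr tr'; set C := curvature_mx _ _ _ _; set C' := curvature_mx _ _ _ _.
have PC : P *m C = C' *m P.
  by apply: mulmx_rV_inj => x; rewrite !mulmxA !curvature_mxE (lie_iso_curvature _ _ _ uP uG h).
by rewrite -[C](mulKmx uP) PC mxtrace_mulC mulmxK.
Qed.

Lemma ricci_bilinear L G y z : ricci L G y z =
  (y *m (\matrix_(i, j) ricci L G (e i) (e j)) *m z^T) 0 0.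
Proof.
have aux (a : R) (A A' B B' C C' : 'rV[R]_7) i :
    (a *: A + A' - (a *: B + B') - (a *: C + C')) 0 i =
    a * (A - B - C) 0 i + (A' - B' - C') 0 i.
  by rewrite !mxE; ring.
have lin2 (a : R) u u' w : ricci L G (a *: u + u') w = a * ricci L G u w + ricci L G u' w.
  rewrite /ricci mulr_sumr -big_split; apply: eq_bigr => i _ /=.
  rewrite /curvature bracket_linr !levi_civita_linl levi_civita_linr; exact: aux.
have lin3 (a : R) u u' w : ricci L G w (a *: u + u') = a * ricci L G w u + ricci L G w u'.
  rewrite /ricci mulr_sumr -big_split; apply: eq_bigr => i _ /=.
  rewrite /curvature !levi_civita_linr; exact: aux.
rewrite (linear_form_row (f := fun w => ricci L G w z)) //.
rewrite -mulmxA mxE; apply: eq_bigr => i _.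
rewrite (linear_form_row (f := fun w => ricci L G (e i) w)) // mxE; congr (_ * _).
by apply: eq_bigr => j _; rewrite !mxE mulrC.
Qed.

Lemma lie_iso_ricci_endo P L L' G : P \in unitmx -> G \in unitmx -> lie_iso P L L' ->
  ricci_endo L' (P *m G *m P^T) = P *m ricci_endo L G *m invmx P.
Proof.
move=> uP uG h; have uPt : P^T \in unitmx by rewrite unitmx_tr.
rewrite /ricci_endo -!/(basis_vec R _).
set Rc := \matrix_(i, j) ricci L G _ _; set Rc' := \matrix_(i, j) _.
have -> : Rc' = P *m Rc *m P^T.
  apply/matrixP => i j; rewrite mxE -(lie_iso_ricci _ _ uP uG h) -!rowE ricci_bilinear.
  rewrite -row_mul tr_row [LHS]mxE [RHS]mxE; apply: eq_bigr => k _.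
  by rewrite [row _ _ _ _]mxE [col _ _ _ _]mxE.
have uG' : P *m G *m P^T \in unitmx by rewrite !unitmx_mul uP uG.
apply: (can_inj (mulmxK uG')); rewrite mulmxKV // !mulmxA mulmxKV //.
by rewrite -[_ *m invmx G *m G]mulmxA mulVmx ?mulmx1.
Qed.

Lemma inner_product_unitmx G : inner_product G -> G \in unitmx.
Proof.
move=> [_ pos]; apply: contraT => nu.
have [x x0 xG] : exists2 x : 'rV[R]_7, x != 0 & x *m G = 0.
  have /rowV0Pn[x /sub_kermxP xG x0] : kermx G != 0.
    by rewrite kermx_eq0 row_free_unit.
  by exists x.
by have := pos x x0; rewrite /metric xG mul0mx mxE ltxx.
Qed.

Lemma inner_product_conj P G : P \in unitmx -> inner_product G ->
  inner_product (P *m G *m P^T).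
Proof.
move=> uP [tG pos]; split=> [|v v0]; first by rewrite !trmx_mul trmxK tG mulmxA.
rewrite -metric_mulmx; apply: pos; apply: contraNneq v0 => vP.
by rewrite -[v](mulmxK uP) vP mul0mx.
Qed.

Lemma lie_iso_nilsoliton P L L' G : P \in unitmx -> lie_iso P L L' ->
  nilsoliton L G -> nilsoliton L' (P *m G *m P^T).
Proof.
move=> uP h [iG [lam [D [dD rD]]]].
have uG := inner_product_unitmx iG.
split; first exact: inner_product_conj.
exists lam, (P *m D *m invmx P); split=> [x y|]; last first.
  rewrite (lie_iso_ricci_endo uP uG h) rD mulmxDr mulmxDl mul_mx_scalar -scalemxAl mulmxV //.
  by rewrite scalemx1.
have h' := lie_iso_inv uP h.
apply: (can_inj (mulmxK uP)); rewrite mulmxDl -!h !mulmxA !mulmxKV // -h.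
exact: dD.
Qed.

End NilsolitonTransport.

(** * Ricci curvature and derivations of a two-step algebra in an orthonormal frame *)

Section TwoStepRicci.

Variable R : realType.
Implicit Types (L : structure_eqs R).

Local Notation e := (@basis_vec R).
Local Notation h := (@lshift 4 3).
Local Notation z := (@rshift 4 3).

(* R^7 is split as r + n' with r = <e_1, ..., e_4> and n' = <e_5, e_6, e_7>. *)
Definition two_step_eqs L : Prop :=
  [/\ forall k, homog 2 (tnth L k), forall i, tnth L (h i) = 0 &
      forall x k, iprod (e (z x)) (tnth L k) = 0].

Definition wcoef L (k : 'I_3) (i j : 'I_4) : R := coef2 (tnth L (z k)) (h i) (h j).

Lemma sum_split7 (F : 'I_7 -> R) :
  \sum_i F i = \sum_(i < 4) F (h i) + \sum_(k < 3) F (z k).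
Proof. exact: (@big_split_ord _ _ _ 4 3). Qed.

Lemma split7P (P : 'I_7 -> Prop) :
  (forall i, P (h i)) -> (forall k, P (z k)) -> forall i, P i.
Proof.
move=> Ph Pz i; rewrite -[i](@splitK 4 3); case: split => j /=; [exact: Ph|exact: Pz].
Qed.

Lemma two_step_unimodular L : two_step_eqs L -> unimodular_eqs L.
Proof.
by move=> [_ hL zL]; apply: split7P => i; rewrite ?hL ?iprod0r ?zL.
Qed.

Definition christoffel L i j k : R := levi_civita L 1%:M (e i) (e j) 0 k.
Definition struct_const L i j k : R := bracket L (e i) (e j) 0 k.

Local Notation ch := (christoffel).
Local Notation sc := (struct_const).

Lemma struct_constE L i j k : sc L i j k = - coef2 (tnth L k) i j.
Proof. by rewrite /sc mxE. Qed.

Lemma christoffelE L i j k : 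
  ch L i j k = 2^-1 * (sc L i j k - sc L j k i + sc L k i j).
Proof.
have m1 v l : metric 1%:M v (e l) = v 0 l.
  by rewrite /metric mulmx1 trmx_delta -colE mxE.
by rewrite /ch -m1 levi_civita_metric ?unitmx1 // /koszul !m1.
Qed.

Lemma ricci_christoffel L a b : ricci L 1%:M (e a) (e b) = \sum_i \sum_m
  (ch L a b m * ch L i m i - ch L i b m * ch L a m i - sc L i a m * ch L m b i).
Proof.
apply: eq_bigr => i _; rewrite /curvature -/(e i).
have linr x v l : levi_civita L 1%:M x v 0 l = \sum_m v 0 m * levi_civita L 1%:M x (e m) 0 l.
  rewrite (@linear_form_row _ (fun v => levi_civita L 1%:M x v 0 l)) // => r u u'.
  by rewrite levi_civita_linr mxE [X in X + _]mxE.
have linl y v l : levi_civita L 1%:M v y 0 l = \sum_m v 0 m * levi_civita L 1%:M (e m) y 0 l.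
  rewrite (@linear_form_row _ (fun v => levi_civita L 1%:M v y 0 l)) // => r u u'.
  by rewrite levi_civita_linl mxE [X in X + _]mxE.
have aux (A B C : 'rV[R]_7) : (A - B - C) 0 i = A 0 i - B 0 i - C 0 i by rewrite !mxE.
by rewrite aux (linr (e i)) (linr (e a)) (linl (e b)) !sumrB.
Qed.

Section TwoStep.

Variable L : structure_eqs R.
Hypothesis tL : two_step_eqs L.

Local Notation W := (wcoef L).

Lemma scL : (forall i j k, sc L i j (h k) = 0) * (forall i j k, sc L (z i) j k = 0) *
   (forall i j k, sc L i (z j) k = 0).
Proof.
case: tL => [_ hL zL]; split; [split|] => i j k; rewrite struct_constE.
- by rewrite hL /coef2 !iprod0r ffunE oppr0.
- by rewrite /coef2 zL iprod0r ffunE oppr0.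
- by rewrite coef2C /coef2 zL iprod0r ffunE !oppr0.
Qed.

Lemma sc_hhz i j k : sc L (h i) (h j) (z k) = - W k i j.
Proof. by rewrite struct_constE. Qed.

Lemma chL : ((forall i j k, ch L (h i) (h j) (z k) = - (2^-1 * W k i j)) *
  (forall i j k, ch L (h i) (z k) (h j) = 2^-1 * W k i j) *
  (forall i j k, ch L (z k) (h i) (h j) = 2^-1 * W k i j)) *
 ((forall i j k, ch L (h i) (h j) (h k) = 0) *
  (forall i j k, ch L (h i) (z j) (z k) = 0) *
  (forall i j k, ch L (z i) (h j) (z k) = 0) *
  (forall i j k, ch L (z i) (z j) k = 0)).
Proof.
have skew k i j : W k i j = - W k j i by rewrite /wcoef coef2C.
by do !split; move=> i j k; rewrite christoffelE ?scL ?sc_hhz ?[W k j i]skew; ring.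
Qed.

Lemma wcoef_skew k i j : W k i j = - W k j i.
Proof. by rewrite /wcoef coef2C. Qed.

Lemma wcoef_diag k i : W k i i = 0.
Proof. by have := wcoef_skew k i i; lra. Qed.

Lemma sum_split7_mixed (t : 'I_7 -> 'I_7 -> R) :
  (forall i m, t (h i) (h m) = 0) -> (forall i m, t (z i) (z m) = 0) ->
  \sum_i \sum_m t i m = \sum_i \sum_k (t (h i) (z k) + t (z k) (h i)).
Proof.
move=> hh zz; rewrite sum_split7.
rewrite (eq_bigr (fun i => \sum_k t (h i) (z k))) => [|i _]; last first.
  by rewrite sum_split7 big1 ?add0r.
rewrite [X in _ + X](eq_bigr (fun k => \sum_i t (z k) (h i))) => [|k _]; last first.
  by rewrite sum_split7 [X in _ + X]big1 ?addr0.
rewrite [X in _ + X]exchange_big -big_split; apply: eq_bigr => i _ /=.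
by rewrite -big_split.
Qed.

(** The only nonzero Christoffel symbols have two indices in r and one in n', and are halves of
    structure coefficients up to sign. This leaves a nonpositive Ricci block on r, a nonnegative one
    on n' and no mixed terms. *)
Lemma ricci_hh a b : ricci L 1%:M (e (h a)) (e (h b)) =
  - (2^-1 * \sum_i \sum_k W k a i * W k b i).
Proof.
rewrite ricci_christoffel sum_split7_mixed => [||i m]; last 2 first.
- by move=> i m; rewrite !(chL, scL); ring.
- by rewrite !(chL, scL); ring.
rewrite mulr_sumr -sumrN; apply: eq_bigr => i _.
rewrite mulr_sumr -sumrN; apply: eq_bigr => k _.
by rewrite !(chL, scL, sc_hhz) wcoef_diag (wcoef_skew k i b) (wcoef_skew k i a); field.
Qed.

Lemma ricci_zz a b : ricci L 1%:M (e (z a)) (e (z b)) =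
  4^-1 * \sum_i \sum_j W a i j * W b i j.
Proof.
rewrite ricci_christoffel sum_split7.
rewrite [X in _ + X]big1 ?addr0 => [|i _]; last first.
  by rewrite big1 // => m _; rewrite !(chL, scL); ring.
rewrite mulr_sumr; apply: eq_bigr => i _.
rewrite sum_split7 [X in _ + X]big1 ?addr0 => [|m _]; last first.
  by rewrite !(chL, scL); ring.
rewrite mulr_sumr; apply: eq_bigr => j _.
by rewrite !(chL, scL, sc_hhz) (wcoef_skew a j i); field.
Qed.

Lemma ricci_hz a b : ricci L 1%:M (e (h a)) (e (z b)) = 0.
Proof.
rewrite ricci_christoffel big1 // => i _; rewrite big1 // => m _.
by move: i m; do 2!apply: split7P => ?; rewrite !(chL, scL); ring.
Qed.

Lemma ricci_zh a b : ricci L 1%:M (e (z a)) (e (h b)) = 0.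
Proof.
rewrite ricci_christoffel big1 // => i _; rewrite big1 // => m _.
by move: i m; do 2!apply: split7P => ?; rewrite !(chL, scL); ring.
Qed.

(** The n'-components, on pairs from r, of the condition that Rc - lambda is a derivation, with c =
    - lambda. *)
Definition soliton_eq (c : R) : Prop := forall k i j,
  2^-1 * (\sum_a (\sum_b \sum_l W l i b * W l a b) * W k a j +
         \sum_a (\sum_b \sum_l W l j b * W l a b) * W k i a) +
  4^-1 * (\sum_l (\sum_a \sum_b W k a b * W l a b) * W l i j) = c * W k i j.

Lemma ricci_endo1 i j : ricci_endo L 1%:M i j = ricci L 1%:M (e i) (e j).
Proof. by rewrite /ricci_endo invmx1 mulmx1 mxE. Qed.

Lemma bracket_basis D i j k : bracket L (e i *m D) (e j) 0 k = \sum_a D i a * sc L a j k.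
Proof.
rewrite (@linear_form_row _ (fun x => bracket L x (e j) 0 k)) => [|a u v]; last first.
  by rewrite bracket_linl mxE [X in X + _]mxE.
by apply: eq_bigr => a _; rewrite -rowE mxE.
Qed.

Lemma bracket_basisr D i j k : bracket L (e i) (e j *m D) 0 k = \sum_a D j a * sc L i a k.
Proof.
rewrite (@linear_form_row _ (fun x => bracket L (e i) x 0 k)) => [|a u v]; last first.
  by rewrite bracket_linr mxE [X in X + _]mxE.
by apply: eq_bigr => a _; rewrite -rowE mxE.
Qed.

Lemma derivationP D : derivation L D <-> forall i j k,
  \sum_a sc L i j a * D a k = \sum_a D i a * sc L a j k + \sum_a D j a * sc L i a k.
Proof.
have lhs i j k : (bracket L (e i) (e j) *m D) 0 k = \sum_a sc L i j a * D a k.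
  by rewrite mxE.
split=> [dD i j k|dD x y].
  by rewrite -lhs dD mxE bracket_basis bracket_basisr.
apply/rowP => k.
pose f x y := (bracket L x y *m D - (bracket L (x *m D) y + bracket L x (y *m D))) 0 k.
have aux (r : R) (A A' B B' C C' : 'rV[R]_7) :
    (r *: A + A' - (r *: B + B' + (r *: C + C'))) 0 k =
    r * (A - (B + C)) 0 k + (A' - (B' + C')) 0 k by rewrite !mxE; ring.
have f1 (r : R) u u' v : f (r *: u + u') v = r * f u v + f u' v.
  by rewrite /f !mulmxDl -scalemxAl !bracket_linl mulmxDl -scalemxAl aux.
have f2 (r : R) u u' v : f v (r *: u + u') = r * f v u + f v u'.
  by rewrite /f !mulmxDl -scalemxAl !bracket_linr mulmxDl -scalemxAl aux.
suff : f x y = 0 by rewrite /f mxE [X in _ + X]mxE => /eqP; rewrite subr_eq0 => /eqP.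
rewrite (@linear_form_row _ (f^~ y)) // big1 // => i _.
rewrite (@linear_form_row _ (f (e i))) // big1 ?mulr0 // => j _.
rewrite /f mxE [X in _ + X]mxE [X in _ - X]mxE lhs dD bracket_basis bracket_basisr.
by rewrite subrr mulr0.
Qed.

(** Brackets take values in the central n' and the Ricci tensor is block diagonal, so every
    component of the derivation identity other than those in [soliton_eq] is trivial. *)
Lemma soliton_derivation lam :
  derivation L (ricci_endo L 1%:M - lam%:M) <-> soliton_eq (- lam).
Proof.
set D := _ - _.
have h_inj i j : (h i == h j) = (i == j) by [].
have z_inj i j : (z i == z j) = (i == j) by rewrite -!val_eqE /= eqn_add2l.
have hz i j : (h i == z j) = false.
  by apply/negP => /eqP/(congr1 val) /= hij; have := ltn_ord i; rewrite hij ltnNge leq_addr.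
have DE i j : D i j = ricci L 1%:M (e i) (e j) - lam * (i == j)%:R.
  rewrite /D; move: (ricci_endo L 1%:M) ricci_endo1 => M ME.
  by rewrite !mxE ME mulr_natr.
have Dhz i j : D (h i) (z j) = 0 by rewrite DE ricci_hz hz mulr0 subr0.
have Dzh i j : D (z i) (h j) = 0 by rewrite DE ricci_zh eq_sym hz mulr0 subr0.
have split0 (F : 'I_7 -> R) : (forall i, F (h i) = 0) -> (forall i, F (z i) = 0) ->
    \sum_i F i = 0.
  by move=> h0 z0; rewrite sum_split7 !big1 // addr0.
have delta_sum n (F : 'I_n -> R) i : \sum_a (i == a)%:R * F a = F i.
  rewrite (bigD1 i) //= eqxx mul1r big1 ?addr0 // => a /negPf.
  by rewrite eq_sym => ->; rewrite mul0r.
have lhs k i j : \sum_a sc L (h i) (h j) a * D a (z k) =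
    - (4^-1 * \sum_l (\sum_a \sum_b W k a b * W l a b) * W l i j) + lam * W k i j.
  rewrite sum_split7 big1 ?add0r => [|a _]; last by rewrite Dhz mulr0.
  rewrite (eq_bigr (fun l => - (4^-1 * (\sum_a \sum_b W k a b * W l a b) * W l i j)
      + lam * ((k == l)%:R * W l i j))) => [|l _].
    rewrite big_split /= sumrN -[X in _ + X]mulr_sumr delta_sum mulr_sumr.
    by congr (- _ + _); apply: eq_bigr => l _; rewrite mulrA.
  rewrite DE ricci_zz z_inj sc_hhz [k == l]eq_sym.
  rewrite [X in 4^-1 * X](eq_bigr (fun a => \sum_b W k a b * W l a b)) => [|a _].
    by ring.
  by apply: eq_bigr => b _; rewrite mulrC.
have rhs (F : 'I_4 -> R) i : \sum_a D (h i) (h a) * F a =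
    - (2^-1 * \sum_a (\sum_b \sum_l W l i b * W l a b) * F a) - lam * F i.
  rewrite (eq_bigr (fun a => - (2^-1 * (\sum_b \sum_l W l i b * W l a b) * F a)
      - lam * ((i == a)%:R * F a))) => [|a _].
    rewrite big_split /= !sumrN -[X in _ - X]mulr_sumr delta_sum mulr_sumr.
    by congr (- _ - _); apply: eq_bigr => a _; rewrite mulrA.
  by rewrite DE ricci_hh h_inj; ring.
have rhs1 k i j : \sum_a D (h i) a * sc L a (h j) (z k) =
    - \sum_a D (h i) (h a) * W k a j.
  rewrite sum_split7 [X in _ + X]big1 ?addr0 => [|a _]; last by rewrite Dhz mul0r.
  by rewrite -sumrN; apply: eq_bigr => a _; rewrite sc_hhz mulrN.
have rhs2 k i j : \sum_a D (h j) a * sc L (h i) a (z k) =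
    - \sum_a D (h j) (h a) * W k i a.
  rewrite sum_split7 [X in _ + X]big1 ?addr0 => [|a _]; last by rewrite Dhz mul0r.
  by rewrite -sumrN; apply: eq_bigr => a _; rewrite sc_hhz mulrN.
rewrite derivationP; split=> [dD k i j|se].
  by have := dD (h i) (h j) (z k); rewrite lhs rhs1 rhs2 !rhs => ?; lra.
move=> i j k; move: k i j; apply: split7P => k i j.
  rewrite !split0 ?addr0 // => a; rewrite ?scL ?mulr0 ?mul0r //.
  by rewrite Dzh mulr0.
move: i j; apply: split7P => i; apply: split7P => j.
- by rewrite lhs rhs1 rhs2 !rhs; have := se k i j => ?; lra.
- by rewrite !split0 ?addr0 // => a; rewrite ?(scL, Dzh) ?mulr0 ?mul0r.
- by rewrite !split0 ?addr0 // => a; rewrite ?(scL, Dzh) ?mulr0 ?mul0r.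
- by rewrite !split0 ?addr0 // => a; rewrite ?(scL, Dzh) ?mulr0 ?mul0r.
Qed.

Lemma nilsoliton_soliton_eq : nilsoliton L 1%:M <-> exists c, soliton_eq c.
Proof.
have i1 : inner_product (1%:M : 'M[R]_7).
  split=> [|v v0]; first by rewrite trmx1.
  rewrite /metric mulmx1 mxE lt_neqAle sumr_ge0 ?andbT => [|i _]; last first.
    by rewrite mxE -expr2 sqr_ge0.
  apply: contraNneq v0 => /esym s0; apply/eqP/rowP => i; rewrite [RHS]mxE.
  have := s0; under eq_bigr => k _ do rewrite mxE -expr2.
  move=> /eqP; rewrite psumr_eq0 => [/allP/(_ i (mem_index_enum i))|k _]; last exact: sqr_ge0.
  by rewrite sqrf_eq0 => /eqP.
split=> [[_ [lam [D [dD rD]]]]|[c se]].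
  exists (- lam); apply/soliton_derivation.
  by rewrite rD addrC addKr.
split=> //; exists (- c), (ricci_endo L 1%:M - (- c)%:M); split.
  by apply/soliton_derivation; rewrite opprK.
by rewrite addrC subrK.
Qed.

End TwoStep.

End TwoStepRicci.

(** * Skew forms on R^4 *)

Section SkewForms.

Variable R : realFieldType.

Definition alt2 (v : nat -> nat -> R) (i j : nat) : R :=
  if (i < j)%N then v i j else if (j < i)%N then - v j i else 0.

(** In this lexicographic order the complement of pair p is pair 5 - p. *)
Definition pair4 (p : nat) : nat * nat :=
  nth (0, 0)%N [:: (0, 1); (0, 2); (0, 3); (1, 2); (1, 3); (2, 3)]%N p.

Definition upper (v : nat -> nat -> R) (p : nat) : R := v (pair4 p).1 (pair4 p).2.

(** The sign of the product of pair p with its complement: with indices from 0, only f^{02} ∧ f^{13}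
    is negative. *)
Definition star_sign (p : nat) : R := if p \in [:: 1; 4]%N then -1 else 1.

(** Turns the matrix products of the soliton equation into inner products and wedge pairings of
    2-forms. In matrix form: V V^T U + U V V^T = |v|^2 U + <u, v> V - (u ∧ v) ⋆V. *)
Lemma skew4_identity (v u : nat -> nat -> R) (p : nat) (i := (pair4 p).1) (j := (pair4 p).2) :
  (p < 6)%N ->
  \sum_(a < 4) \sum_(b < 4) alt2 v i b * alt2 v a b * alt2 u a j +
  \sum_(a < 4) \sum_(b < 4) alt2 v j b * alt2 v a b * alt2 u i a =
  (\sum_(q < 6) upper v q ^+ 2) * upper u p + (\sum_(q < 6) upper u q * upper v q) * upper v p
  - (\sum_(q < 6) star_sign q * upper u q * upper v (5 - q)) * (star_sign p * upper v (5 - p)).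
Proof.
rewrite {}/i {}/j; by case: p => [|[|[|[|[|[|//]]]]]] _;
  rewrite !big_ord_recl !big_ord0 /alt2 /upper /star_sign /=; ring.
Qed.

(** The matrix E of the overview, which is also the Hodge operator on 2-forms of R^4. *)
Definition star6 : 'M[R]_6 := \matrix_(p, q) ((p + q == 5)%N%:R * star_sign p).

Definition raw (W : 'I_3 -> 'I_4 -> 'I_4 -> R) k (i j : nat) : R := W k (inord i) (inord j).

Definition wmx (W : 'I_3 -> 'I_4 -> 'I_4 -> R) : 'M[R]_(3, 6) :=
  \matrix_(k, p) upper (raw W k) p.

Lemma alt2_raw (W : 'I_3 -> 'I_4 -> 'I_4 -> R) k (i j : 'I_4) :
  (forall k i j, W k i j = - W k j i) -> alt2 (raw W k) i j = W k i j.
Proof.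
move=> skew; rewrite /alt2 /raw !inord_val; case: ltngtP => [//|_|/val_inj ->].
  by rewrite -skew.
by have := skew k j j; lra.
Qed.

Lemma mul_star6 n (A : 'M[R]_(n, 6)) k p :
  (A *m star6) k p = star_sign p * A k (rev_ord p).
Proof.
rewrite mxE (bigD1 (rev_ord p)) //= big1 ?addr0 => [|q /negPf qp].
  rewrite mxE /= (_ : (_ == 5)%N) ?mul1r; last by have := ltn_ord p; lia.
  rewrite mulrC; congr (_ * _); rewrite /star_sign !inE.
  have p6 := ltn_ord p.
  have -> : (6 - p.+1 == 1)%N = (nat_of_ord p == 4)%N by apply/eqP/eqP; lia.
  have -> : (6 - p.+1 == 4)%N = (nat_of_ord p == 1)%N by apply/eqP/eqP; lia.
  by rewrite orbC.
rewrite mxE; case: eqP => [e5|_]; last by rewrite mul0r mulr0.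
have : q == rev_ord p by rewrite -val_eqE /=; have := ltn_ord p; lia.
by rewrite qp.
Qed.

Lemma pair4_lt p : (p < 6)%N -> ((pair4 p).1 < 4)%N && ((pair4 p).2 < 4)%N.
Proof. by case: p => [|[|[|[|[|[|]]]]]]. Qed.

Lemma sum_upper (W : 'I_3 -> 'I_4 -> 'I_4 -> R) (skew : forall k i j, W k i j = - W k j i) k l :
  \sum_a \sum_b W k a b * W l a b = 2 * \sum_(q < 6) upper (raw W k) q * upper (raw W l) q.
Proof.
transitivity (\sum_(a < 4) \sum_(b < 4) alt2 (raw W k) a b * alt2 (raw W l) a b).
  by apply: eq_bigr => a _; apply: eq_bigr => b _; rewrite !alt2_raw.
by rewrite !big_ord_recl !big_ord0 /alt2 /upper /=; ring.
Qed.

Lemma wmx_pairing (W : 'I_3 -> 'I_4 -> 'I_4 -> R) k l :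
  (wmx W *m star6 *m (wmx W)^T) k l =
  \sum_(q < 6) star_sign q * upper (raw W k) q * upper (raw W l) (5 - q)%N.
Proof.
rewrite mxE (reindex_inj rev_ord_inj); apply: eq_bigr => q _.
rewrite mul_star6 !mxE rev_ordK /=.
have q6 := ltn_ord q.
have -> : (6 - q.+1 = 5 - q)%N by lia.
rewrite /star_sign !inE.
have -> : (5 - q == 1)%N = (nat_of_ord q == 4)%N by apply/eqP/eqP; lia.
have -> : (5 - q == 4)%N = (nat_of_ord q == 1)%N by apply/eqP/eqP; lia.
by rewrite orbC.
Qed.

(** Summed over l, [skew4_identity] gives tr(N) w + N w - Z w E for the first parenthesis. The
    second contributes 2 N w, each pair of indices being counted twice. Hence mu = 2 c - tr N. *)
Lemma soliton_matrix_eq (W : 'I_3 -> 'I_4 -> 'I_4 -> R) (c : R)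
    (w := wmx W) (N := w *m w^T) (Z := w *m star6 *m w^T) :
  (forall k i j, W k i j = - W k j i) ->
  (forall k i j,
    2^-1 * (\sum_a (\sum_b \sum_l W l i b * W l a b) * W k a j +
           \sum_a (\sum_b \sum_l W l j b * W l a b) * W k i a) +
    4^-1 * (\sum_l (\sum_a \sum_b W k a b * W l a b) * W l i j) = c * W k i j) <->
  2 *: (N *m w) - Z *m w *m star6 = (2 * c - \tr N) *: w.
Proof.
move=> skew.
have NE k l : N k l = \sum_(q < 6) upper (raw W k) q * upper (raw W l) q.
  by rewrite mxE; apply: eq_bigr => q _; rewrite !mxE.
have ZE := wmx_pairing W.
pose T k (i j : 'I_4) := \sum_a (\sum_b \sum_l W l i b * W l a b) * W k a j +
           \sum_a (\sum_b \sum_l W l j b * W l a b) * W k i a.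
have TE k (p : 'I_6) : T k (inord (pair4 p).1) (inord (pair4 p).2) =
    (\tr N *: w + N *m w - Z *m w *m star6) k p.
  have /andP[p1 p2] := pair4_lt (ltn_ord p).
  transitivity (\sum_l (
    \sum_(a < 4) \sum_(b < 4) alt2 (raw W l) (pair4 p).1 b * alt2 (raw W l) a b * alt2 (raw W k) a (pair4 p).2 +
    \sum_(a < 4) \sum_(b < 4) alt2 (raw W l) (pair4 p).2 b * alt2 (raw W l) a b * alt2 (raw W k) (pair4 p).1 a)).
    rewrite big_split; congr (_ + _); rewrite /= exchange_big; apply: eq_bigr => a _;
      rewrite exchange_big mulr_suml; apply: eq_bigr => b _; rewrite mulr_suml;
      apply: eq_bigr => l _; rewrite -!alt2_raw ?inordK //.
  rewrite (eq_bigr _ (fun l _ => skew4_identity (raw W l) (raw W k) (ltn_ord p))).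
  rewrite big_split sumrN big_split /= -!mulr_suml.
  rewrite [in RHS]mxE [X in _ = X + _]mxE [X in _ = X + _ + _]mxE [X in _ = _ + X]mxE.
  rewrite mul_star6; congr (_ * _ + _ - _).
  - by apply: eq_bigr => l _; rewrite NE; apply: eq_bigr => q _; rewrite expr2.
  - by rewrite mxE.
  - by rewrite mxE; apply: eq_bigr => l _; rewrite NE mxE.
  rewrite mxE mulr_sumr; apply: eq_bigr => l _; rewrite ZE mxE /= subSS.
  by rewrite mulrCA.
pose F k i j := 2^-1 * T k i j +
  4^-1 * (\sum_l (\sum_a \sum_b W k a b * W l a b) * W l i j) - c * W k i j.
have FE k (p : 'I_6) : F k (inord (pair4 p).1) (inord (pair4 p).2) =
    2^-1 * (2 *: (N *m w) - Z *m w *m star6 - (2 * c - \tr N) *: w) k p.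
  rewrite /F TE.
  have -> : \sum_l (\sum_a \sum_b W k a b * W l a b) *
      W l (inord (pair4 p).1) (inord (pair4 p).2) = 2 * (N *m w) k p.
    rewrite [in RHS]mxE mulr_sumr; apply: eq_bigr => l _.
    by rewrite sum_upper // -NE [w l p]mxE mulrA.
  have -> : W k (inord (pair4 p).1) (inord (pair4 p).2) = w k p by rewrite mxE.
  have aux (A B C : 'M[R]_(3, 6)) (t : R) :
      2^-1 * (t *: C + A - B) k p + 4^-1 * (2 * A k p) - c * C k p =
      2^-1 * (2 *: A - B - (2 * c - t) *: C) k p by rewrite !mxE; field.
  exact: aux.
have Fskew k i j : F k i j = - F k j i.
  rewrite /F /T (skew k i j) [\sum_l _ * W l i j](eq_bigr (fun l =>
    - ((\sum_a \sum_b W k a b * W l a b) * W l j i))); last first.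
    by move=> l _; rewrite skew mulrN.
  rewrite sumrN [\sum_a _ * W k a j](eq_bigr (fun a =>
    - ((\sum_b \sum_l W l i b * W l a b) * W k j a))); last first.
    by move=> a _; rewrite skew mulrN.
  rewrite [\sum_a _ * W k i a](eq_bigr (fun a =>
    - ((\sum_b \sum_l W l j b * W l a b) * W k a i))); last first.
    by move=> a _; rewrite skew mulrN.
  by rewrite !sumrN; ring.
split=> [se|me k i j].
  apply/matrixP => k p; apply/eqP; rewrite -subr_eq0; apply/eqP.
  have := FE k p; rewrite /F /T se subrr => /esym/eqP.
  by rewrite mulf_eq0 invr_eq0 pnatr_eq0 /= [X in X == 0]mxE [X in _ + X]mxE => /eqP.
suff F0 : F k i j = 0 by apply/eqP; rewrite -subr_eq0; apply/eqP.
have Fp (p : 'I_6) : F k (inord (pair4 p).1) (inord (pair4 p).2) = 0.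
  by rewrite FE me subrr mxE mulr0.
have Fdiag x : F k x x = 0 by have := Fskew k x x; lra.
have iE (x : 'I_4) : exists2 n, (n < 4)%N & x = inord n.
  by exists x => //; rewrite inord_val.
have o p (p6 : (p < 6)%N) := Fp (Ordinal p6).
have := (o 0%N isT, o 1%N isT, o 2%N isT, o 3%N isT, o 4%N isT, o 5%N isT).
rewrite /pair4 /= => hp.
have [i' i4 ->] := iE i; have [j' j4 ->] := iE j.
case: i' i4 => [|[|[|[|//]]]] _; case: j' j4 => [|[|[|[|//]]]] _; rewrite ?Fdiag ?hp //;
  by rewrite Fskew hp oppr0.
Qed.

End SkewForms.

(** * The square of the torsion matrix *)

Section TorsionSquare.

Variable R : realType.

Local Notation e := (@basis_vec R).
Local Notation h := (@lshift 4 3).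
Local Notation z := (@rshift 4 3).

(** d phi ∧ phi is the sum of the df^i ∧ (e_i _| phi) ∧ phi, each of which is kappa times a diagonal
    entry of the torsion matrix. *)
Lemma torsion_trace (L : structure_eqs R) (phi : ext_alg R) (kappa : R) :
  (forall k, homog 2 (tnth L k)) ->
  (forall i a, homog 2 a ->
     top3 a (iprod (e i) phi) phi = kappa * dot a (iprod (e i) phi)) ->
  wedge (ext_d L phi) phi [set: 'I_7] = kappa * \tr (torsion_mx L phi).
Proof.
move=> hL hk; rewrite ext_dE wedge_suml sum_ffunE mulr_sumr; apply: eq_bigr => i _.
by rewrite mxE -hk.
Qed.

Variables (L : structure_eqs R) (phi : ext_alg R) (s : R).
Hypothesis tL : two_step_eqs L.
Hypothesis s0 : 0 < s.
Hypothesis contraction : forall i j k l,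
  \sum_m (coef3 phi i k m * coef3 phi j l m + coef3 phi j k m * coef3 phi i l m) =
     s * (2 * (i == j)%:R * (k == l)%:R - (i == k)%:R * (j == l)%:R
        - (i == l)%:R * (j == k)%:R).
Hypothesis torsion_symm : forall i k, torsion_mx L phi k i = torsion_mx L phi i k.

Let W := wcoef L.
Let w := wmx W.
Let t i j k := coef3 phi i j k.
(** The inner product of the cross products e_i × e_j and e_a × e_b. *)
Let tau i j a b := \sum_m t i j m * t a b m.

Lemma tauN1 i j a b : tau i j a b = - tau j i a b.
Proof. by rewrite /tau -sumrN; apply: eq_bigr => m _; rewrite /t coef3C12 mulNr. Qed.

Lemma tauN2 i j a b : tau i j a b = - tau i j b a.
Proof. by rewrite /tau -sumrN; apply: eq_bigr => m _; rewrite /t [coef3 phi a b m]coef3C12 mulrN. Qed.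

Lemma tauC i j a b : tau i j a b = tau a b i j.
Proof. by apply: eq_bigr => m _; rewrite mulrC. Qed.

Lemma tau_contraction i j k l : tau i k j l + tau j k i l =
  s * (2 * (i == j)%:R * (k == l)%:R - (i == k)%:R * (j == l)%:R
        - (i == l)%:R * (j == k)%:R).
Proof. by rewrite -contraction big_split. Qed.

Lemma tau_same i j : i != j -> tau i j i j = s.
Proof.
move=> /negPf nij; have := tau_contraction i i j j; rewrite !eqxx nij /= => ?; lra.
Qed.

Lemma tau_share i j k : j != k -> i != j -> tau i j i k = 0.
Proof.
move=> /negPf njk /negPf nij; have := tau_contraction i i j k.
by rewrite !eqxx nij njk /= => ?; lra.
Qed.

Lemma tau_swap i j k l : i != j -> k != l -> i != k -> j != k -> 
  tau i k j l = - tau j k i l.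
Proof.
move=> /negPf ij /negPf kl /negPf ik /negPf jk.
by have := tau_contraction i j k l; rewrite ij kl ik jk /= => ?; lra.
Qed.

Definition horiz (n : nat) : 'I_7 := h (inord n).

Lemma horiz_eq m n : (m < 4)%N -> (n < 4)%N -> (horiz m == horiz n) = (m == n).
Proof. by move=> m4 n4; rewrite -val_eqE /= !inordK. Qed.

Let tt : 'M[R]_(6, 7) :=
  \matrix_(p, m) t (horiz (pair4 p).1) (horiz (pair4 p).2) m.

Lemma torsion_zE k m : torsion_mx L phi (z k) m = (w *m tt) k m.
Proof.
have [hL0 Lh Lz] := tL.
have skew := @wcoef_skew R L.
(* [dot2E] sums over ordered pairs, hence the factor 2. *)
apply: (@mulfI _ 2); first by rewrite pnatr_eq0.
rewrite mxE dot2E // sum_split7 [X in _ + X]big1 ?addr0 => [|i _]; last first.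
  by rewrite big1 // => j _; rewrite /coef2 Lz iprod0r ffunE mul0r.
rewrite (eq_bigr (fun i => \sum_j W k i j * t m (h i) (h j))) => [|i _]; last first.
  rewrite sum_split7 [X in _ + X]big1 ?addr0 // => j _.
  by rewrite coef2C /coef2 Lz iprod0r ffunE oppr0 mul0r.
rewrite mxE.
pose u (i j : nat) := t m (h (inord i)) (h (inord j)).
rewrite (eq_bigr (fun i : 'I_4 => \sum_(j < 4) alt2 (raw W k) i j * u i j)); last first.
  by move=> i _; apply: eq_bigr => j _; rewrite /u !inord_val alt2_raw.
have uskew i j : u i j = - u j i by rewrite /u /t coef3C23.
rewrite (eq_bigr (fun p : 'I_6 => upper (raw W k) p * u (pair4 p).1 (pair4 p).2)); last first.
  move=> p _; rewrite !mxE /= /u /t; congr (_ * _).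
  by rewrite coef3C23 coef3C12 opprK.
rewrite !big_ord_recl !big_ord0 /alt2 /upper /=.
rewrite (uskew 1 0)%N (uskew 2 0)%N (uskew 3 0)%N (uskew 2 1)%N (uskew 3 1)%N (uskew 3 2)%N.
ring.
Qed.

Lemma torsion_zh k i : torsion_mx L phi (z k) (h i) = 0.
Proof.
have [hL0 Lh Lz] := tL.
by rewrite torsion_symm mxE Lh /dot big1 // => S _; rewrite ffunE mul0r.
Qed.

Let q := tau (horiz 0) (horiz 1) (horiz 2) (horiz 3).

(** The rows of [tt] are the cross products of pairs from r. By the contraction identity [tau] is s
    on equal pairs, 0 on pairs sharing one index, and alternating in four distinct indices;
    complementary pairs therefore carry q with the signs of the wedge pairing. *)
Lemma tt_gram : tt *m tt^T = s%:M + q *: star6 R.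
Proof.
have pE (p r : 'I_6) : (tt *m tt^T) p r =
    tau (horiz (pair4 p).1) (horiz (pair4 p).2) (horiz (pair4 r).1) (horiz (pair4 r).2).
  by rewrite mxE; apply: eq_bigr => m _; rewrite !mxE.
have q1 : tau (horiz 0) (horiz 2) (horiz 1) (horiz 3) = - q.
  have := @tau_swap (horiz 1) (horiz 2) (horiz 0) (horiz 3); rewrite !horiz_eq //.
  move=> /(_ isT isT isT isT).
  by rewrite (tauN1 (horiz 1) (horiz 0)) (tauN1 (horiz 2) (horiz 0)) -/q => ?; lra.
have q2 : tau (horiz 0) (horiz 3) (horiz 1) (horiz 2) = q.
  have := @tau_swap (horiz 1) (horiz 3) (horiz 0) (horiz 2); rewrite !horiz_eq //.
  move=> /(_ isT isT isT isT).
  rewrite (tauN1 (horiz 1) (horiz 0)) (tauN2 (horiz 0) (horiz 1)) (tauN1 (horiz 3) (horiz 0)).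
  by rewrite -/q => ?; lra.
apply/matrixP => p r; rewrite pE [RHS]mxE [s%:M _ _]mxE [X in _ + X]mxE [star6 _ _ _]mxE.
case: p r => [p p6] [r r6]; rewrite -val_eqE /=.
case: p p6 => [|[|[|[|[|[|//]]]]]] p6; case: r r6 => [|[|[|[|[|[|//]]]]]] r6;
  rewrite /pair4 /star_sign /= ?mulr1n ?mulr0n ?mul0r ?mul1r ?mulr0 ?mulr1 ?addr0 ?add0r ?mulrN1;
  try by first [ rewrite tau_same ?horiz_eq //
    | rewrite tau_share ?horiz_eq // | rewrite tauN1 tau_share ?horiz_eq ?oppr0 //
    | rewrite tauN2 tau_share ?horiz_eq ?oppr0 //
    | rewrite tauN1 tauN2 tau_share ?horiz_eq ?oppr0 // | rewrite tauC ?q1 ?q2 //].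
all: try by rewrite ?q1 ?q2.
all: by rewrite tauC ?q1 ?q2.
Qed.

Let N := w *m w^T.
Let Z := w *m star6 R *m w^T.

Lemma torsion_square_mx (M := \matrix_(k, l) torsion_mx L phi (z k) (z l)) :
  M^T = M /\ M *m M = s *: N + q *: Z.
Proof.
have tM : M^T = M.
  apply/matrixP => k l; rewrite [LHS]mxE /M [LHS]mxE [RHS]mxE; exact: torsion_symm.
split=> //; rewrite -{2}tM.
have -> : M *m M^T = w *m tt *m (w *m tt)^T.
  apply/matrixP => k l; rewrite [LHS]mxE [RHS]mxE sum_split7 [X in _ = X + _]big1 ?add0r => [|i _].
    apply: eq_bigr => x _.
    by rewrite -torsion_zE [_^T _ _]mxE [_^T _ _]mxE -torsion_zE [M k x]mxE [M l x]mxE.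
  by rewrite -torsion_zE torsion_zh mul0r.
rewrite trmx_mul mulmxA -[w *m tt *m tt^T]mulmxA tt_gram mulmxDr mulmxDl.
by rewrite mul_mx_scalar -scalemxAl -scalemxAr -scalemxAl.
Qed.

(** The restriction of phi to r is dual to a vector xi of R^4, and [torsion_zh] says that every
    ⋆df^k kills xi. For skew 4 x 4 matrices A ⋆A is a scalar, namely the Pfaffian up to sign; the
    polarised product for df^k and df^l is Z_kl up to a factor, so one nonzero Z_kl forces xi =
    0. *)
Lemma coef3_horizontal0 : Z != 0 -> forall i j k : 'I_4, t (h i) (h j) (h k) = 0.
Proof.
move=> Z0.
have [k [l Zkl]] : exists k l, Z k l != 0.
  case/boolP: [forall k, forall l, Z k l == 0] => [/forallP Zz|].
    case/eqP: Z0; apply/matrixP => k l; rewrite [RHS]mxE.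
    by apply/eqP; have /forallP := Zz k; apply.
  by case/forallPn => k /forallPn[l Zkl]; exists k, l.
pose x a b c := t (horiz a) (horiz b) (horiz c).
have x12 a b c : x a b c = - x b a c by rewrite /x /t coef3C12.
have x23 a b c : x a b c = - x a c b by rewrite /x /t coef3C23.
have x0 a b : x a a b = 0 by have := x12 a a b; lra.
have x1 a b : x a b b = 0 by have := x23 a b b; lra.
have eqs k' i : \sum_(p < 6) w k' p * x (pair4 p).1 (pair4 p).2 i = 0 \/ (4 <= i)%N.
  case: (ltnP i 4) => i4; last by right.
  left; rewrite -[RHS](torsion_zh k' (inord i)) torsion_zE [RHS]mxE.
  by apply: eq_bigr => p _; rewrite [tt _ _]mxE.
pose ww k' p : R := upper (raw W k') p.
have wwE k' (p : 'I_6) : w k' p = ww k' p by rewrite mxE.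
have eqs' k' i : (i < 4)%N -> \sum_(p < 6) ww k' p * x (pair4 p).1 (pair4 p).2 i = 0.
  move=> i4; case: (eqs k' i) => [e0|]; last by rewrite leqNgt i4.
  by rewrite -[RHS]e0; apply: eq_bigr => p _; rewrite wwE.
have xs : (x 1 2 0 = x 0 1 2) * (x 1 3 0 = x 0 1 3) * (x 2 3 0 = x 0 2 3) *
   (x 0 2 1 = - x 0 1 2) * (x 0 3 1 = - x 0 1 3) * (x 2 3 1 = x 1 2 3) *
   (x 0 3 2 = - x 0 2 3) * (x 1 3 2 = - x 1 2 3).
  have x13 a b c : x a b c = x c a b by rewrite x23 x12 opprK.
  by do !split; rewrite // x13.
have x0' a b : x a b a = 0 by rewrite x23 x0 oppr0.
have T k' : [/\ ww k' 3 * x 0 1 2 + ww k' 4 * x 0 1 3 + ww k' 5 * x 0 2 3 = 0,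
   ww k' 1 * x 0 1 2 + ww k' 2 * x 0 1 3 - ww k' 5 * x 1 2 3 = 0,
   ww k' 0 * x 0 1 2 - ww k' 2 * x 0 2 3 - ww k' 4 * x 1 2 3 = 0 &
   ww k' 0 * x 0 1 3 + ww k' 1 * x 0 2 3 + ww k' 3 * x 1 2 3 = 0].
  have := (eqs' k' 0%N isT, eqs' k' 1%N isT, eqs' k' 2%N isT, eqs' k' 3%N isT).
  rewrite !big_ord_recl !big_ord0 /pair4 /= !(x0, x1, x0', xs) => -[[[e0 e1] e2] e3].
  by split; lra.
have ZE : Z k l = ww k 0 * ww l 5 + ww k 5 * ww l 0 - ww k 1 * ww l 4 -
    ww k 4 * ww l 1 + ww k 2 * ww l 3 + ww k 3 * ww l 2.
  by rewrite [LHS]wmx_pairing !big_ord_recl big_ord0 /star_sign /= -!/(ww _ _) /=; ring.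
have [t0 t1 t2 t3] := T k; have [u0 u1 u2 u3] := T l.
have Zx y r : Z k l * y = r -> r = 0 -> y = 0.
  by move=> <- /eqP; rewrite mulf_eq0 (negPf Zkl) => /eqP.
pose T0 k' := ww k' 3 * x 0 1 2 + ww k' 4 * x 0 1 3 + ww k' 5 * x 0 2 3.
pose T1 k' := ww k' 1 * x 0 1 2 + ww k' 2 * x 0 1 3 - ww k' 5 * x 1 2 3.
pose T2 k' := ww k' 0 * x 0 1 2 - ww k' 2 * x 0 2 3 - ww k' 4 * x 1 2 3.
pose T3 k' := ww k' 0 * x 0 1 3 + ww k' 1 * x 0 2 3 + ww k' 3 * x 1 2 3.
have T0E k' : T0 k' = 0 by case: (T k').
have T1E k' : T1 k' = 0 by case: (T k').
have T2E k' : T2 k' = 0 by case: (T k').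
have T3E k' : T3 k' = 0 by case: (T k').
(* Here and below the multipliers form the polarised Pfaffian adjoint: coefficients of df^l on the
   equations of df^k, and conversely. *)
have x012 : x 0 1 2 = 0.
  apply: (Zx _ (ww l 2 * T0 k - ww l 4 * T1 k + ww l 5 * T2 k +
    (ww k 2 * T0 l - ww k 4 * T1 l + ww k 5 * T2 l))); last by rewrite !(T0E, T1E, T2E); ring.
  by rewrite ZE /T0 /T1 /T2; ring.
have x013 : x 0 1 3 = 0.
  apply: (Zx _ (ww l 3 * T1 k - ww l 1 * T0 k + ww l 5 * T3 k +
    (ww k 3 * T1 l - ww k 1 * T0 l + ww k 5 * T3 l))); last by rewrite !(T0E, T1E, T3E); ring.
  by rewrite ZE /T0 /T1 /T3; ring.
have x023 : x 0 2 3 = 0.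
  apply: (Zx _ (ww l 0 * T0 k - ww l 3 * T2 k - ww l 4 * T3 k +
    (ww k 0 * T0 l - ww k 3 * T2 l - ww k 4 * T3 l))); last by rewrite !(T0E, T2E, T3E); ring.
  by rewrite ZE /T0 /T2 /T3; ring.
have x123 : x 1 2 3 = 0.
  apply: (Zx _ (ww l 1 * T2 k - ww l 0 * T1 k + ww l 2 * T3 k +
    (ww k 1 * T2 l - ww k 0 * T1 l + ww k 2 * T3 l))); last by rewrite !(T1E, T2E, T3E); ring.
  by rewrite ZE /T1 /T2 /T3; ring.
have sorted0 a b c : (a < b)%N -> (b < c)%N -> (c < 4)%N -> x a b c = 0.
  case: c => [|[|[|[|//]]]] //; case: b => [|[|[|//]]] //; case: a => [|[|//]] //.
have asc a b c : (a < b)%N -> (a < 4)%N -> (b < 4)%N -> (c < 4)%N -> x a b c = 0.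
  move=> ab a4 b4 c4; case: (ltngtP b c) => [bc|cb|<-]; [exact: sorted0| |exact: x1].
  rewrite x23; case: (ltngtP a c) => [ac|ca|<-]; [|rewrite x12|]; rewrite ?x0 ?oppr0 //.
    by rewrite sorted0 ?oppr0.
  by rewrite sorted0 ?oppr0.
move=> i j k'; rewrite -[i]inord_val -[j]inord_val -[k']inord_val.
rewrite -[t _ _ _]/(x i j k').
case: (ltngtP i j) => [ij|ji|<-]; [exact: asc| |exact: x0].
by rewrite x12 asc ?oppr0.
Qed.

(** As phi vanishes on r, cross products of vectors of r lie in n'. There the e_0 × e_a, a = 1, 2,
    3, are orthogonal of squared length s. The product e_2 × e_3 is orthogonal to the last two and
    has the same length, so its inner product q with e_0 × e_1 is s or -s. *)
Lemma q_square : Z != 0 -> q ^+ 2 = s ^+ 2.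
Proof.
move=> /coef3_horizontal0 t0.
have tauz i j a b : tau (horiz i) (horiz j) (horiz a) (horiz b) =
    \sum_(m < 3) t (horiz i) (horiz j) (z m) * t (horiz a) (horiz b) (z m).
  rewrite /tau sum_split7 big1 ?add0r // => m _.
  by rewrite t0 mul0r.
pose O : 'M[R]_3 := \matrix_(a, m) t (horiz 0) (horiz a.+1) (z m).
pose b : 'cV[R]_3 := \col_m t (horiz 2) (horiz 3) (z m).
have OO : O *m O^T = s%:M.
  apply/matrixP => i j; rewrite mxE [RHS]mxE.
  transitivity (tau (horiz 0) (horiz i.+1) (horiz 0) (horiz j.+1)).
    by rewrite tauz; apply: eq_bigr => m _; rewrite !mxE.
  have i4 : (i.+1 < 4)%N by rewrite ltnS.
  have j4 : (j.+1 < 4)%N by rewrite ltnS.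
  have [ij|nij] := eqVneq i j; first by rewrite ij tau_same ?horiz_eq // mulr1n.
  by rewrite mulr0n tau_share ?horiz_eq // eqSS val_eqE.
have Ob : O *m b = \col_i (q *+ (i == 0)).
  apply/matrixP => i l; rewrite mxE [RHS]mxE.
  transitivity (tau (horiz 0) (horiz i.+1) (horiz 2) (horiz 3)).
    by rewrite tauz; apply: eq_bigr => m _; rewrite !mxE.
  rewrite -val_eqE; case: i => [[|[|[|//]]] i3] /=.
  - by rewrite mulr1n.
  - by rewrite mulr0n tauN1 tau_share ?horiz_eq ?oppr0.
  - by rewrite mulr0n tauN1 tauN2 tau_share ?horiz_eq ?oppr0.
have bb : b^T *m b = s%:M.
  apply/matrixP => i j; rewrite !ord1 mxE [RHS]mxE mulr1n.
  rewrite -(@tau_same (horiz 2) (horiz 3)) ?horiz_eq // tauz.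
  by apply: eq_bigr => m _; rewrite !mxE.
have OO' : O^T *m O = s%:M.
  have sn0 : s != 0 by rewrite gt_eqF.
  have /mulmx1C : (s^-1 *: O) *m O^T = 1%:M.
    by rewrite -scalemxAl OO scale_scalar_mx mulVf.
  by rewrite -scalemxAr => /(congr1 ( *:%R s)); rewrite scalerA divff // scale1r scale_scalar_mx mulr1.
have : (O *m b)^T *m (O *m b) = (s ^+ 2)%:M.
  rewrite trmx_mul -mulmxA [O^T *m (O *m b)]mulmxA OO' mul_scalar_mx -scalemxAr bb.
  by rewrite scale_scalar_mx expr2.
rewrite Ob => /matrixP/(_ 0 0); rewrite mxE [RHS]mxE mulr1n => <-.
rewrite sum_ord3 !mxE /= !mulr0n !mulr1n; ring.
Qed.

End TorsionSquare.

(** * Adapted frames *)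

Section Cholesky.

Variable R : realType.

(** Upper triangular, unlike the usual factor: the last rows then involve only the last basis
    vectors, so an orthonormal frame of R^7 ends with a basis of n'. The induction accordingly
    splits off the first coordinate. *)
Lemma cholesky n (G : 'M[R]_n) : G^T = G ->
  (forall v : 'rV_n, v != 0 -> 0 < (v *m G *m v^T) 0 0) ->
  exists P Q : 'M_n, [/\ P *m Q = 1%:M, P *m G *m P^T = 1%:M &
    forall i j : 'I_n, (j < i)%N -> P i j = 0 /\ Q i j = 0].
Proof.
elim: n G => [|n IH] G tG pos.
  by exists 0, 0; split=> [||[]//]; apply/matrixP => -[].
change 'M[R]_(1 + n) in G.
have {}pos : forall v : 'rV_(1 + n), v != 0 -> 0 < (v *m G *m v^T) 0 0 := pos.
pose a := ulsubmx G; pose b := ursubmx G; pose D := drsubmx G.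
have GE : G = block_mx a b b^T D.
  by rewrite -[LHS]submxK trmx_ursub tG.
have tD : D^T = D by rewrite trmx_drsub tG.
have [P' [Q' [PQ PDP tri]]] : exists P Q : 'M_n, [/\ P *m Q = 1%:M, P *m D *m P^T = 1%:M &
    forall i j : 'I_n, (j < i)%N -> P i j = 0 /\ Q i j = 0].
  apply: IH => // v v0.
  have := pos (row_mx 0 v); rewrite GE mul_row_block !mul0mx !add0r tr_row_mx mul_row_col.
  rewrite trmx0 mulmx0 add0r; apply.
  apply: contraNneq v0 => e0; have := e0; rewrite -[RHS]row_mx0.
  by move=> /eq_row_mx[_ ->].
have QP := mulmx1C PQ.
(* The product of P'^T and P' is the inverse of D, so (1, y) is orthogonal to the last n
   coordinates; its squared length sigma is the Schur complement. *)
pose y : 'M_(1, n) := - (b *m P'^T *m P').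
have DP : D *m P'^T *m P' = 1%:M.
  have : P' *m (D *m P'^T) = 1%:M by rewrite mulmxA.
  by move/mulmx1C.
have yD : y *m D = - b.
  have PPD : P'^T *m P' *m D = 1%:M.
    by have := congr1 trmx DP; rewrite !trmx_mul trmxK tD trmx1 !mulmxA.
  by rewrite /y mulNmx -[b *m _ *m _]mulmxA -mulmxA PPD mulmx1.
pose sigma := (a + y *m b^T) 0 0.
have yG : row_mx 1%:M y *m G = row_mx sigma%:M 0.
  by rewrite GE mul_row_block !mul1mx yD subrr -mx11_scalar.
have sig0 : 0 < sigma.
  have := pos (row_mx 1%:M y); rewrite yG tr_row_mx mul_row_col mul0mx addr0 trmx1 mulmx1.
  rewrite mxE mulr1n; apply; apply/eqP => e0; have := e0.
  rewrite -[RHS]row_mx0 => /eq_row_mx[/matrixP/(_ 0 0)].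
  by rewrite !mxE => /eqP; rewrite oner_eq0.
pose x := (Num.sqrt sigma)^-1.
have x0 : x != 0 by rewrite invr_eq0 gt_eqF // sqrtr_gt0.
have xx : x * x * sigma = 1.
  by rewrite -invfM -expr2 sqr_sqrtr ?ltW // mulVf // gt_eqF.
change (exists P Q : 'M[R]_(1 + n), [/\ P *m Q = 1%:M, P *m G *m P^T = 1%:M &
    forall i j : 'I_(1 + n), (j < i)%N -> P i j = 0 /\ Q i j = 0]).
exists (block_mx x%:M (x *: y) 0 P'), (block_mx x^-1%:M (- (y *m Q')) 0 Q'); split.
- rewrite mulmx_block !mul0mx !mulmx0 !add0r !addr0 PQ -scalar_mxM divff //.
  by rewrite mul_scalar_mx scalerN -scalemxAl addNr -scalar_mx_block.
- have -> : block_mx x%:M (x *: y) 0 P' = col_mx (x *: row_mx 1%:M y) (row_mx 0 P').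
    by rewrite scale_row_mx scalemx1.
  rewrite mul_col_mx -scalemxAl yG GE mul_row_block !mul0mx !add0r.
  rewrite tr_col_mx mul_col_row linearZ /= !tr_row_mx trmx0 trmx1.
  rewrite -!scalemxAr -!scalemxAl !mul_row_col !mul0mx !mulmx0 !mulmx1 !addr0 !add0r PDP.
  rewrite scaler0 !scalerA -[P' *m D *m _]mulmxA.
  have -> : D *m y^T = - b^T by rewrite -{1}tD -trmx_mul yD linearN.
  by rewrite mulmxN subrr scaler0 scale_scalar_mx xx -scalar_mx_block.
move=> i j; case: (split_ordP i) => i' ->; case: (split_ordP j) => j' -> /=.
- by rewrite !ord1.
- by rewrite ord1.
- by rewrite !block_mxEdl !mxE.
by rewrite !block_mxEdr ltn_add2l => /tri.
Qed.

End Cholesky.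

(** * Metric, coclosedness and G2 condition in an orthonormal frame *)

Section Frames.

Variable R : realType.
Implicit Types (L : structure_eqs R) (phi a b vol : ext_alg R) (G P : 'M[R]_7).

Local Notation e := (@basis_vec R).
Local Notation h := (@lshift 4 3).
Local Notation z := (@rshift 4 3).

Lemma pull_scale (r : R) G a k : homog k a -> pull (r *: G) a = r ^+ k *: pull G a.
Proof.
move=> ha; apply/ffunP => S; rewrite !ffunE scaler_sumr; apply: eq_bigr => T /eqP cT.
have [->|/ha kT] := eqVneq (a T) 0; first by rewrite !mul0r scaler0.
rewrite /GRing.scale /= mulrCA; congr (_ * _); rewrite -cT kT /minor -detZ.
by congr (\det _); apply/matrixP => i j; rewrite !mxE.
Qed.

Lemma form_inner_scale (r : R) G a b k : G \in unitmx -> r != 0 -> homog k b ->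
  form_inner (r *: G) a b = r^-1 ^+ k * form_inner G a b.
Proof.
move=> uG r0 hb; have u : r *: G \in unitmx by rewrite unitmxZ ?unitfE.
rewrite !form_innerE invmxZ //.
rewrite (pull_scale _ _ hb) /dot mulr_sumr; apply: eq_bigr => S _.
by rewrite ffunE /GRing.scale /= mulrCA.
Qed.

Lemma form_inner1 a b : form_inner 1%:M a b = dot a b.
Proof. by rewrite form_innerE invmx1 pull1. Qed.

Lemma volume_form_setT G vol : volume_form G vol -> vol [set: 'I_7] != 0.
Proof.
move=> [hv nv]; apply/eqP => v0; have v00 := homog7_eq0 hv v0.
move: nv; rewrite form_innerE v00 /dot big1 => [/eqP|S _]; last by rewrite ffunE mul0r.
by rewrite eq_sym oner_eq0.
Qed.

Lemma metric_basis G i j : metric G (e i) (e j) = G i j.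
Proof. by rewrite /metric -rowE trmx_delta -colE !mxE. Qed.

(** [purely_coclosed] and [induces] each bring their own metric and volume. Both are read off the
    same 7-forms, so the metrics are proportional, and coclosedness passes from one to the other. *)
Lemma G2_metric_unique phi G vol G' vol' :
  G2_metric_volume phi G vol -> G2_metric_volume phi G' vol' ->
  exists2 r : R, r != 0 & G' = r *: G.
Proof.
move=> [iG vG bG] [iG' vG' bG']; have v0 := volume_form_setT vG.
have v0' := volume_form_setT vG'.
exists (vol [set: 'I_7] / vol' [set: 'I_7]).
  by rewrite mulf_neq0 ?invr_eq0.
apply/matrixP => i j; rewrite mxE -!metric_basis.
have := bG (e i) (e j); rewrite -bG' => /ffunP/(_ [set: 'I_7]); rewrite !ffunE.
rewrite /GRing.scale /= => E; apply: (mulIf v0'); rewrite -E; field.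
exact: v0'.
Qed.

Lemma coclosed_frame P L phi G : P \in unitmx -> G \in unitmx ->
  (forall k, homog 2 (tnth L k)) ->
  P *m G *m P^T = 1%:M ->
  (forall a, homog 2 a -> form_inner G (ext_d L a) phi = 0) <->
  (forall i k, torsion_mx (transport P L) (pull P phi) k i =
     torsion_mx (transport P L) (pull P phi) i k).
Proof.
move=> uP uG hL PGP.
have hL' k : homog 2 (tnth (transport P L) k).
  by rewrite transportE; apply: homog_sum => i; apply/homogZ/pull_homog.
rewrite -torsion_sym //; have key a : dot (ext_d (transport P L) (pull P a)) (pull P phi) =
    form_inner G (ext_d L a) phi.
  by rewrite -(form_inner_pull _ _ uP uG) PGP form_inner1 pull_ext_d.
split=> [d0 a ha|d0 a ha]; last by rewrite -key; apply/d0/pull_homog.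
by rewrite -(pullVK a uP) key; apply/d0/pull_homog.
Qed.

Lemma G2_frame_of_metric P phi G vol : P \in unitmx -> homog 3 phi ->
  P *m G *m P^T = 1%:M -> G2_metric_volume phi G vol ->
  G2_frame (pull P phi) (\det P * vol [set: 'I_7]).
Proof.
move=> uP h3 PGP [iG vG bG]; have v0 := volume_form_setT vG; split.
- exact: pull_homog.
- by rewrite mulf_neq0 // -unitfE -unitmxE.
move=> k l; rewrite !iprod_pull top3_pull.
have /ffunP/(_ [set: 'I_7]) := bG (e k *m P) (e l *m P); rewrite metric_mulmx PGP.
rewrite metric_basis [X in X = _ -> _]ffunE [X in _ = X -> _]ffunE.
rewrite /GRing.scale /= -/(top3 _ _ _) [1%:M k l]mxE.
move: (top3 _ _ _) (vol _) => x y E.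
have -> : x = 6 * ((k == l)%:R * y).
  apply: (@mulfI R 6^-1); first by rewrite invr_eq0 pnatr_eq0.
  by rewrite [RHS]mulrA mulVf ?pnatr_eq0 // mul1r; exact: esym E.
have aux (d n r : R) : d * (6 * (n * r)) = 6 * (d * r) * n by ring.
exact: aux.
Qed.

End Frames.

(** * The action of a frame of R^4 on 2-forms *)

Section Compound.

Variable R : realFieldType.

(** The second compound matrix, transposed because coordinates of 2-forms are row vectors acted on
    from the right. *)
Definition compound (A : nat -> nat -> R) (p q : nat) : R :=
  A (pair4 q).1 (pair4 p).1 * A (pair4 q).2 (pair4 p).2
  - A (pair4 q).1 (pair4 p).2 * A (pair4 q).2 (pair4 p).1.

Definition compound_mx (A : nat -> nat -> R) : 'M[R]_6 := \matrix_(p, q) compound A p q.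

(** The wedge pairing takes values in 4-forms, on which A acts by its determinant; for a triangular
    A this is the product of the diagonal. *)
Lemma compound_star (A : nat -> nat -> R) :
  (forall i j, (j < i)%N -> (i < 4)%N -> A i j = 0) ->
  compound_mx A *m star6 R *m (compound_mx A)^T =
    (A 0%N 0%N * A 1%N 1%N * A 2 2 * A 3 3) *: star6 R.
Proof.
move=> triA.
have key p r : (p < 6)%N -> (r < 6)%N ->
    \sum_(q < 6) star_sign R q * compound A p (5 - q) * compound A r q =
    (A 0%N 0%N * A 1%N 1%N * A 2 2 * A 3 3) * ((p + r == 5)%N%:R * star_sign R p).
  move=> p6 r6; rewrite !big_ord_recl big_ord0 /=.
  case: p p6 => [|[|[|[|[|[|//]]]]]] _; case: r r6 => [|[|[|[|[|[|//]]]]]] _;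
    rewrite /compound /star_sign /= ?(triA 1 0)%N ?(triA 2 0)%N ?(triA 2 1)%N
     ?(triA 3 0)%N ?(triA 3 1)%N ?(triA 3 2)%N //; ring.
apply/matrixP => p r; rewrite mxE [RHS]mxE [star6 _ _ _]mxE -key //.
by apply: eq_bigr => q _; rewrite mul_star6 !mxE /=; congr (_ * _ * _).
Qed.

Lemma compound_pairing (A : nat -> nat -> R) (v : nat -> nat -> R) (q : nat) :
  (q < 6)%N -> \sum_(a < 4) \sum_(b < 4) A (pair4 q).1 a * alt2 v a b * A (pair4 q).2 b =
  \sum_(p < 6) upper v p * compound A p q.
Proof.
move=> q6; rewrite !big_ord_recl !big_ord0 /alt2 /upper /compound /=.
case: q q6 => [|[|[|[|[|[|//]]]]]] _ /=; ring.
Qed.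

End Compound.

(** * Nonexistence *)

Section Nonexistence.

Variable R : realType.
Implicit Types (L : structure_eqs R) (phi a b vol : ext_alg R) (G P Q : 'M[R]_7).

Local Notation e := (@basis_vec R).
Local Notation h := (@lshift 4 3).
Local Notation z := (@rshift 4 3).

Definition upper_triangular n (A : 'M[R]_n) : Prop := forall i j : 'I_n, (j < i)%N -> A i j = 0.

Lemma hz_ltn (i : 'I_4) (k : 'I_3) : (h i < z k)%N.
Proof. by rewrite /= (leq_trans (ltn_ord i)) // leq_addr. Qed.

Lemma two_step_transport P L : P \in unitmx ->
  (forall k i, P (z k) (h i) = 0) -> (forall k i, invmx P (z k) (h i) = 0) ->
  two_step_eqs L -> two_step_eqs (transport P L).
Proof.
move=> uP tP tQ [hL Lh Lz]; split=> [k|i|x k]; rewrite transportE.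
- by apply: homog_sum => i; apply/homogZ/pull_homog.
- rewrite big1 //; apply: split7P => j; first by rewrite Lh pull0 scaler0.
  by rewrite tQ scale0r.
rewrite iprod_sumr big1 // => j _; rewrite iprodZr iprod_pull_basis.
suff -> : iprod (row (z x) P) (tnth L j) = 0 by rewrite pull0 scaler0.
rewrite iprod_sum_basis big1 // => i _; move: i; apply: split7P => i.
  by rewrite mxE tP scale0r.
by rewrite Lz scaler0.
Qed.

Lemma coef2_sum (c : 'I_7 -> R) (F : 'I_7 -> ext_alg R) i j :
  coef2 (\sum_l c l *: F l) i j = \sum_l c l * coef2 (F l) i j.
Proof.
rewrite /coef2 !iprod_sumr sum_ffunE; apply: eq_bigr => l _.
by rewrite !iprodZr ffunE.
Qed.

Lemma wcoef_transport P L k i j : two_step_eqs L ->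
  wcoef (transport P L) k i j = \sum_l invmx P (z l) (z k) *
    \sum_a \sum_b P (h i) (h a) * wcoef L l a b * P (h j) (h b).
Proof.
move=> [hL Lh Lz]; rewrite /wcoef transportE coef2_sum sum_split7.
rewrite big1 ?add0r => [|l _]; last by rewrite Lh pull0 /coef2 !iprod0r ffunE mulr0.
apply: eq_bigr => l _; congr (_ * _).
have := coef2_pull P (tnth L (z l)) => /matrixP/(_ (h i) (h j)); rewrite mxE => ->.
rewrite mxE exchange_big sum_split7 /=.
rewrite [X in _ + X]big1 ?addr0 => [|b _]; last first.
  rewrite mxE big1 ?mul0r // => a _; rewrite [X in _ * X]mxE coef2C.
  by rewrite /coef2 Lz iprod0r ffunE oppr0 mulr0.
apply: eq_bigr => b _; rewrite mxE sum_split7 [X in _ + X]big1 ?addr0 => [|a _]; last first.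
  by rewrite [X in _ * X]mxE /coef2 Lz iprod0r ffunE mulr0.
by rewrite mulr_suml; apply: eq_bigr => a _; rewrite !mxE.
Qed.

Definition horizontal_block P (i j : nat) : R := P (horiz i) (horiz j).

Lemma wmx_transport P L : two_step_eqs L ->
  wmx (wcoef (transport P L)) =
    (\matrix_(l, k) invmx P (z l) (z k))^T *m wmx (wcoef L) *m
    compound_mx (horizontal_block P).
Proof.
move=> tL; have skew := @wcoef_skew R L.
rewrite -mulmxA; apply/matrixP => k p; rewrite mxE [RHS]mxE /upper /raw wcoef_transport //.
apply: eq_bigr => l _; rewrite !mxE; congr (_ * _).
transitivity (\sum_(a < 4) \sum_(b < 4) horizontal_block P (pair4 p).1 a *
   alt2 (raw (wcoef L) l) a b * horizontal_block P (pair4 p).2 b).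
  apply: eq_bigr => a _; apply: eq_bigr => b _.
  by rewrite alt2_raw // /horizontal_block /horiz !inord_val.
rewrite compound_pairing //; apply: eq_bigr => q _; by rewrite !mxE.
Qed.

Lemma rV_dot_eq0 n (x : 'rV[R]_n) : x *m x^T = 0 -> x = 0.
Proof.
move=> /matrixP/(_ 0 0); rewrite !mxE => x0.
have : \sum_i x 0 i ^+ 2 = 0.
  by rewrite -[RHS]x0; apply: eq_bigr => i _; rewrite [x^T _ _]mxE expr2.
move=> /psumr_eq0P h; apply/rowP => i; rewrite [RHS]mxE.
by apply/eqP; rewrite -sqrf_eq0; apply/eqP/h => // j _; apply: sqr_ge0.
Qed.

Lemma gram_unitmx m n (w : 'M[R]_(m, n)) :
  (forall x : 'rV_m, x *m w = 0 -> x = 0) -> w *m w^T \in unitmx.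
Proof.
move=> free; apply: contraT => nu.
have /rowV0Pn[x /sub_kermxP xw x0] : kermx (w *m w^T) != 0.
  by rewrite kermx_eq0 row_free_unit.
case/eqP: x0; apply/free/rV_dot_eq0.
by rewrite trmx_mul mulmxA -[x *m w *m _]mulmxA xw mul0mx.
Qed.

Lemma upper_triangular_diag n (A B : 'M[R]_n) i :
  upper_triangular A -> upper_triangular B -> A *m B = 1%:M -> A i i != 0.
Proof.
move=> tA tB /matrixP/(_ i i); rewrite mxE [RHS]mxE eqxx (bigD1 i) //= big1 ?addr0 => [|j nji].
  by apply: contra_eq_neq => ->; rewrite mul0r eq_sym oner_eq0.
case: (ltngtP j i) => [ji|ij|/val_inj ji]; last by rewrite ji eqxx in nji.
  by rewrite tA // mul0r.
by rewrite tB // mulr0.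
Qed.

Lemma star6_sym : (star6 R)^T = star6 R.
Proof.
apply/matrixP => p q; rewrite !mxE; case: p q => [p p6] [q q6] /=.
by case: p p6 => [|[|[|[|[|[|//]]]]]] _; case: q q6 => [|[|[|[|[|[|//]]]]]] _;
  rewrite /= ?mul0r.
Qed.

Lemma star6K : star6 R *m star6 R = 1%:M.
Proof.
apply/matrixP => p q; rewrite mul_star6 !mxE /= -val_eqE /=.
case: p q => [p p6] [q q6] /=.
case: p p6 => [|[|[|[|[|[|//]]]]]] _; case: q q6 => [|[|[|[|[|[|//]]]]]] _;
  rewrite /star_sign /= ?mul0r ?mul1r ?mulr1 ?mulr0 ?mulN1r ?opprK ?oppr0 //.
Qed.

Lemma minors3Z (d : R) (A : 'M[R]_3) : minors3 (d *: A) = d ^+ 2 * minors3 A.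
Proof.
by rewrite /minors3 -scalemxAl -scalemxAr !linearZ /=; field.
Qed.

Lemma no_purely_coclosed L (r : 'M[R]_(6, 3)) (w0 := wmx (wcoef L))
    (Z0 := w0 *m star6 R *m w0^T) :
  two_step_eqs L -> w0 *m r = 1%:M ->
  (Z0 != 0 -> \det Z0 = 0 /\ forall c : 'M_3, upper_triangular c -> \det c != 0 ->
     minors3 (c^T *m Z0 *m c) != 0) ->
  forall G, nilsoliton L G ->
  ~ exists phi : ext_alg R, purely_coclosed L phi /\ induces phi G.
Proof.
move=> tL w0r hZ0 G nG [phi [[[h3 _] [G' [vol' [m' d']]] dphi] [vol mv]]].
have iG : inner_product G by case: nG.
have [P [Q [PQ PGP tri]]] := cholesky iG.1 iG.2.
have [uP uQ] := mulmx1_unit PQ.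
have QE : Q = invmx P by rewrite -[RHS]mulmx1 -PQ mulKmx.
have tP : upper_triangular P by move=> i j /tri[].
have tQ : upper_triangular (invmx P) by rewrite -QE => i j /tri[].
have uG := inner_product_unitmx iG.
pose L' := transport P L; pose phi' := pull P phi.
have tL' : two_step_eqs L'.
  by apply: two_step_transport => // k i; [apply: tP|apply: tQ]; apply: hz_ltn.
have [c se] : exists c, soliton_eq L' c.
  apply/nilsoliton_soliton_eq => //; rewrite -PGP.
  exact: lie_iso_nilsoliton uP (lie_iso_transport L uP) nG.
have [hL _ _] := tL; have [hL' _ _] := tL'.
have symm i k : torsion_mx L' phi' k i = torsion_mx L' phi' i k.
  apply/(coclosed_frame _ uP uG hL PGP).1 => a ha.
  (* Coclosedness is known for G' = t G; rescaling multiplies the inner product of 3-forms by a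
     nonzero factor. *)
  have [t t0 GE] := G2_metric_unique mv m'.
  have [iG' vG' _] := m'.
  move: d'; rewrite coclosed_dual //; last 3 first.
  - exact: two_step_unimodular.
  - by case: vG'.
  - exact: volume_form_setT vG'.
  move=> /(_ a ha); rewrite GE (form_inner_scale _ uG t0 h3) => /eqP.
  by rewrite mulf_eq0 expf_eq0 invr_eq0 (negPf t0) => /eqP.
have fr := G2_frame_of_metric uP h3 PGP mv.
have [s s0 [contr star]] := G2_frame_contraction fr.
have trT : \tr (torsion_mx L' phi') = 0.
  have := torsion_trace hL' star; rewrite -pull_ext_d // -pull_wedge dphi pull0 ffunE.
  move=> /esym/eqP; rewrite mulf_eq0 => /orP[|/eqP //].
  have [_ c0 _] := fr; move: c0; rewrite mulf_eq0 negb_or => /andP[/negPf p0 /negPf v0].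
  rewrite !mulf_eq0 p0 v0 invr_eq0 (gt_eqF s0) !orbF => /eqP ?; lra.
pose w := wmx (wcoef L'); pose N := w *m w^T; pose Z := w *m star6 R *m w^T.
pose M : 'M[R]_3 := \matrix_(k, l) torsion_mx L' phi' (z k) (z l).
have [tM MM] := torsion_square_mx tL' contr symm; rewrite -/M -/w -/N -/Z in tM MM.
have qs := q_square tL' s0 contr symm; rewrite -/w -/Z in qs.
have trM : \tr M = 0.
  rewrite -trT /mxtrace sum_split7 [X in _ = X + _]big1 ?add0r => [|i _].
    by apply: eq_bigr => k _; rewrite mxE.
  have [_ Lh' _] := tL'; rewrite mxE Lh' /dot big1 // => S _; by rewrite ffunE mul0r.
have := (soliton_matrix_eq c (@wcoef_skew R L')).1 se; rewrite -/w -/N -/Z.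
set mu := 2 * c - _ => me.
have e1 : 2 *: (N *m N) - Z *m Z = mu *: N.
  have := congr1 (fun A => A *m w^T) me; rewrite /= mulmxBl -!scalemxAl.
  by rewrite -(mulmxA N) -(mulmxA Z) -(mulmxA Z).
have e2 : 2 *: (N *m Z) - Z *m N = mu *: Z.
  have := congr1 (fun A => A *m star6 R *m w^T) me; rewrite /= !mulmxBl -!scalemxAl.
  rewrite -[Z *m w *m _ *m _]mulmxA star6K mulmx1.
  by rewrite -!(mulmxA N) -!(mulmxA Z) -/N !mulmxA.
pose cm : 'M[R]_3 := \matrix_(l, k) invmx P (z l) (z k).
pose C2 := compound_mx (horizontal_block P).
have wE : w = cm^T *m w0 *m C2 by apply: wmx_transport.
have tri_hb i j : (j < i)%N -> (i < 4)%N -> horizontal_block P i j = 0.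
  by move=> ji i4; apply: tP; rewrite /= !inordK // (ltn_trans ji).
pose d := horizontal_block P 0%N 0%N * horizontal_block P 1%N 1%N * horizontal_block P 2 2 * horizontal_block P 3 3.
have d0 : d != 0.
  rewrite /d !mulf_neq0 // /horizontal_block; apply: upper_triangular_diag tP tQ _; exact: mulmxV.
have C2E : C2 *m star6 R *m C2^T = d *: star6 R by apply: compound_star.
(* The horizontal block of the frame only rescales the wedge pairing; the vertical block acts by
   congruence. *)
have ZE : Z = d *: (cm^T *m Z0 *m cm).
  transitivity (cm^T *m w0 *m (C2 *m star6 R *m C2^T) *m (w0^T *m cm)).
    by rewrite /Z wE !trmx_mul trmxK !mulmxA.
  by rewrite C2E -scalemxAr -!scalemxAl /Z0 !mulmxA.
have tcm : upper_triangular cm.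
  by move=> i j ij; rewrite mxE tQ //= ltn_add2l.
have ucm : cm \in unitmx.
  pose pm : 'M[R]_3 := \matrix_(l, k) P (z l) (z k).
  have /mulmx1_unit[] // : cm *m pm = 1%:M.
  apply/matrixP => k l; have /matrixP/(_ (z k) (z l)) := mulVmx uP.
  rewrite mxE sum_split7 big1 ?add0r => [E|i _]; last by rewrite tQ ?hz_ltn // mul0r.
  have -> : (1%:M : 'M[R]_3) k l = (1%:M : 'M[R]_7) (z k) (z l).
    by rewrite !mxE -[z k == z l]val_eqE /= eqn_add2l.
  by rewrite -E mxE; apply: eq_bigr => x _; rewrite !mxE.
have uC2 : C2 \in unitmx.
  have /mulmx1_unit[] // : C2 *m (d^-1 *: (star6 R *m C2^T *m star6 R)) = 1%:M.
  by rewrite -scalemxAr !mulmxA C2E -!scalemxAl star6K scalerA mulVf // scale1r.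
(* N is the Gram matrix of the df^k in the frame, which stay independent. *)
have uN : N \in unitmx.
  apply: gram_unitmx => x; rewrite wE !mulmxA => xw.
  have := congr1 (mulmx^~ (invmx C2)) xw; rewrite /= mulmxK // mul0mx => {}xw.
  have := congr1 (mulmx^~ r) xw; rewrite /= -mulmxA w0r mulmx1 mul0mx => {}xw.
  have uct : cm^T \in unitmx by rewrite unitmx_tr.
  by have := congr1 (mulmx^~ (invmx cm^T)) xw; rewrite /= mulmxK // mul0mx.
have tN : N^T = N by rewrite trmx_mul trmxK.
have tZ : Z^T = Z by rewrite !trmx_mul trmxK star6_sym mulmxA.
apply: (soliton_contradiction uN tN tZ e1 e2 tM trM MM s0 qs) => nZ.
have nZ0 : Z0 != 0 by apply: contraNneq nZ => Z00; rewrite ZE Z00 mulmx0 mul0mx scaler0.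
have [dZ0 mZ0] := hZ0 nZ0; split.
  by rewrite ZE detZ !det_mulmx dZ0 mulr0 mul0r mulr0.
rewrite ZE minors3Z mulf_neq0 ?expf_neq0 // mZ0 //.
by rewrite -unitfE -unitmxE.
Qed.

End Nonexistence.

(** * The structure equations as integer tables *)

Section ConcreteAlgebras.

Variable R : realType.

Local Notation e := (@basis_vec R).
Local Notation h := (@lshift 4 3).
Local Notation z := (@rshift 4 3).

Lemma iprod_monomial1 i j :
  iprod (e i) (monomial R [set j]) = (i == j)%:R *: monomial R set0.
Proof.
apply/ffunP => S; rewrite iprod_basis !ffunE.
have [->|neS] := eqVneq S set0.
  by rewrite in_set0 setU0 shuffle_signs0 mul1r (inj_eq set1_inj) /GRing.scale /= mulr1.
rewrite scaler0; case: ifPn => // iS; case: eqP => [e1|_]; last by rewrite mulr0.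
have : #|i |: S| = 1 by rewrite e1 cards1.
by rewrite cardsU1 iS add1n => -[/eqP]; rewrite cards_eq0 (negPf neS).
Qed.

Lemma iprod_monomial0 i : iprod (e i) (monomial R set0) = 0.
Proof.
apply/ffunP => S; rewrite iprod_basis !ffunE; case: ifP => // _.
case: eqP => [e0|_]; last by rewrite mulr0.
by have := setU11 i S; rewrite e0 inE.
Qed.

Definition fidx (a : nat) : 'I_7 := inord a.-1.

Lemma iprod_wedge_set0 v (a b : ext_alg R) :
  iprod v (wedge a b) set0 = iprod v a set0 * b set0 + a set0 * iprod v b set0.
Proof.
rewrite iprod_wedge ffunE !wedge_set0; congr (_ + _ * _).
by rewrite ffunE cards0 mul1r.
Qed.

Lemma coef2_ff a b i j : coef2 (@ff R a b) i j =
  (i == fidx a)%:R * (j == fidx b)%:R - (i == fidx b)%:R * (j == fidx a)%:R.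
Proof.
have nz x : (set0 == [set x] :> {set 'I_7}) = false.
  by apply/eqP => /setP/(_ x); rewrite set11 in_set0.
rewrite /coef2 /ff iprod_wedge iprodDr [LHS]ffunE !iprod_wedge_set0.
rewrite !iprod_monomial1 !iprodZr !iprod_monomial0 iprod_grade_inv !iprod_monomial1.
rewrite -/(fidx a) -/(fidx b) !ffunE !cards0 !nz !eqxx !scaler0 /GRing.scale /=.
by rewrite expr0; ring.
Qed.

Lemma homog_ff a b : homog 2 (@ff R a b).
Proof.
have h1 (j : 'I_7) : homog 1 (monomial R [set j]).
  by rewrite -[X in homog X](cards1 j); apply: homog_monomial.
exact: (@homog_wedge _ 1 1).
Qed.

Lemma homogN k (a : ext_alg R) : homog k a -> homog k (- a).
Proof. by rewrite -scaleN1r; apply: homogZ. Qed.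

Lemma fidx_z x a : (0 < a <= 4)%N -> (z x == fidx a) = false.
Proof.
move=> /andP[a0 a4]; apply/negP => /eqP/(congr1 val); rewrite /= inordK; lia.
Qed.

Lemma iprod_ff_z x a b : (0 < a <= 4)%N -> (0 < b <= 4)%N -> iprod (e (z x)) (@ff R a b) = 0.
Proof.
move=> a4 b4; rewrite iprod_wedge !iprod_monomial1 -/(fidx a) -/(fidx b).
by rewrite !fidx_z // !scale0r wedge0l wedge0r addr0.
Qed.

Definition horizontal2 (a : ext_alg R) : Prop :=
  homog 2 a /\ forall x, iprod (e (z x)) a = 0.

Lemma horizontal2_ff a b : (0 < a <= 4)%N -> (0 < b <= 4)%N -> horizontal2 (ff a b).
Proof. by move=> a4 b4; split=> [|x]; [exact: homog_ff | exact: iprod_ff_z]. Qed.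

Lemma horizontal2D a b : horizontal2 a -> horizontal2 b -> horizontal2 (a + b).
Proof.
by move=> [ha za] [hb zb]; split=> [|x]; [exact: homogD | rewrite iprodDr za zb addr0].
Qed.

Lemma horizontal2N a : horizontal2 a -> horizontal2 (- a).
Proof.
by move=> [ha za]; split=> [|x]; [exact: homogN | rewrite iprodNr za oppr0].
Qed.

Lemma horizontal20 : horizontal2 0.
Proof. by split=> [|x]; [exact: homog0 | rewrite iprod0r]. Qed.

Definition vertical_eqs (a b c : ext_alg R) : structure_eqs R :=
  [tuple 0; 0; 0; 0; a; b; c].

Lemma vertical_eqsP a b c : horizontal2 a -> horizontal2 b -> horizontal2 c ->
  two_step_eqs (vertical_eqs a b c).
Proof.
move=> ha hb hc.
have H k : horizontal2 (tnth (vertical_eqs a b c) k).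
  case: k => [[|[|[|[|[|[|[|//]]]]]]] k7]; rewrite (tnth_nth 0) /=;
    first [exact: horizontal20 | assumption].
split=> [k|i|x k]; [by case: (H k)| |by case: (H k)].
by case: i => [[|[|[|[|//]]]] i4]; rewrite (tnth_nth 0).
Qed.

Lemma upper_vertical_eqs a b c (k : 'I_3) p : (p < 6)%N ->
  upper (raw (wcoef (vertical_eqs a b c)) k) p =
  coef2 (nth 0 [:: a; b; c] k) (inord (pair4 p).1) (inord (pair4 p).2).
Proof.
move=> p6; have /andP[p1 p2] := pair4_lt p6.
rewrite /upper /raw /wcoef (tnth_nth 0).
congr coef2.
- by apply: val_inj; rewrite /= !inordK ?(leq_trans p1).
- by apply: val_inj; rewrite /= !inordK ?(leq_trans p2).
Qed.

Lemma inord_fidx i a : (i < 7)%N -> (0 < a <= 4)%N -> (inord i == fidx a) = (i.+1 == a)%N.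
Proof. by move=> i7 /andP[a0 a4]; rewrite -val_eqE /= !inordK //; lia. Qed.

Lemma coef2D (a b : ext_alg R) i j : coef2 (a + b) i j = coef2 a i j + coef2 b i j.
Proof. by rewrite /coef2 !iprodDr ffunE. Qed.

Lemma coef2N (a : ext_alg R) i j : coef2 (- a) i j = - coef2 a i j.
Proof. by rewrite /coef2 !iprodNr ffunE. Qed.

(** Matrix identities are checked by computation on integer tables and then mapped to R. Missing
    entries read as 0, so [[::]] is a zero row. *)
Definition entry (t : seq (seq int)) (i j : nat) : int := nth 0 (nth [::] t i) j.

Definition table_mx m n (t : seq (seq int)) : 'M[R]_(m, n) :=
  \matrix_(i, j) (entry t i j)%:~R.

Definition table_rel m n (p : nat -> nat -> bool) : bool :=
  all (fun i => all (p i) (iota 0 n)) (iota 0 m).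

Lemma table_relP m n p : table_rel m n p -> forall (i : 'I_m) (j : 'I_n), p i j.
Proof.
move=> /allP H i j; have /H/allP : val i \in iota 0 m by rewrite mem_iota ltn_ord.
by apply; rewrite mem_iota ltn_ord.
Qed.

Definition tabulate m n (f : nat -> nat -> int) : seq (seq int) :=
  mkseq (fun i => mkseq (f i) n) m.

Lemma table_mx_tabulate m n f : table_mx m n (tabulate m n f) = \matrix_(i, j) (f i j)%:~R.
Proof. by apply/matrixP => i j; rewrite !mxE /entry !nth_mkseq. Qed.

Definition table_mul m n p s t : seq (seq int) :=
  tabulate m p (fun i j => foldr +%R 0 [seq entry s i k * entry t k j | k <- iota 0 n]).

Definition table_tr m n t : seq (seq int) := tabulate n m (fun i j => entry t j i).

Lemma mul_table_mx m n p s t :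
  table_mx m n s *m table_mx n p t = table_mx m p (table_mul m n p s t).
Proof.
rewrite table_mx_tabulate; apply/matrixP => i j; rewrite !mxE.
have iotaE : iota 0 n = index_iota 0 n by rewrite /index_iota subn0.
rewrite foldrE big_map iotaE big_mkord rmorph_sum.
by apply: eq_bigr => k _; rewrite !mxE -intrM.
Qed.

Lemma tr_table_mx m n t : (table_mx m n t)^T = table_mx n m (table_tr m n t).
Proof. by rewrite table_mx_tabulate; apply/matrixP => i j; rewrite !mxE. Qed.

Lemma eq_table_mx m n s t : table_rel m n (fun i j => entry s i j == entry t i j) ->
  table_mx m n s = table_mx m n t.
Proof. by move=> /table_relP H; apply/matrixP => i j; rewrite !mxE (eqP (H i j)). Qed.

Lemma table_scalar n x t : table_rel n n (fun i j => entry t i j == x *+ (i == j)) ->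
  table_mx n n t = x%:~R%:M.
Proof.
move=> /table_relP H; apply/matrixP => i j; rewrite !mxE (eqP (H i j)).
by rewrite (inj_eq val_inj); case: eqP.
Qed.

Definition star6_table : seq (seq int) :=
  [:: [:: 0; 0; 0; 0; 0; 1]; [:: 0; 0; 0; 0; -1; 0]; [:: 0; 0; 0; 1; 0; 0];
      [:: 0; 0; 1; 0; 0; 0]; [:: 0; -1; 0; 0; 0; 0]; [:: 1; 0; 0; 0; 0; 0]].

Lemma star6_table_mx : star6 R = table_mx 6 6 star6_table.
Proof.
apply/matrixP => i j; rewrite !mxE.
case: i => [[|[|[|[|[|[|//]]]]]] ?]; case: j => [[|[|[|[|[|[|//]]]]]] ?];
  by rewrite /star_sign /= ?mul0r ?mul1r.
Qed.

Lemma wmx_vertical_eqs a b c t :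
  (forall k p, (k < 3)%N -> (p < 6)%N ->
     coef2 (nth 0 [:: a; b; c] k) (inord (pair4 p).1) (inord (pair4 p).2) =
     (entry t k p)%:~R) ->
  wmx (wcoef (vertical_eqs a b c)) = table_mx 3 6 t.
Proof.
by move=> h; apply/matrixP => k p; rewrite mxE upper_vertical_eqs // [RHS]mxE h.
Qed.

Ltac table_tac := apply: wmx_vertical_eqs;
  case=> [|[|[|//]]]; case=> [|[|[|[|[|[|//]]]]]] _ _ /=;
  rewrite ?coef2D ?coef2N !coef2_ff !inord_fidx //=;
  rewrite ?mulr1 ?mulr0 ?mul0r ?subr0 ?sub0r ?addr0 ?oppr0 ?add0r //.

Lemma wmx_n63R : wmx (wcoef (n63R R)) =
  table_mx 3 6 [:: [:: 1; 0; 0; 0; 0; 0]; [:: 0; 1; 0; 0; 0; 0]; [:: 0; 0; 0; 1; 0; 0]].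
Proof. by table_tac. Qed.

Lemma wmx_n73A : wmx (wcoef (n73A R)) =
  table_mx 3 6 [:: [:: 1; 0; 0; 0; 0; 0]; [:: 0; 0; 0; 1; 0; 0]; [:: 0; 0; 0; 0; 1; 0]].
Proof. by table_tac. Qed.

Lemma wmx_n73B : wmx (wcoef (n73B R)) =
  table_mx 3 6 [:: [:: 1; 0; 0; 0; 0; 0]; [:: 0; 0; 0; 1; 0; 0]; [:: 0; 0; 0; 0; 0; 1]].
Proof. by table_tac. Qed.

Lemma wmx_n73B1 : wmx (wcoef (n73B1 R)) =
  table_mx 3 6 [:: [:: 1; 0; 0; 0; 0; -1]; [:: 0; 1; 0; 0; 1; 0]; [:: 0; 0; 1; 0; 0; 0]].
Proof. by table_tac. Qed.


Lemma wmx_n73C : wmx (wcoef (n73C R)) =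
  table_mx 3 6 [:: [:: 1; 0; 0; 0; 0; 1]; [:: 0; 0; 0; 1; 0; 0]; [:: 0; 0; 0; 0; 1; 0]].
Proof. by table_tac. Qed.

Lemma wmx_n73D : wmx (wcoef (n73D R)) =
  table_mx 3 6 [:: [:: 1; 0; 0; 0; 0; 1]; [:: 0; 1; 0; 0; 0; 0]; [:: 0; 0; 0; 0; 1; 0]].
Proof. by table_tac. Qed.

Lemma wmx_n73D1 : wmx (wcoef (n73D1 R)) =
  table_mx 3 6 [:: [:: 1; 0; 0; 0; 0; -1]; [:: 0; 1; 0; 0; 1; 0]; [:: 0; 0; 1; -1; 0; 0]].
Proof. by table_tac. Qed.

Lemma two_step_n63R : two_step_eqs (n63R R).
Proof. by apply: vertical_eqsP; apply: horizontal2_ff. Qed.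

Lemma two_step_n73A : two_step_eqs (n73A R).
Proof. by apply: vertical_eqsP; apply: horizontal2_ff. Qed.

Lemma two_step_n73B : two_step_eqs (n73B R).
Proof. by apply: vertical_eqsP; apply: horizontal2_ff. Qed.

Lemma two_step_n73B1 : two_step_eqs (n73B1 R).
Proof.
apply: vertical_eqsP; last exact: horizontal2_ff.
  by apply: horizontal2D; [|apply: horizontal2N]; apply: horizontal2_ff.
by apply: horizontal2D; apply: horizontal2_ff.
Qed.

Definition pairing_table w : seq (seq int) :=
  table_mul 3 6 3 (table_mul 3 6 6 w star6_table) (table_tr 3 6 w).

Lemma table_pairing w : table_mx 3 6 w *m star6 R *m (table_mx 3 6 w)^T =
  table_mx 3 3 (pairing_table w).
Proof. by rewrite star6_table_mx tr_table_mx !mul_table_mx. Qed.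

Lemma upper_triangular_det3 (c : 'M[R]_3) : upper_triangular c -> \det c != 0 ->
  [/\ c 1 0 = 0, c 2%:R 0 = 0 & c 2%:R 1 = 0] /\ [/\ c 0 0 != 0, c 1 1 != 0 & c 2%:R 2%:R != 0].
Proof.
move=> tc; have [c1 c2 c3] : [/\ c 1 0 = 0, c 2%:R 0 = 0 & c 2%:R 1 = 0] by split; apply: tc.
rewrite det3 c1 c2 c3 !(mulr0, subr0, mul0r, addr0) !mulf_eq0 !negb_or.
by move=> /and3P[].
Qed.

Lemma minors3E (A : 'M[R]_3) : minors3 A =
  A 0 0 * A 1 1 - A 0 1 * A 1 0 + (A 0 0 * A 2%:R 2%:R - A 0 2%:R * A 2%:R 0)
  + (A 1 1 * A 2%:R 2%:R - A 1 2%:R * A 2%:R 1).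
Proof. by rewrite /minors3 !mxtrace3 !mxE !sum_ord3; field. Qed.

(** The df^k involve only f^1, f^2 and f^3, so their products vanish and Z = 0. *)
Lemma n63R_not_purely_coclosed G : nilsoliton (n63R R) G ->
  ~ exists phi : ext_alg R, purely_coclosed (n63R R) phi /\ induces phi G.
Proof.
apply: (@no_purely_coclosed _ _ (table_mx 6 3
  [:: [:: 1; 0; 0]; [:: 0; 1; 0]; [::]; [:: 0; 0; 1]])); first exact: two_step_n63R.
  by rewrite wmx_n63R mul_table_mx (@table_scalar _ 1).
rewrite wmx_n63R table_pairing.
by rewrite (@table_scalar _ 0) // raddf0 eqxx.
Qed.

(** All df^k are divisible by f^2, hence Z = 0. *)
Lemma n73A_not_purely_coclosed G : nilsoliton (n73A R) G ->
  ~ exists phi : ext_alg R, purely_coclosed (n73A R) phi /\ induces phi G.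
Proof.
apply: (@no_purely_coclosed _ _ (table_mx 6 3
  [:: [:: 1; 0; 0]; [::]; [::]; [:: 0; 1; 0]; [:: 0; 0; 1]])); first exact: two_step_n73A.
  by rewrite wmx_n73A mul_table_mx (@table_scalar _ 1).
rewrite wmx_n73A table_pairing.
by rewrite (@table_scalar _ 0) // raddf0 eqxx.
Qed.

Lemma n73B_not_purely_coclosed G : nilsoliton (n73B R) G ->
  ~ exists phi : ext_alg R, purely_coclosed (n73B R) phi /\ induces phi G.
Proof.
apply: (@no_purely_coclosed _ _ (table_mx 6 3
  [:: [:: 1; 0; 0]; [::]; [::]; [:: 0; 1; 0]; [::]; [:: 0; 0; 1]])); first exact: two_step_n73B.
  by rewrite wmx_n73B mul_table_mx (@table_scalar _ 1).
(* The only nonzero product is f^{12} ∧ f^{34}: a hyperbolic plane. *)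
rewrite wmx_n73B table_pairing (@eq_table_mx _ _ _ [:: [:: 0; 0; 1]; [::]; [:: 1; 0; 0]]) // => _.
split=> [|c tc /(upper_triangular_det3 tc)[[c1 c2 c3] [d0 d1 d2]]].
  by rewrite det3 !mxE /entry /=; ring.
rewrite minors3E; set B := _ *m c.
have BE i j : B i j = c 0 i * c 2%:R j + c 2%:R i * c 0 j.
  by rewrite 2!(mxE, sum_ord3) !(mxE, sum_ord3) /entry /=; ring.
rewrite !BE ?c1 ?c2 ?c3 => {BE B}.
(* Minus the squared area spanned by rows 0 and 2 of c. *)
rewrite [X in X != _](_ : _ = - ((c 0 0 ^+ 2 + c 0 1 ^+ 2) * c 2%:R 2%:R ^+ 2)); last by ring.
by rewrite oppr_eq0 mulf_neq0 ?sqrf_eq0 // paddr_eq0 ?sqr_ge0 // sqrf_eq0 negb_and d0.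
Qed.

Lemma n73B1_not_purely_coclosed G : nilsoliton (n73B1 R) G ->
  ~ exists phi : ext_alg R, purely_coclosed (n73B1 R) phi /\ induces phi G.
Proof.
apply: (@no_purely_coclosed _ _ (table_mx 6 3
  [:: [:: 1; 0; 0]; [:: 0; 1; 0]; [:: 0; 0; 1]])); first exact: two_step_n73B1.
  by rewrite wmx_n73B1 mul_table_mx (@table_scalar _ 1).
(* The first two df^k are orthogonal anti-self-dual forms, and f^{14} is isotropic and pairs to 0
   with both. *)
rewrite wmx_n73B1 table_pairing (@eq_table_mx _ _ _ [:: [:: -2; 0; 0]; [:: 0; -2; 0]; [::]]) // => _.
split=> [|c tc /(upper_triangular_det3 tc)[[c1 c2 c3] [d0 d1 d2]]].
  by rewrite det3 !mxE /entry /=; ring.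
rewrite minors3E; set B := _ *m c.
have BE i j : B i j = - 2 * (c 0 i * c 0 j + c 1 i * c 1 j).
  by rewrite 2!(mxE, sum_ord3) !(mxE, sum_ord3) /entry /=; ring.
rewrite !BE ?c1 ?c2 ?c3 => {BE B}.
(* Four times the squared length of the vector product of rows 0 and 1 of c. *)
rewrite [X in X != _](_ : _ = 4 * ((c 0 0 * c 1 1) ^+ 2 + ((c 0 0 * c 1 2%:R) ^+ 2 +
  (c 0 1 * c 1 2%:R - c 0 2%:R * c 1 1) ^+ 2))); last by ring.
rewrite mulf_neq0 ?pnatr_eq0 // paddr_eq0 ?addr_ge0 ?sqr_ge0 //.
by rewrite sqrf_eq0 mulf_eq0 negb_and negb_or d0 d1.
Qed.

End ConcreteAlgebras.

(** * Existence *)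

Section PullBackStructure.

Variable R : realType.
Implicit Types (L : structure_eqs R) (phi a b vol : ext_alg R) (G P : 'M[R]_7).

Local Notation e := (@basis_vec R).
Local Notation h := (@lshift 4 3).
Local Notation z := (@rshift 4 3).

Lemma inner_product1 : inner_product (1%:M : 'M[R]_7).
Proof.
split=> [|v v0]; first exact: trmx1.
rewrite /metric mulmx1 lt0r; apply/andP; split; last first.
  by rewrite mxE sumr_ge0 // => i _; rewrite mxE -expr2 sqr_ge0.
apply: contraNneq v0 => v0; apply/eqP/rV_dot_eq0; apply/matrixP => i j.
by rewrite !ord1 v0 mxE.
Qed.

Lemma homog7_eq a b : homog 7 a -> homog 7 b -> a [set: 'I_7] = b [set: 'I_7] -> a = b.
Proof.
move=> ha hb ab; apply/eqP; rewrite -subr_eq0; apply/eqP/homog7_eq0.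
  by apply: homogD => //; apply: homogN.
by rewrite !ffunE ab subrr.
Qed.

Lemma homog_setT : homog 7 (monomial R [set: 'I_7]).
Proof. by have := @homog_monomial R [set: 'I_7]; rewrite cardsT card_ord. Qed.

(** With Q the inverse of P, the Gram matrix Q Q^T is the one that makes the rows of P
    orthonormal. *)
Lemma G2_frame_metric_volume P phi : P \in unitmx -> G2_frame phi 1 ->
  G2_metric_volume (pull (invmx P) phi) (invmx P *m (invmx P)^T)
    (pull (invmx P) (monomial R [set: 'I_7])).
Proof.
move=> uP fr; have [h3 _ _] := fr; have uQ : invmx P \in unitmx by rewrite unitmx_inv.
have iG : inner_product (invmx P *m (invmx P)^T).
  by rewrite -{1}[invmx P]mulmx1; apply: inner_product_conj uQ inner_product1.
split=> // [|v w].
  split; first exact/pull_homog/homog_setT.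
  have -> : invmx P *m (invmx P)^T = invmx P *m 1%:M *m (invmx P)^T by rewrite mulmx1.
  rewrite form_inner_pull ?unitmx1 // form_inner1 /dot (bigD1 [set: 'I_7]) //= big1 => [|S /negPf nS].
    by rewrite !ffunE eqxx mulr1 addr0.
  by rewrite !ffunE nS mul0r.
apply: homog7_eq.
- exact/homogZ/pull_homog/homog_setT.
- apply/homogZ/(@homog_wedge _ 4 3); last exact: pull_homog.
  by apply: (@homog_wedge _ 2 2); apply/homog_iprod/pull_homog.
rewrite [LHS]ffunE [RHS]ffunE !iprod_pull -/(top3 _ _ _) top3_pull pull_setT.
rewrite (G2_frame_form _ _ fr) /metric /GRing.scale /= ffunE eqxx trmx_mul !mulmxA.
have aux (x y : R) : x * (y * 1) = 6^-1 * (y * (6 * 1 * x)) by field.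
exact: aux.
Qed.

Lemma G2_metric_volume_structure phi G vol : homog 3 phi ->
  G2_metric_volume phi G vol -> G2_structure phi.
Proof.
move=> h3 [[_ pG] vG bG]; split=> // v v0.
apply: contraTneq (pG v v0) => w0; have := bG v v; rewrite w0 scaler0.
move=> /ffunP/(_ [set: 'I_7])/eqP; rewrite !ffunE mulf_eq0 (negPf (volume_form_setT vG)) orbF.
by move=> /eqP ->; rewrite ltxx.
Qed.

Lemma purely_coclosed_frame P L phi : P \in unitmx -> two_step_eqs L ->
  G2_frame phi 1 ->
  (forall i k, torsion_mx (transport P L) phi k i = torsion_mx (transport P L) phi i k) ->
  \tr (torsion_mx (transport P L) phi) = 0 ->
  nilsoliton (transport P L) 1%:M ->
  exists (phi : ext_alg R) (G : 'M[R]_7),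
    [/\ purely_coclosed L phi, induces phi G & nilsoliton L G].
Proof.
move=> uP tL fr symT trT nT; have [h3 _ _] := fr; have [hL _ _] := tL.
pose Q := invmx P; have uQ : Q \in unitmx by rewrite unitmx_inv.
have mv := G2_frame_metric_volume uP fr; have [iG vG _] := mv.
have h3' : homog 3 (pull Q phi) by apply: pull_homog.
exists (pull Q phi), (Q *m Q^T); split; last 2 first.
- by exists (pull Q (monomial R [set: 'I_7])).
- rewrite -[Q *m _]/(Q *m Q^T) -{1}[Q]mulmx1.
  exact: lie_iso_nilsoliton uQ (lie_iso_inv uP (lie_iso_transport L uP)) nT.
split; first exact: G2_metric_volume_structure h3' mv.
  exists (Q *m Q^T), (pull Q (monomial R [set: 'I_7])); split=> //.
  apply/coclosed_dual => //; [exact: two_step_unimodular | by case: vG | exact: volume_form_setT vG | ].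
  apply/(coclosed_frame (P := P)) => //; first exact: inner_product_unitmx.
    by rewrite mulmxA mulmxV // mul1mx -trmx_mul mulmxV // trmx1.
  by rewrite pullVK.
have hL' k : homog 2 (tnth (transport P L) k).
  by rewrite transportE; apply: homog_sum => i; apply/homogZ/pull_homog.
apply: homog7_eq0.
  by apply: (@homog_wedge _ 4 3) => //; apply: homog_ext_d.
have [s s0 [_ star]] := G2_frame_contraction fr.
have := torsion_trace hL' star; rewrite trT mulr0.
rewrite -{1 2}(pullVK phi uP) -pull_ext_d // -pull_wedge pull_setT => /eqP.
by rewrite mulf_eq0 -[_ == 0]negbK -unitfE -unitmxE uP => /eqP.
Qed.

End PullBackStructure.

(** * Three-forms with integer coefficients *)

Section IntegralForms.

Variable R : realType.

Local Notation e := (@basis_vec R).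
Local Notation h := (@lshift 4 3).
Local Notation z := (@rshift 4 3).

Definition terms_coef (t : seq (int * seq nat)) (i j k : nat) : int :=
  foldr +%R 0 [seq x.1 * (x.2 == [:: i; j; k])%:Z | x <- t].

Definition terms_form (t : seq (int * seq nat)) : ext_alg R :=
  \sum_(x <- t) (x.1%:~R : R) *: monomial R (nat_set x.2).

Definition triples7 (t : seq (int * seq nat)) : bool :=
  all (fun x => [&& sorted ltn x.2, size x.2 == 3 & all (fun i => i < 7) x.2])%N t.

Lemma nat_set_inj s t : sorted ltn s -> sorted ltn t ->
  all (fun i => i < 7)%N s -> all (fun i => i < 7)%N t -> nat_set s = nat_set t -> s = t.
Proof.
move=> ss st s7 t7 st'; apply: (irr_sorted_eq ltn_trans ltnn ss st) => x.
have [x7|x7] := ltnP x 7; first by rewrite -!in_nat_set // st'.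
by apply/idP/idP => [/(allP s7)|/(allP t7)]; rewrite ltnNge x7.
Qed.

Lemma homog_terms_form t : triples7 t -> homog 3 (terms_form t).
Proof.
elim: t => [_|x t IH /= /andP[/and3P[sx /eqP zx x7] tt]].
  by rewrite /terms_form big_nil; apply: homog0.
rewrite /terms_form big_cons; apply: homogD; last exact: IH.
apply: homogZ; rewrite -zx -(card_nat_set _ x7); first exact: homog_monomial.
exact: sorted_uniq ltn_trans ltnn _ sx.
Qed.

Lemma coefs_terms_form t i j k : triples7 t -> (i < j)%N -> (j < k)%N -> (k < 7)%N ->
  coefs (terms_form t) i j k = (terms_coef t i j k)%:~R.
Proof.
move=> h3 ij jk k7; rewrite -coefs_nat_set // /terms_form.
elim: t h3 => [_|x t IH /= /andP[/and3P[sx zx x7] tt]].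
  by rewrite big_nil ffunE.
rewrite big_cons /terms_coef /= -/(terms_coef t i j k) 2!ffunE ffunE intrD IH //.
congr (_ + _); rewrite intrM; congr (_ * _).
suff -> : (nat_set [:: i; j; k] == nat_set x.2) = (x.2 == [:: i; j; k]) by case: eqP.
apply/eqP/eqP => [E|-> //]; apply: nat_set_inj => //=; first by rewrite ij jk.
by rewrite k7 (ltn_trans jk k7) (ltn_trans ij (ltn_trans jk k7)).
Qed.

Lemma alt3_intr (T : nat -> nat -> nat -> R) (c : nat -> nat -> nat -> int) i j k :
  (i < 7)%N -> (j < 7)%N -> (k < 7)%N ->
  (forall i j k, (i < j)%N -> (j < k)%N -> (k < 7)%N -> T i j k = (c i j k)%:~R) ->
  alt3 -%R 0 T i j k = (alt3 -%R 0 c i j k)%:~R.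
Proof.
move=> i7 j7 k7 Tc; rewrite /alt3.
by case: (ltngtP i j) => ij; case: (ltngtP j k) => jk; case: (ltngtP i k) => ik //;
  rewrite ?rmorphN /= ?Tc //; lia.
Qed.

Lemma coef3_terms_form t i j k : triples7 t ->
  coef3 (terms_form t) i j k = (alt3 -%R 0 (terms_coef t) i j k)%:~R.
Proof.
move=> h3; rewrite -alt3_coefs; apply: alt3_intr => // *.
exact: coefs_terms_form.
Qed.

Lemma top3_poly_intr (f g : nat -> nat -> int) (c : nat -> nat -> nat -> int) :
  top3_poly +%R *%R -%R 0 (fun i j => (f i j)%:~R) (fun i j => (g i j)%:~R)
    (fun i j k => (c i j k)%:~R) = (top3_poly +%R *%R -%R 0 f g c)%:~R :> R.
Proof.
rewrite /top3_poly !sum_ofE; elim: shuffles223 => [|x s IH]; first by rewrite /= big_nil.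
rewrite big_cons IH [in RHS]/= rmorphD; congr (_ + _).
by rewrite /signed; case: ifP => _; rewrite ?rmorphN !rmorphM.
Qed.

Lemma terms_form_frame t : triples7 t ->
  table_rel 7 7 (fun k l =>
    metric_poly +%R *%R -%R 0 (terms_coef t) k l == 6%:Z *+ (k == l)) ->
  G2_frame (terms_form t) 1.
Proof.
move=> t3 /table_relP H; have h3 := homog_terms_form t3; split=> // [|k l].
  exact: oner_neq0.
have h2 i : homog 2 (iprod (e i) (terms_form t)) by apply: homog_iprod.
rewrite top3_polyE // mulr1 -[k == l]val_eqE.
transitivity ((metric_poly +%R *%R -%R 0 (terms_coef t) k l)%:~R : R); last first.
  by rewrite (eqP (H k l)); case: eqP => _; rewrite ?mulr1 ?mulr0.
rewrite -top3_poly_intr; apply: eq_top3_poly => [i j i7 j7|i j i7 j7|a b c a7 b7 c7].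
- by rewrite -[coefs2 _ _ _]/(coef3 (terms_form t) k (inord i) (inord j)) coef3_terms_form // !inordK.
- by rewrite -[coefs2 _ _ _]/(coef3 (terms_form t) l (inord i) (inord j)) coef3_terms_form // !inordK.
by rewrite /coefs coef3_terms_form // !inordK.
Qed.

End IntegralForms.

(** * Explicit frames for the three remaining algebras *)

Section Existence.

Variable R : realType.

Local Notation e := (@basis_vec R).
Local Notation h := (@lshift 4 3).
Local Notation z := (@rshift 4 3).

(* f^567 - f^5 (f^12 + f^34) - f^6 (f^13 - f^24) - f^7 (f^14 + f^23); here the
   indices start from 0 *)
Definition G2_terms : seq (int * seq nat) :=
  [:: (-1, [:: 0; 1; 4]%N); (-1, [:: 2; 3; 4]%N); (-1, [:: 0; 2; 5]%N); (1, [:: 1; 3; 5]%N);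
      (-1, [:: 0; 3; 6]%N); (-1, [:: 1; 2; 6]%N); (1, [:: 4; 5; 6]%N)].

Lemma G2_terms_frame : G2_frame (terms_form R G2_terms) 1.
Proof. by apply: terms_form_frame; vm_compute. Qed.

(** The cross products of pairs from r for the explicit phi; multiplied by w, they give the torsion
    rows of n'. *)
Definition contraction_table : seq (seq int) :=
  tabulate 6 7 (fun p m => alt3 -%R 0 (terms_coef G2_terms) (pair4 p).1 (pair4 p).2 m).

Lemma torsion_table L w k m : two_step_eqs L -> wmx (wcoef L) = table_mx R 3 6 w ->
  torsion_mx L (terms_form R G2_terms) (z k) m =
  (entry (table_mul 3 6 7 w contraction_table) k m)%:~R.
Proof.
move=> tL wE; rewrite torsion_zE // wE.
rewrite (_ : \matrix_(p, m) _ = table_mx R 6 7 contraction_table).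
  by rewrite mul_table_mx mxE.
apply/matrixP => p j; rewrite table_mx_tabulate !mxE coef3_terms_form //.
by have /andP[p1 p2] := pair4_lt (ltn_ord p); rewrite /= !inordK.
Qed.

Lemma torsion_table_sym L w (u := table_mul 3 6 7 w contraction_table) :
  two_step_eqs L -> wmx (wcoef L) = table_mx R 3 6 w ->
  table_rel 3 4 (fun k m => entry u k m == 0) ->
  table_rel 3 3 (fun k l => entry u k (4 + l) == entry u l (4 + k)) ->
  entry u 0 4 + entry u 1 5 + entry u 2 6 = 0 ->
  (forall i k, torsion_mx L (terms_form R G2_terms) k i =
     torsion_mx L (terms_form R G2_terms) i k) /\
  \tr (torsion_mx L (terms_form R G2_terms)) = 0.
Proof.
move=> tL wE /table_relP u0 /table_relP usym utr; have [_ Lh _] := tL.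
have Mh i m : torsion_mx L (terms_form R G2_terms) (h i) m = 0.
  by rewrite mxE Lh /dot big1 // => S _; rewrite ffunE mul0r.
have Mz k m : torsion_mx L (terms_form R G2_terms) (z k) m = (entry u k m)%:~R.
  exact: torsion_table.
split=> [i k|].
  move: i k; apply: split7P => i; apply: split7P => k; rewrite ?Mh ?Mz //=.
  - by rewrite (eqP (u0 _ _)).
  - by rewrite (eqP (u0 _ _)).
  by rewrite (eqP (usym _ _)).
rewrite /mxtrace sum_split7 big1 ?add0r => [|i _]; last exact: Mh.
by rewrite sum_ord3 !Mz /= -!rmorphD /= -[RHS]/(0%:~R) -utr.
Qed.

Lemma nilsoliton_table L w (wN := table_mul 3 3 6 (table_mul 3 6 3 w (table_tr 3 6 w)) w)
    (wZ := table_mul 3 6 6 (table_mul 3 3 6 (pairing_table w) w) star6_table) :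
  two_step_eqs L -> wmx (wcoef L) = table_mx R 3 6 w ->
  table_rel 3 6 (fun i j => 2 * entry wN i j - entry wZ i j == 2 * entry w i j) ->
  nilsoliton L 1%:M.
Proof.
move=> tL wE /table_relP H; apply/nilsoliton_soliton_eq => //.
set N := wmx (wcoef L) *m (wmx (wcoef L))^T.
(* All three frames are scaled so that mu = 2; this is the c with 2 c - tr N = 2. *)
exists (2^-1 * (2 + \tr N)); apply/(soliton_matrix_eq _ (@wcoef_skew R L)).
rewrite mulVKf ?pnatr_eq0 // addrK wE table_pairing star6_table_mx tr_table_mx !mul_table_mx.
apply/matrixP => i j; rewrite !mxE -/wN -/wZ.
have := congr1 (fun x : int => x%:~R : R) (eqP (H i j)).
by rewrite rmorphB !rmorphM.
Qed.

Definition compound_table a : seq (seq int) := tabulate 6 6 (fun p q =>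
  entry a (pair4 q).1 (pair4 p).1 * entry a (pair4 q).2 (pair4 p).2
  - entry a (pair4 q).1 (pair4 p).2 * entry a (pair4 q).2 (pair4 p).1).

Lemma frame_of_table L a v v' (x : int) w0 w :
  two_step_eqs L -> wmx (wcoef L) = table_mx R 3 6 w0 ->
  table_rel 4 4 (fun i j => entry (table_mul 4 4 4 a a) i j == 1 *+ (i == j)) ->
  x != 0 -> table_rel 3 3 (fun i j => entry (table_mul 3 3 3 v v') i j == x *+ (i == j)) ->
  table_rel 3 6 (fun i j => entry (table_mul 3 6 6 (table_mul 3 3 6 (table_tr 3 3 v) w0)
    (compound_table a)) i j == entry w i j) ->
  exists2 P, P \in unitmx & two_step_eqs (transport P L) /\
    wmx (wcoef (transport P L)) = table_mx R 3 6 w.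
Proof.
move=> tL wE aa x0 vv ww; pose A := table_mx R 4 4 a; pose V := table_mx R 3 3 v.
have AA : A *m A = 1%:M by rewrite mul_table_mx (table_scalar _ aa).
have uV : V \in unitmx.
  have /mulmx1_unit[] // : V *m (x%:~R^-1 *: table_mx R 3 3 v') = 1%:M.
  rewrite -scalemxAr mul_table_mx (table_scalar _ vv) scale_scalar_mx mulVf //.
  by rewrite intr_eq0.
pose Q : 'M[R]_7 := block_mx A 0 0 V; pose P : 'M[R]_7 := block_mx A 0 0 (invmx V).
have PQ : P *m Q = 1%:M.
  rewrite [LHS](@mulmx_block _ 4 3 4 3 4 3) !mulmx0 !mul0mx !addr0 add0r AA mulVmx //.
  by rewrite -scalar_mx_block.
have [uP uQ] := mulmx1_unit PQ.
have QE : invmx P = Q by rewrite -[Q]mul1mx -(mulVmx uP) -mulmxA PQ mulmx1.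
exists P => //; split.
  apply: two_step_transport => // k i; rewrite ?QE.
    by rewrite [LHS](@block_mxEdl _ 4 3 4 3) mxE.
  by rewrite [LHS](@block_mxEdl _ 4 3 4 3) mxE.
rewrite wmx_transport // QE wE.
have -> : (\matrix_(l, k) Q (z l) (z k)) = V.
  by apply/matrixP => l k; rewrite [LHS]mxE [LHS](@block_mxEdr _ 4 3 4 3).
have hE i j : (i < 4)%N -> (j < 4)%N -> horizontal_block P i j = (entry a i j)%:~R.
  move=> i4 j4; rewrite /horizontal_block [LHS](@block_mxEul _ 4 3 4 3) mxE.
  by rewrite !inordK.
have -> : compound_mx (horizontal_block P) = table_mx R 6 6 (compound_table a).
  apply/matrixP => p q; rewrite table_mx_tabulate !mxE /compound.
  have /andP[p1 p2] := pair4_lt (ltn_ord p); have /andP[q1 q2] := pair4_lt (ltn_ord q).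
  by rewrite !hE // rmorphB !rmorphM.
by rewrite tr_table_mx !mul_table_mx; apply: eq_table_mx.
Qed.

(* The frame has horizontal block a = a^-1 and vertical block v^-1 = v' / x; w0 and w
   are the coefficients of the df^k in the standard basis and in the frame. *)
Definition frame_check a v v' (x : int) w0 w : bool :=
  let u := table_mul 3 6 7 w contraction_table in
  let wN := table_mul 3 3 6 (table_mul 3 6 3 w (table_tr 3 6 w)) w in
  let wZ := table_mul 3 6 6 (table_mul 3 3 6 (pairing_table w) w) star6_table in
  [&& table_rel 4 4 (fun i j => entry (table_mul 4 4 4 a a) i j == 1 *+ (i == j)),
    x != 0, table_rel 3 3 (fun i j => entry (table_mul 3 3 3 v v') i j == x *+ (i == j)),
    table_rel 3 6 (fun i j => entry (table_mul 3 6 6 (table_mul 3 3 6 (table_tr 3 3 v) w0)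
      (compound_table a)) i j == entry w i j),
    table_rel 3 6 (fun i j => 2 * entry wN i j - entry wZ i j == 2 * entry w i j),
    table_rel 3 4 (fun k m => entry u k m == 0),
    table_rel 3 3 (fun k l => entry u k (4 + l) == entry u l (4 + k)) &
    entry u 0 4 + entry u 1 5 + entry u 2 6 == 0].

Lemma exists_of_table L a v v' x w0 w :
  two_step_eqs L -> wmx (wcoef L) = table_mx R 3 6 w0 -> frame_check a v v' x w0 w ->
  exists (phi : ext_alg R) (G : 'M[R]_7),
    [/\ purely_coclosed L phi, induces phi G & nilsoliton L G].
Proof.
move=> tL wE /andP[aa /andP[x0 /and5P[vv ww nw u0 /andP[us /eqP ut]]]].
have [P uP [tL' wE']] := frame_of_table tL wE aa x0 vv ww.
have [symT trT] := torsion_table_sym tL' wE' u0 us ut.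
exact: purely_coclosed_frame uP tL G2_terms_frame symT trT (nilsoliton_table tL' wE' nw).
Qed.

(** The 2-forms multiplying f^5, f^6, f^7 in phi are self-dual. Reversing e_4 makes df^5
    anti-self-dual, hence orthogonal to them, and M has only the entries M_67 = M_76 = -1. *)
Lemma n73C_purely_coclosed : exists (phi : ext_alg R) (G : 'M[R]_7),
  [/\ purely_coclosed (n73C R) phi, induces phi G & nilsoliton (n73C R) G].
Proof.
apply: (@exists_of_table _
  [:: [:: 1; 0; 0; 0]; [:: 0; 1; 0; 0]; [:: 0; 0; 1; 0]; [:: 0; 0; 0; -1]]
  [:: [:: 1; 0; 0]; [:: 0; 1; 0]; [:: 0; 0; 1]]
  [:: [:: 1; 0; 0]; [:: 0; 1; 0]; [:: 0; 0; 1]] 1 _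
  [:: [:: 1; 0; 0; 0; 0; -1]; [:: 0; 0; 0; 1; 0; 0]; [:: 0; 0; 0; 0; -1; 0]] _ (@wmx_n73C R)).
  by apply: vertical_eqsP; [apply: horizontal2D|..]; apply: horizontal2_ff.
by vm_compute.
Qed.

(** The vertical block replaces f^{13} and f^{24} by the self-dual f^{24} - f^{13} and the
    anti-self-dual f^{13} + f^{24}, all three df^k getting the same length; M is diagonal with
    entries -2, 2, 0. *)
Lemma n73D_purely_coclosed : exists (phi : ext_alg R) (G : 'M[R]_7),
  [/\ purely_coclosed (n73D R) phi, induces phi G & nilsoliton (n73D R) G].
Proof.
apply: (@exists_of_table _
  [:: [:: 1; 0; 0; 0]; [:: 0; 1; 0; 0]; [:: 0; 0; 1; 0]; [:: 0; 0; 0; 1]]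
  [:: [:: 1; 0; 0]; [:: 0; -1; 1]; [:: 0; 1; 1]]
  [:: [:: 2; 0; 0]; [:: 0; -1; 1]; [:: 0; 1; 1]] 2 _
  [:: [:: 1; 0; 0; 0; 0; 1]; [:: 0; -1; 0; 0; 1; 0]; [:: 0; 1; 0; 0; 1; 0]] _ (@wmx_n73D R)).
  by apply: vertical_eqsP; [apply: horizontal2D|..]; apply: horizontal2_ff.
by vm_compute.
Qed.

(** In the standard frame the df^k are anti-self-dual, orthogonal to the self-dual forms in phi, so
    that M = 0. *)
Lemma n73D1_purely_coclosed : exists (phi : ext_alg R) (G : 'M[R]_7),
  [/\ purely_coclosed (n73D1 R) phi, induces phi G & nilsoliton (n73D1 R) G].
Proof.
apply: (@exists_of_table _
  [:: [:: 1; 0; 0; 0]; [:: 0; 1; 0; 0]; [:: 0; 0; 1; 0]; [:: 0; 0; 0; 1]]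
  [:: [:: 1; 0; 0]; [:: 0; 1; 0]; [:: 0; 0; 1]]
  [:: [:: 1; 0; 0]; [:: 0; 1; 0]; [:: 0; 0; 1]] 1 _
  [:: [:: 1; 0; 0; 0; 0; -1]; [:: 0; 1; 0; 0; 1; 0]; [:: 0; 0; 1; -1; 0; 0]] _ (@wmx_n73D1 R)).
  apply: vertical_eqsP.
  - by apply: horizontal2D; [|apply: horizontal2N]; apply: horizontal2_ff.
  - by apply: horizontal2D; apply: horizontal2_ff.
  by apply: horizontal2D; [|apply: horizontal2N]; apply: horizontal2_ff.
by vm_compute.
Qed.

End Existence.

Theorem corollary5p11 (R : realType) :
  (forall L : structure_eqs R, L \in [:: n73C R; n73D R; n73D1 R] ->
     exists (phi : ext_alg R) (G : 'M[R]_7),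
       [/\ purely_coclosed L phi, induces phi G & nilsoliton L G])
  /\
  (forall L : structure_eqs R, L \in [:: n63R R; n73A R; n73B R; n73B1 R] ->
     forall G : 'M[R]_7, nilsoliton L G ->
       ~ exists phi : ext_alg R, purely_coclosed L phi /\ induces phi G).
Proof.
split=> L; rewrite !inE.
  move=> /or3P[] /eqP ->; [exact: n73C_purely_coclosed | exact: n73D_purely_coclosed |].
  exact: n73D1_purely_coclosed.
move=> /or4P[] /eqP -> G.
- exact: n63R_not_purely_coclosed.
- exact: n73A_not_purely_coclosed.
- exact: n73B_not_purely_coclosed.
exact: n73B1_not_purely_coclosed.
Qed.
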